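(* Let $\nu>0$ be real and let $z\neq0$ be complex with $|\arg z|\le\pi$. Then $$\frac{\partial K_\nu(z)}{\partial\nu}=2\nu\left[K_\nu(z)\int_z^\infty\frac{I_\nu(t)K_\nu(t)}{t}\,dt-I_\nu(z)\int_z^\infty\frac{K_\nu^2(t)}{t}\,dt\right].$$
   Context: $I_\nu(z)=(z/2)^\nu\sum_{k\ge0}\frac{(z/2)^{2k}}{k!\,\Gamma(\nu+k+1)}$ is the modified Bessel function and $K_\nu(z)=\frac\pi2\frac{I_{-\nu}(z)-I_\nu(z)}{\sin\pi\nu}$ for $\nu\notin\mathbb{Z}$ (defined by the limit in $\nu$ for integral $\nu$) is the Macdonald function. Multivalued functions take their principal values, with $\arg z=\pm\pi$ understood as the continuous boundary values from above/below the cut $(-\infty,0]$. Integrals $\int_z^\infty$ are along paths in $|\arg t|\le\pi$, $t\ne0$, ending at $+\infty$ along the positive real direction. $\partial/\partial\nu$ is the derivative with respect to the order at fixed $z$. *)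

(* Defs.v *)
(* Stdlib reals with Coquelicot. *)
From Stdlib Require Import Reals Factorial Lra.
From Coquelicot Require Import Coquelicot.

Open Scope R_scope.

(* Gauss's limit n! n^x / (x (x+1) ... (x+n)), valid at every real x that is
   not a pole.  At the poles x = 0, -1, -2, ... the terms eventually have a
   zero denominator, so that Gamma x = 0 and / Gamma x = 0 there (/ 0 = 0),
   in accordance with the zeros of the entire function 1 / Gamma. *)
Definition Gamma (x : R) : R :=
  real (Lim_seq (fun n : nat =>
    INR (fact n) * Rpower (INR n) x / prod_f_R0 (fun k : nat => x + INR k) n)).

Definition CSeries (u : nat -> C) : C :=
  (Series (fun k => Re (u k)), Series (fun k => Im (u k))).

(* Lim does not look at the value at x itself. *)
Definition CLim (f : R -> C) (x : R) : C :=
  (real (Lim (fun y => Re (f y)) x), real (Lim (fun y => Im (f y)) x)).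

Definition CDerive (f : R -> C) (s : R) : C :=
  (Derive (fun y => Re (f y)) s, Derive (fun y => Im (f y)) s).

(* A point of the closed cut plane |arg z| <= PI, z <> 0, is given by z together
   with its argument a, a number with |a| <= PI and is_arg z a.  For z off
   the negative axis a is determined by z and is the principal argument; for
   z < 0 the two choices a = PI and a = - PI are the points on the upper
   and on the lower side of the cut.  A multivalued function is a function of
   the pair (z, a), which takes at a = +/- PI its boundary values from above
   and below. *)
Definition is_arg (z : C) (a : R) : Prop :=
  z = (Cmod z * cos a, Cmod z * sin a).

(* z ^ nu = |z| ^ nu * exp (i nu arg z) *)
Definition Cpower (z : C) (a nu : R) : C :=
  (Rpower (Cmod z) nu * cos (nu * a), Rpower (Cmod z) nu * sin (nu * a)).

(* z / 2 has the same argument as z. *)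
Definition BesselI (nu : R) (z : C) (a : R) : C :=
  (Cpower (z / 2) a nu *
   CSeries (fun k : nat =>
     (z / 2) ^ (2 * k) / RtoC (INR (fact k) * Gamma (nu + INR k + 1))))%C.

Definition BesselK_nonint (nu : R) (z : C) (a : R) : C :=
  (RtoC (PI / 2) * ((BesselI (- nu) z a - BesselI nu z a) / RtoC (sin (PI * nu))))%C.

(* frac_part nu = 0 if and only if nu is an integer. *)
Definition BesselK (nu : R) (z : C) (a : R) : C :=
  if Req_dec_T (frac_part nu) 0
  then CLim (fun mu => BesselK_nonint mu z a) nu
  else BesselK_nonint nu z a.

Definition C1_on (t : R -> C) (a b : R) : Prop :=
  exists g dg : R -> C,
    (forall s, is_derive (K := R_AbsRing) (V := C_R_NormedModule) g s (dg s)) /\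
    (forall s, continuous (U := C_UniformSpace) dg s) /\
    (forall s, a <= s <= b -> t s = g s).

Definition piecewise_C1 (t : R -> C) : Prop :=
  exists sigma : nat -> R,
    sigma O = 0 /\
    (forall n, sigma n < sigma (S n)) /\
    is_lim_seq sigma p_infty /\
    (forall n, C1_on t (sigma n) (sigma (S n))).

(* t, with argument a, is a path parametrized by [0, +oo[ in |arg t| <= PI,
   t <> 0, from the point (z, theta) to +oo in the positive real direction.
   Continuity of a prevents the path from jumping across the cut. *)
Record path_to_infty (z : C) (theta : R) (t : R -> C) (a : R -> R) : Prop := {
  path_start : t 0 = z /\ a 0 = theta;
  path_C1 : piecewise_C1 t;
  path_arg_cont : continuous_on (fun s => 0 <= s) a;
  path_domain : forall s, 0 <= s ->
    t s <> 0%C /\ Rabs (a s) <= PI /\ is_arg (t s) (a s);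
  path_end_mod : is_lim (fun s => Cmod (t s)) p_infty p_infty;
  path_end_arg : is_lim a p_infty 0 }.

(* J is the (improper) integral of f from (z, theta) to +oo, along whichever
   path; path_to_infty_exists below shows that there is one. *)
Definition is_int_to_infty (f : C -> R -> C) (z : C) (theta : R) (J : C) : Prop :=
  forall (t : R -> C) (a : R -> R), path_to_infty z theta t a ->
    is_RInt_gen (V := C_R_NormedModule)
      (fun s => (f (t s) (a s) * CDerive t s)%C)
      (at_point 0) (Rbar_locally p_infty) J.

Lemma pair_basis (u v : R) :
  plus (G := C_R_NormedModule)
    (scal (V := C_R_NormedModule) u (1, 0))
    (scal (V := C_R_NormedModule) v (0, 1)) = (u, v).
Proof.
apply injective_projections; cbn; unfold mult, plus; cbn; ring.
Qed.

Lemma is_derive_pair (f g : R -> R) (s df dg : R) :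
  is_derive f s df -> is_derive g s dg ->
  is_derive (K := R_AbsRing) (V := C_R_NormedModule)
    (fun y => (f y, g y)) s (df, dg).
Proof.
intros Hf Hg. rewrite <- pair_basis.
apply is_derive_ext with (fun y => plus (G := C_R_NormedModule)
  (scal (V := C_R_NormedModule) (f y) (1, 0))
  (scal (V := C_R_NormedModule) (g y) (0, 1))).
- intro y. apply pair_basis.
- apply (is_derive_plus (V := C_R_NormedModule));
    apply (is_derive_scal_l (V := C_R_NormedModule)); assumption.
Qed.

Lemma continuous_pair (f g : R -> R) (s : R) :
  continuous f s -> continuous g s ->
  continuous (U := C_UniformSpace) (fun y => (f y, g y)) s.
Proof.
intros Hf Hg. apply continuous_ext with (fun y => plus (G := C_R_NormedModule)
  (scal (V := C_R_NormedModule) (f y) (1, 0))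
  (scal (V := C_R_NormedModule) (g y) (0, 1))).
- intro y. apply pair_basis.
- apply (continuous_plus (V := C_R_NormedModule));
    apply (continuous_scal_l (V := C_R_NormedModule)); assumption.
Qed.

Lemma path_to_infty_exists (z : C) (theta : R) :
  z <> 0%C -> Rabs theta <= PI -> is_arg z theta ->
  exists t a, path_to_infty z theta t a.
Proof.
intros Hz Hth Ha.
set (r := Cmod z).
assert (Hr : 0 < r) by now apply Cmod_gt_0.
set (a := fun s : R => theta * exp (- s)).
set (t := fun s : R => ((r + s) * cos (a s), (r + s) * sin (a s)) : C).
assert (Hm : forall s, 0 <= s -> Cmod (t s) = r + s).
{ intros s Hs. unfold t, Cmod. cbn [fst snd].
  replace (((r + s) * cos (a s)) ^ 2 + ((r + s) * sin (a s)) ^ 2)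
    with (Rsqr (r + s) * (Rsqr (sin (a s)) + Rsqr (cos (a s))))
    by (unfold Rsqr; ring).
  rewrite sin2_cos2, Rmult_1_r. apply sqrt_Rsqr. lra. }
exists t, a. split.
- split.
  + unfold t, a. rewrite Ropp_0, exp_0, Rplus_0_r, Rmult_1_r.
    symmetry. exact Ha.
  + unfold a. rewrite Ropp_0, exp_0. ring.
- exists INR. split; [reflexivity|]. split; [|split].
  + intro n. rewrite S_INR. lra.
  + apply is_lim_seq_INR.
  + intro n. exists t, (fun s =>
      (cos (a s) + (r + s) * (a s * sin (a s)),
       sin (a s) - (r + s) * (a s * cos (a s))) : C).
    split; [|split; [|reflexivity]].
    * intro s.
      apply (is_derive_pair (fun s => (r + s) * cos (a s))
               (fun s => (r + s) * sin (a s))); unfold a;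
        auto_derive; try exact I; ring.
    * intro s.
      apply (continuous_pair (fun s => cos (a s) + (r + s) * (a s * sin (a s)))
               (fun s => sin (a s) - (r + s) * (a s * cos (a s))));
        apply (ex_derive_continuous (V := R_NormedModule));
        unfold a; auto_derive; exact I.
- intros s _. eapply filterlim_filter_le_1.
  + apply filter_le_within.
  + apply (ex_derive_continuous (V := R_NormedModule)).
    unfold a. auto_derive. exact I.
- intros s Hs. split; [|split].
  + intro H. apply (f_equal Cmod) in H. rewrite Hm, Cmod_0 in H by assumption. lra.
  + unfold a. rewrite Rabs_mult, (Rabs_pos_eq (exp (- s))) by apply Rlt_le, exp_pos.
    apply Rle_trans with (Rabs theta * 1); [|lra].
    apply Rmult_le_compat_l; [apply Rabs_pos|].
    rewrite <- exp_0. destruct (Rle_lt_or_eq_dec _ _ Hs) as [H|H].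
    * apply Rlt_le, exp_increasing. lra.
    * subst s. rewrite Ropp_0. lra.
  + unfold is_arg. rewrite Hm by assumption. reflexivity.
- apply is_lim_ext_loc with (fun s => r + s).
  + exists 0. intros s Hs. symmetry. apply Hm. lra.
  + eapply is_lim_plus; [apply is_lim_const|apply is_lim_id|reflexivity].
- unfold a. replace (Finite 0) with (Rbar_mult theta 0)
    by (simpl; f_equal; ring).
  apply is_lim_scal_l.
  apply is_lim_comp with (l := m_infty).
  + apply is_lim_exp_m.
  + change m_infty with (Rbar_opp p_infty).
    apply is_lim_opp, is_lim_id.
  + exists 0. discriminate.
Qed.

(* Main.v *)
Require Import Defs.
From Stdlib Require Import ZArith Compare_dec Factorial Reals Lra Lia Psatz.
From Coquelicot Require Import Coquelicot.

Open Scope R_scope.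

(* Put t = e^w, w = ln |t| + i arg t.  The cut plane becomes a strip, I_nu and K_nu become
   restrictions of entire functions of w solving u'' = (nu^2 + e^{2w}) u, and dt / t = dw.
   Write W(f, g) = f g' - f' g; for solutions f, g of orders nu, mu one has
   W(f, g)' = (mu^2 - nu^2) f g.

   Since W(K_nu, I_nu) = 1, for every mu near nu
     K_mu - K_nu = - K_nu (W(I_nu, K_mu) + 1) + I_nu W(K_nu, K_mu).
   Both Wronskian terms vanish at infinity, hence equal mu^2 - nu^2 times primitives vanishing at
   infinity of I_nu K_mu and K_nu K_mu.  Dividing by mu - nu and letting mu tend to nu gives the
   formula, and only the continuity of K_mu in mu is needed: nothing has to be differentiated with
   respect to the order, not even 1 / Gamma, and integer orders are not special.

   The input on K is its integral representation k_nu(x) = int_0^oo e^{-x cosh u} cosh(nu u) du on the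
   positive axis, which gives the decay and the Lipschitz dependence on the order there.  It extends
   to an entire solution in w, and is identified with the series through its behaviour at x = 0:
   2 (x/2)^nu k_nu(x) tends to a function of nu which is Gauss's limit by the Bohr-Mollerup argument,
   and the factor pi / sin(pi nu) comes from Euler's product for the sine.  Off the real axis, I_nu is
   bounded along rays and K_nu along arcs |t| = r in a sector around the positive axis; this gives the
   convergence of the integrals along every admissible path. *)

(** * Complex exponential and curves *)

(** The orders [mu] near [nu] are controlled only where that is cheap: on the positive axis, where
    the integral representation gives a Lipschitz bound, and on the segment from the real point
    [sz nu] to w, where a bootstrap propagates it. Off the axis, the estimates at infinity concern
    the fixed order [nu] alone: the quotients of Wronskians are followed to infinity along the real
    axis, and only the limiting primitives of I_nu K_nu and K_nu^2 are bounded in the sector |arg t|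
    <= 1, which every admissible path eventually enters because its argument tends to 0. The value 1
    lies below pi/2, so that Re t stays comparable to |t|. Such a primitive also removes the path
    from the problem: the integral is minus its value at w. K_nu is handled through the predicate
    [IsK], entire solutions that agree with [kw] on the real axis; it covers integral and other
    orders alike. The formula with sin(pi nu) serves only to identify such a solution with the
    definition, and integral orders then follow by Lipschitz continuity. *)

Definition cexp (w : C) : C := (exp (fst w) * cos (snd w), exp (fst w) * sin (snd w)).

Definition cder (g : R -> C) (s : R) (d : C) : Prop :=
  is_derive (fun y => fst (g y)) s (fst d) /\ is_derive (fun y => snd (g y)) s (snd d).

(* Entire functions, with a derivative whose remainder is quadratic uniformly on discs: stronger
   than differentiability, but stable under all the operations below, including series. *)
Definition Hol (F F' : C -> C) : Prop :=
  forall r, exists M, 0 <= M /\ forall v w, Cmod v <= r -> Cmod w <= r ->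
    Cmod (F w) <= M /\ Cmod (F' w) <= M /\
    Cmod (F v - F w - F' w * (v - w))%C <= M * Cmod (v - w)%C ^ 2.

Lemma C_eq (a b : C) : fst a = fst b -> snd a = snd b -> a = b.
Proof. destruct a, b; simpl; intros; subst; reflexivity. Qed.

Lemma is_derive_eq (f : R -> R) (x d d' : R) : is_derive f x d -> d = d' -> is_derive f x d'.
Proof. intros H <-; exact H. Qed.

Lemma cder_eq g s d d' : cder g s d -> d = d' -> cder g s d'.
Proof. intros H <-; exact H. Qed.

Lemma Cmod_sqr (a b : R) : Cmod (a, b) ^ 2 = a ^ 2 + b ^ 2.
Proof. apply (Cmod2_alt (a, b)). Qed.

Lemma Cmod_le_sum (a b : R) : Cmod (a, b) <= Rabs a + Rabs b.
Proof.
  apply Rsqr_incr_0_var; [|generalize (Rabs_pos a) (Rabs_pos b); lra].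
  rewrite !Rsqr_pow2, Cmod_sqr, <- (pow2_abs a), <- (pow2_abs b).
  generalize (Rabs_pos a) (Rabs_pos b); nra.
Qed.

Lemma Cmod_minus_sym (a b : C) : Cmod (a - b)%C = Cmod (b - a)%C.
Proof. rewrite <- Cmod_opp. f_equal. ring. Qed.

Lemma Cmod_triangle3 (a b c : C) : Cmod (a - c)%C <= Cmod (a - b)%C + Cmod (b - c)%C.
Proof. replace (a - c)%C with ((a - b) + (b - c))%C by ring. apply Cmod_triangle. Qed.

Lemma Cmod_minus_le (a b : C) : Cmod (a - b)%C <= Cmod a + Cmod b.
Proof. unfold Cminus. rewrite <- (Cmod_opp b). apply Cmod_triangle. Qed.

Lemma Cmod_le_minus (a b : C) : Cmod a <= Cmod b + Cmod (a - b)%C.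
Proof. replace a with (b + (a - b))%C at 1 by ring. apply Cmod_triangle. Qed.

Lemma Cmod_fst (a : C) : Rabs (fst a) <= Cmod a.
Proof. apply Rle_trans with (2 := Rmax_Cmod a), Rmax_l. Qed.
Lemma Cmod_snd (a : C) : Rabs (snd a) <= Cmod a.
Proof. apply Rle_trans with (2 := Rmax_Cmod a), Rmax_r. Qed.

Lemma cexp_plus (a b : C) : cexp (a + b)%C = (cexp a * cexp b)%C.
Proof.
  destruct a as [a1 a2], b as [b1 b2]. unfold cexp; simpl.
  rewrite exp_plus, cos_plus, sin_plus. apply C_eq; simpl; ring.
Qed.

Lemma cexp_0 : cexp 0%C = 1%C.
Proof. unfold cexp; simpl. rewrite exp_0, cos_0, sin_0. apply C_eq; simpl; ring. Qed.

Lemma cexp_R (x : R) : cexp (RtoC x) = RtoC (exp x).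
Proof. unfold cexp; simpl. rewrite cos_0, sin_0. apply C_eq; simpl; ring. Qed.

Lemma Cmod_cexp (w : C) : Cmod (cexp w) = exp (fst w).
Proof.
  apply Rsqr_inj; [apply Cmod_ge_0 | apply Rlt_le, exp_pos |].
  unfold cexp. rewrite !Rsqr_pow2, Cmod_sqr.
  generalize (sin2_cos2 (snd w)); unfold Rsqr; intro H.
  replace ((exp (fst w) * cos (snd w)) ^ 2 + (exp (fst w) * sin (snd w)) ^ 2)
    with (exp (fst w) ^ 2 * (sin (snd w) * sin (snd w) + cos (snd w) * cos (snd w))) by ring.
  rewrite H; ring.
Qed.

Lemma cexp_neq_0 (w : C) : cexp w <> 0%C.
Proof. apply Cmod_gt_0. rewrite Cmod_cexp. apply exp_pos. Qed.

Lemma cexp_opp (w : C) : cexp (- w)%C = (/ cexp w)%C.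
Proof.
  assert (H : (cexp (- w) * cexp w = 1)%C).
  { rewrite <- cexp_plus. replace (- w + w)%C with (RtoC 0) by ring. apply cexp_0. }
  replace (cexp (- w)) with (cexp (-w) * cexp w * / cexp w)%C.
  - rewrite H. ring.
  - field. apply cexp_neq_0.
Qed.

Lemma cder_const (c : C) s : cder (fun _ => c) s 0%C.
Proof. split; simpl; apply (is_derive_const (V := R_NormedModule)). Qed.

Lemma cder_line (a k : C) s : cder (fun y => a + RtoC y * k)%C s k.
Proof. split; simpl; auto_derive; auto; ring. Qed.

Lemma cder_plus g h s dg dh : cder g s dg -> cder h s dh -> cder (fun y => g y + h y)%C s (dg + dh)%C.
Proof. intros [H1 H2] [H3 H4]; split; simpl; apply (is_derive_plus (V := R_NormedModule)); assumption. Qed.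

Lemma is_derive_Rmult (f g : R -> R) x df dg : is_derive f x df -> is_derive g x dg ->
  is_derive (fun y => f y * g y) x (df * g x + f x * dg).
Proof. intros; apply (is_derive_mult f g x df dg); auto. intros; apply Rmult_comm. Qed.

Lemma cder_mult g h s dg dh : cder g s dg -> cder h s dh ->
  cder (fun y => g y * h y)%C s (dg * h s + g s * dh)%C.
Proof.
  intros [H1 H2] [H3 H4]; split; simpl.
  - eapply is_derive_eq.
    + apply (is_derive_minus (V := R_NormedModule)); apply is_derive_Rmult; eassumption.
    + unfold minus, plus, opp; simpl; ring.
  - eapply is_derive_eq.
    + apply (is_derive_plus (V := R_NormedModule)); apply is_derive_Rmult; eassumption.
    + unfold plus; simpl; ring.
Qed.

Lemma cder_minus g h s dg dh : cder g s dg -> cder h s dh -> cder (fun y => g y - h y)%C s (dg - dh)%C.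
Proof. intros [H1 H2] [H3 H4]; split; simpl; apply (is_derive_minus (V := R_NormedModule)); assumption. Qed.

Lemma cder_cexp g s d : cder g s d -> cder (fun y => cexp (g y)) s (cexp (g s) * d)%C.
Proof.
  intros [H1 H2].
  assert (E : is_derive (fun y => exp (fst (g y))) s (exp (fst (g s)) * fst d)).
  { eapply is_derive_eq; [apply (is_derive_comp exp); [apply is_derive_exp | exact H1]|].
    unfold scal; simpl; unfold mult; simpl; ring. }
  assert (Cs : is_derive (fun y => cos (snd (g y))) s (- sin (snd (g s)) * snd d)).
  { eapply is_derive_eq; [apply (is_derive_comp cos); [apply is_derive_cos | exact H2]|].
    unfold scal; simpl; unfold mult; simpl; ring. }
  assert (Sn : is_derive (fun y => sin (snd (g y))) s (cos (snd (g s)) * snd d)).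
  { eapply is_derive_eq; [apply (is_derive_comp sin); [apply is_derive_sin | exact H2]|].
    unfold scal; simpl; unfold mult; simpl; ring. }
  split; simpl; (eapply is_derive_eq; [apply is_derive_Rmult; eassumption|]); simpl; ring.
Qed.

Lemma nonincreasing_of_derive (f df : R -> R) a b : a <= b ->
  (forall x, a <= x <= b -> is_derive f x (df x)) ->
  (forall x, a <= x <= b -> df x <= 0) -> f b <= f a.
Proof.
  intros Hab Hd Hn.
  destruct (MVT_gen f a b df) as [c [Hc E]]; rewrite ?Rmin_left, ?Rmax_right in * by lra.
  - intros; apply Hd; lra.
  - intros x Hx. apply derivable_continuous_pt. exists (df x). apply is_derive_Reals, Hd; lra.
  - specialize (Hn c Hc). nra.
Qed.

(** Project on the direction of the total displacement [D]: the scalar function <D, g> - |D| B has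
    derivative at most |D| (|dg| - dB) <= 0. The bound is given by an antiderivative [B], so that no
    integral of |dg| has to be formed. *)
Lemma curve_mvt (g dg : R -> C) (B dB : R -> R) a b : a <= b ->
  (forall s, a <= s <= b -> cder g s (dg s)) ->
  (forall s, a <= s <= b -> is_derive B s (dB s)) ->
  (forall s, a <= s <= b -> Cmod (dg s) <= dB s) ->
  Cmod (g b - g a)%C <= B b - B a.
Proof.
  intros Hab Hg HB Hle.
  set (D := (g b - g a)%C).
  destruct (Req_dec (Cmod D) 0) as [H0|H0].
  { rewrite H0.
    assert (- B b <= - B a); [|lra].
    apply (nonincreasing_of_derive (fun y => - B y) (fun y => - dB y)); auto.
    - intros x Hx. apply (is_derive_opp (V := R_NormedModule)), HB; auto.
    - intros x Hx. specialize (Hle x Hx). generalize (Cmod_ge_0 (dg x)). lra. }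
  assert (HD : 0 < Cmod D) by (generalize (Cmod_ge_0 D); lra).
  set (f := fun s => (fst D * fst (g s) + snd D * snd (g s)) - Cmod D * B s).
  assert (f b <= f a).
  { apply (nonincreasing_of_derive f (fun s => (fst D * fst (dg s) + snd D * snd (dg s)) - Cmod D * dB s));
      auto.
    - intros x Hx. destruct (Hg x Hx) as [H1 H2]. specialize (HB x Hx).
      apply (is_derive_minus (V := R_NormedModule)).
      + apply (is_derive_plus (V := R_NormedModule)); apply is_derive_scal; assumption.
      + apply is_derive_scal; assumption.
    - intros x Hx. specialize (Hle x Hx).
      apply Rle_trans with (Cmod D * Cmod (dg x) - Cmod D * dB x); [|nra].
      assert (fst D * fst (dg x) + snd D * snd (dg x) <= Cmod D * Cmod (dg x)); [|lra].
      rewrite <- (Cmod_conj D), <- Cmod_mult.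
      eapply Rle_trans; [|apply re_le_Cmod]. eapply Rle_trans; [|apply Rle_abs].
      unfold Cconj; simpl. lra. }
  unfold f in H.
  assert (E : Cmod D ^ 2 = fst D * fst D + snd D * snd D).
  { rewrite Cmod2_alt. unfold Re, Im. ring. }
  assert (E1 : fst D = fst (g b) - fst (g a)) by (unfold D; simpl; ring).
  assert (E2 : snd D = snd (g b) - snd (g a)) by (unfold D; simpl; ring).
  assert (fst D * fst D + snd D * snd D <= Cmod D * (B b - B a)).
  { rewrite E1 at 2. rewrite E2 at 2. nra. }
  rewrite <- E in H1. simpl in H1. nra.
Qed.

Lemma exp_ge_1 x : 0 <= x -> 1 <= exp x.
Proof. intros. generalize (exp_ineq1_le x). lra. Qed.

Lemma exp_le x y : x <= y -> exp x <= exp y.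
Proof. intros [H|H]; [left; now apply exp_increasing | subst; right; reflexivity]. Qed.

Lemma fst_le_Cmod (a : C) : fst a <= Cmod a.
Proof. apply Rle_trans with (2 := Cmod_fst a), Rle_abs. Qed.

Lemma Cmod_cexp_le w : Cmod (cexp w) <= exp (Cmod w).
Proof. rewrite Cmod_cexp. apply exp_le, fst_le_Cmod. Qed.

Lemma cexp_rest1 (z : C) : Cmod (cexp z - 1)%C <= Cmod z * exp (Cmod z).
Proof.
  set (g := fun s : R => cexp (0 + RtoC s * z)%C).
  replace (cexp z - 1)%C with (g 1 - g 0)%C.
  2: { unfold g. rewrite Cmult_1_l, Cmult_0_l, !Cplus_0_l, cexp_0. reflexivity. }
  replace (Cmod z * exp (Cmod z)) with (Cmod z * exp (Cmod z) * 1 - Cmod z * exp (Cmod z) * 0) by ring.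
  apply (curve_mvt g (fun s => cexp (0 + RtoC s * z) * z)%C (fun s => Cmod z * exp (Cmod z) * s) (fun _ => Cmod
    z * exp (Cmod z))); try lra.
  - intros s _. apply cder_cexp, cder_line.
  - intros s _. auto_derive; auto; ring.
  - intros s Hs. rewrite Cmod_mult, Rmult_comm. apply Rmult_le_compat_l; [apply Cmod_ge_0|].
    eapply Rle_trans; [apply Cmod_cexp_le|]. apply exp_le.
    rewrite Cplus_0_l, Cmod_mult, Cmod_R, Rabs_pos_eq by lra. generalize (Cmod_ge_0 z); nra.
Qed.

Lemma cexp_rest2 (z : C) : Cmod (cexp z - 1 - z)%C <= Cmod z ^ 2 * exp (Cmod z).
Proof.
  set (g := fun s : R => (cexp (0 + RtoC s * z) - (0 + RtoC s * z))%C).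
  replace (cexp z - 1 - z)%C with (g 1 - g 0)%C.
  2: { unfold g. rewrite Cmult_1_l, Cmult_0_l, !Cplus_0_l, cexp_0. ring. }
  set (K := Cmod z ^ 2 * exp (Cmod z)).
  replace K with (K * 1 - K * 0) by ring.
  apply (curve_mvt g (fun s => cexp (0 + RtoC s * z) * z - z)%C (fun s => K * s) (fun _ => K)); try lra.
  - intros s _. apply cder_minus; [apply cder_cexp, cder_line | apply cder_line].
  - intros s _. auto_derive; auto; ring.
  - intros s Hs. rewrite Cplus_0_l.
    replace (cexp (s * z) * z - z)%C with ((cexp (s * z) - 1) * z)%C by ring.
    rewrite Cmod_mult. unfold K.
    assert (H : Cmod (s * z)%C <= Cmod z).
    { rewrite Cmod_mult, Cmod_R, Rabs_pos_eq by lra. generalize (Cmod_ge_0 z); nra. }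
    apply Rle_trans with (Cmod z * exp (Cmod z) * Cmod z); [|right; ring].
    apply Rmult_le_compat_r; [apply Cmod_ge_0|].
    eapply Rle_trans; [apply cexp_rest1|].
    apply Rmult_le_compat; auto using Cmod_ge_0, exp_le. apply Rlt_le, exp_pos.
Qed.

(** * Holomorphic functions of the logarithm *)

Lemma Hol_ext F F' G G' : (forall w, F w = G w) -> (forall w, F' w = G' w) -> Hol F F' -> Hol G G'.
Proof.
  intros E E' H r. destruct (H r) as [M [M0 HM]]. exists M. split; auto.
  intros v w Hv Hw. rewrite <- !E, <- E'. apply HM; auto.
Qed.

Lemma Hol_ext_r F F' G' : (forall w, F' w = G' w) -> Hol F F' -> Hol F G'.
Proof. intros; eapply Hol_ext; eauto. Qed.

Lemma Hol_bound F F' : Hol F F' -> forall r, exists M, 0 <= M /\ forall w, Cmod w <= r -> Cmod (F w) <= M.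
Proof.
  intros H r. destruct (H r) as [M [M0 HM]]. exists M; split; auto.
  intros w Hw. apply (HM w w Hw Hw).
Qed.

(** On the disc |v - w| <= 2 |r|, which turns the quadratic remainder into a linear one. *)
Lemma Hol_lip F F' : Hol F F' -> forall r, exists L, 0 <= L /\ forall v w, Cmod v <= r -> Cmod w <= r ->
  Cmod (F v - F w)%C <= L * Cmod (v - w)%C.
Proof.
  intros H r. destruct (H r) as [M [M0 HM]].
  exists (M + M * (2 * Rabs r)). split; [generalize (Rabs_pos r); nra|].
  intros v w Hv Hw. destruct (HM v w Hv Hw) as [_ [H1 H2]].
  assert (H3 : Cmod (v - w)%C <= 2 * Rabs r).
  { eapply Rle_trans; [apply Cmod_minus_le|]. generalize (Rle_abs r); lra. }
  eapply Rle_trans; [apply (Cmod_le_minus _ (F' w * (v - w))%C)|].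
  rewrite Cmod_mult. generalize (Cmod_ge_0 (v - w)%C); intros.
  assert (Cmod (F' w) * Cmod (v - w)%C <= M * Cmod (v - w)%C) by (apply Rmult_le_compat_r; lra).
  assert (M * Cmod (v - w)%C ^ 2 <= M * (2 * Rabs r) * Cmod (v - w)%C).
  { simpl. rewrite Rmult_1_r. apply Rle_trans with (M * (Cmod (v-w)%C * (2 * Rabs r))); [|right; ring].
    apply Rmult_le_compat_l; auto. apply Rmult_le_compat_l; auto. }
  lra.
Qed.

Lemma Hol_const c : Hol (fun _ => c) (fun _ => 0%C).
Proof.
  intro r. exists (Cmod c). split; [apply Cmod_ge_0|]. intros v w _ _.
  rewrite Cmod_0. replace (c - c - 0 * (v - w))%C with (RtoC 0) by ring. rewrite Cmod_0.
  generalize (Cmod_ge_0 c) (Cmod_ge_0 (v - w)%C); intros; repeat split; try lra. simpl.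
  rewrite Rmult_1_r. apply Rmult_le_pos; auto. apply Rmult_le_pos; auto.
Qed.

Lemma Hol_id : Hol (fun w => w) (fun _ => 1%C).
Proof.
  intro r. exists (Rabs r + 1). split; [generalize (Rabs_pos r); lra|]. intros v w _ Hw.
  rewrite Cmod_1. replace (v - w - 1 * (v - w))%C with (RtoC 0) by ring. rewrite Cmod_0.
  generalize (Rle_abs r) (Rabs_pos r) (pow2_ge_0 (Cmod (v - w)%C)); intros; repeat split; nra.
Qed.

Lemma Hol_plus F F' G G' : Hol F F' -> Hol G G' -> Hol (fun w => F w + G w)%C (fun w => F' w + G' w)%C.
Proof.
  intros HF HG r. destruct (HF r) as [M [M0 HM]], (HG r) as [N [N0 HN]].
  exists (M + N). split; [lra|]. intros v w Hv Hw.
  destruct (HM v w Hv Hw) as [A1 [A2 A3]], (HN v w Hv Hw) as [B1 [B2 B3]].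
  repeat split; try (eapply Rle_trans; [apply Cmod_triangle | lra]).
  replace (F v + G v - (F w + G w) - (F' w + G' w) * (v - w))%C with
    ((F v - F w - F' w * (v - w)) + (G v - G w - G' w * (v - w)))%C by ring.
  eapply Rle_trans; [apply Cmod_triangle|]. lra.
Qed.

Lemma Hol_mult F F' G G' : Hol F F' -> Hol G G' ->
  Hol (fun w => F w * G w)%C (fun w => F' w * G w + F w * G' w)%C.
Proof.
  intros HF HG r. destruct (HF r) as [M [M0 HM]], (HG r) as [N [N0 HN]].
  destruct (Hol_lip _ _ HF r) as [L [L0 HL]], (Hol_lip _ _ HG r) as [K [K0 HK]].
  exists (2 * (M * N) + L * K). split; [generalize (Rmult_le_pos _ _ M0 N0) (Rmult_le_pos _ _ L0 K0); lra|].
  intros v w Hv Hw.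
  destruct (HM v w Hv Hw) as [A1 [A2 A3]], (HN v w Hv Hw) as [B1 [B2 B3]].
  specialize (HL v w Hv Hw). specialize (HK v w Hv Hw).
  assert (LK := Rmult_le_pos _ _ L0 K0). assert (MN := Rmult_le_pos _ _ M0 N0).
  assert (P1 : Cmod (F w) * Cmod (G w) <= M * N) by (apply Rmult_le_compat; auto using Cmod_ge_0).
  assert (P2 : Cmod (F' w) * Cmod (G w) <= M * N) by (apply Rmult_le_compat; auto using Cmod_ge_0).
  assert (P3 : Cmod (F w) * Cmod (G' w) <= M * N) by (apply Rmult_le_compat; auto using Cmod_ge_0).
  repeat split.
  - rewrite Cmod_mult. lra.
  - eapply Rle_trans; [apply Cmod_triangle|]. rewrite !Cmod_mult. lra.
  - replace (F v * G v - F w * G w - (F' w * G w + F w * G' w) * (v - w))%C with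
      ((F v - F w - F' w * (v - w)) * G w + F w * (G v - G w - G' w * (v - w)) + (F v - F w) * (G v - G w))%C
        by ring.
    eapply Rle_trans; [apply Cmod_triangle|].
    eapply Rle_trans; [apply Rplus_le_compat_r, Cmod_triangle|]. rewrite !Cmod_mult.
    set (h := Cmod (v - w)%C) in *. assert (0 <= h) by apply Cmod_ge_0.
    assert (Q1 : Cmod (F v - F w - F' w * (v - w))%C * Cmod (G w) <= (M * h ^ 2) * N)
      by (apply Rmult_le_compat; auto using Cmod_ge_0).
    assert (Q2 : Cmod (F w) * Cmod (G v - G w - G' w * (v - w))%C <= M * (N * h ^ 2))
      by (apply Rmult_le_compat; auto using Cmod_ge_0).
    assert (Q3 : Cmod (F v - F w)%C * Cmod (G v - G w)%C <= (L * h) * (K * h))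
      by (apply Rmult_le_compat; auto using Cmod_ge_0).
    replace ((2 * (M * N) + L * K) * h ^ 2) with (M * h ^ 2 * N + M * (N * h ^ 2) + L * h * (K * h)) by ring.
    lra.
Qed.

Lemma Hol_scal c F F' : Hol F F' -> Hol (fun w => c * F w)%C (fun w => c * F' w)%C.
Proof.
  intros H. eapply Hol_ext_r; [|apply Hol_mult; [apply (Hol_const c) | exact H]].
  intro w; simpl. ring.
Qed.

Lemma Hol_minus F F' G G' : Hol F F' -> Hol G G' -> Hol (fun w => F w - G w)%C (fun w => F' w - G' w)%C.
Proof.
  intros HF HG. eapply Hol_ext; [| |apply Hol_plus; [exact HF | apply (Hol_scal (- (1))%C _ _ HG)]];
  intro w; simpl; ring.
Qed.

Lemma Hol_comp F F' Y Y' : Hol F F' -> Hol Y Y' -> Hol (fun w => F (Y w)) (fun w => F' (Y w) * Y' w)%C.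
Proof.
  intros HF HY r. destruct (HY r) as [M [M0 HM]], (Hol_lip _ _ HY r) as [L [L0 HL]].
  destruct (HF M) as [N [N0 HN]].
  assert (MN := Rmult_le_pos _ _ N0 M0).
  exists (N + N * M + N * (L * L)). split; [generalize (Rmult_le_pos _ _ L0 L0); nra|].
  intros v w Hv Hw. destruct (HM v w Hv Hw) as [A1 [A2 A3]]. specialize (HL v w Hv Hw).
  destruct (HM w v Hw Hv) as [A1' _].
  destruct (HN (Y v) (Y w) A1' A1) as [B1 [B2 B3]].
  assert (0 <= N * (L * L)) by (generalize (Rmult_le_pos _ _ L0 L0); nra).
  repeat split.
  - lra.
  - rewrite Cmod_mult. apply Rle_trans with (N * M); [|lra]. apply Rmult_le_compat; auto using Cmod_ge_0.
  - replace (F (Y v) - F (Y w) - F' (Y w) * Y' w * (v - w))%C with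
      ((F (Y v) - F (Y w) - F' (Y w) * (Y v - Y w)) + F' (Y w) * (Y v - Y w - Y' w * (v - w)))%C by ring.
    eapply Rle_trans; [apply Cmod_triangle|]. rewrite Cmod_mult.
    set (h := Cmod (v - w)%C) in *. assert (0 <= h) by apply Cmod_ge_0.
    assert (Cmod (F' (Y w)) * Cmod (Y v - Y w - Y' w * (v - w))%C <= N * (M * h ^ 2))
      by (apply Rmult_le_compat; auto using Cmod_ge_0).
    assert (N * Cmod (Y v - Y w)%C ^ 2 <= N * (L * h) ^ 2).
    { apply Rmult_le_compat_l; auto. apply pow_incr; split; auto using Cmod_ge_0. }
    generalize (pow2_ge_0 h); intros. nra.
Qed.

Lemma Hol_cexp : Hol cexp cexp.
Proof.
  intro r. set (E := exp (Rabs r) * exp (2 * Rabs r)).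
  assert (1 <= exp (Rabs r)) by (apply exp_ge_1, Rabs_pos).
  assert (1 <= exp (2 * Rabs r)) by (apply exp_ge_1; generalize (Rabs_pos r); lra).
  exists E. split; [unfold E; nra|]. intros v w Hv Hw.
  assert (B : Cmod (cexp w) <= exp (Rabs r)).
  { eapply Rle_trans; [apply Cmod_cexp_le|]. apply exp_le. generalize (Rle_abs r); lra. }
  repeat split; try (unfold E; nra).
  replace v with (w + (v - w))%C at 1 by ring. rewrite cexp_plus.
  replace (cexp w * cexp (v - w) - cexp w - cexp w * (v - w))%C with (cexp w * (cexp (v - w) - 1 - (v - w)))%C
    by ring.
  rewrite Cmod_mult. unfold E.
  replace (exp (Rabs r) * exp (2 * Rabs r) * Cmod (v - w) ^ 2) with (exp (Rabs r) * (Cmod (v - w) ^ 2 * exp (2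
    * Rabs r))) by ring.
  apply Rmult_le_compat; auto using Cmod_ge_0.
  eapply Rle_trans; [apply cexp_rest2|]. apply Rmult_le_compat_l; [apply pow2_ge_0|].
  apply exp_le. eapply Rle_trans; [apply Cmod_minus_le|]. generalize (Rle_abs r); lra.
Qed.

(** The difference [f - f1] is trapped by a function that vanishes at [s] together with its
    derivative. This is how quadratic remainders, those of [Hol] and later those of integrals,
    become derivatives. *)
Lemma is_derive_squeeze (f f1 B : R -> R) s l :
  is_derive f1 s l -> f1 s = f s -> is_derive B s 0 -> B s = 0 ->
  locally s (fun y => Rabs (f y - f1 y) <= B y) -> is_derive f s l.
Proof.
  intros H1 E HB B0 [d Hd].
  apply is_derive_ext with (fun y => f1 y + (f y - f1 y)); [intro y; change (f1 y + (f y - f1 y) = f y); ring|].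
  replace l with (l + 0) by ring.
  apply (is_derive_plus (V := R_NormedModule)); [exact H1|].
  apply is_derive_Reals. apply is_derive_Reals in HB.
  intros eps Heps. destruct (HB eps Heps) as [d' Hd'].
  exists (mkposreal (Rmin d d') (Rmin_pos _ _ (cond_pos d) (cond_pos d'))). simpl. intros h Hh Hlt.
  specialize (Hd' h Hh (Rlt_le_trans _ _ _ Hlt (Rmin_r _ _))).
  eapply Rle_lt_trans; [|exact Hd'].
  rewrite E, B0. rewrite !Rminus_0_r.
  replace (f s - f s) with 0 by ring. rewrite Rminus_0_r. unfold Rdiv. rewrite !Rabs_mult.
  apply Rmult_le_compat_r; [apply Rabs_pos|].
  eapply Rle_trans; [|apply Rle_abs]. apply Hd.
  unfold ball; simpl; unfold AbsRing_ball, abs, minus, plus, opp; simpl.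
  replace (s + h + - s) with h by ring. eapply Rlt_le_trans; [exact Hlt | apply Rmin_l].
Qed.

Lemma cder_Hol F F' g s d : Hol F F' -> cder g s d -> cder (fun y => F (g y)) s (F' (g s) * d)%C.
Proof.
  intros HF Hg.
  destruct (HF (Cmod (g s) + 2)) as [M [M0 HM]].
  assert (Hloc : locally s (fun y => Cmod (g y) <= Cmod (g s) + 2)).
  { destruct Hg as [H1 H2].
    assert (C1 : continuous (fun y => fst (g y)) s) by (apply (ex_derive_continuous (V := R_NormedModule));
      eexists; exact H1).
    assert (C2 : continuous (fun y => snd (g y)) s) by (apply (ex_derive_continuous (V := R_NormedModule));
      eexists; exact H2).
    assert (L1 : locally s (fun y => Rabs (fst (g y) - fst (g s)) < 1))
      by exact (C1 _ (locally_ball (fst (g s)) (mkposreal 1 Rlt_0_1))).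
    assert (L2 : locally s (fun y => Rabs (snd (g y) - snd (g s)) < 1))
      by exact (C2 _ (locally_ball (snd (g s)) (mkposreal 1 Rlt_0_1))).
    refine (filter_imp _ _ _ (filter_and _ _ L1 L2)).
    intros y [B1 B2]. unfold Rminus in B1, B2.
    eapply Rle_trans; [apply (Cmod_le_minus _ (g s))|]. apply Rplus_le_compat_l.
    destruct (g y) as [y1 y2], (g s) as [s1 s2]. unfold Cminus, Cplus, Copp; simpl in *.
    eapply Rle_trans; [apply Cmod_le_sum|]. lra. }
  (* M |g y - g s|^2 bounds the distance of F (g y) from its linear part at g s, and has derivative
     0 at [s]. *)
  set (B := fun y => M * ((fst (g y) - fst (g s)) ^ 2 + (snd (g y) - snd (g s)) ^ 2)).
  assert (HB : is_derive B s 0).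
  { destruct Hg as [H1 H2]. unfold B.
    assert (forall (f : R -> R) l, is_derive f s l -> is_derive (fun y => (f y - f s) ^ 2) s 0).
    { intros f l Hf. eapply is_derive_eq.
      - apply is_derive_pow. apply (is_derive_minus (V := R_NormedModule));
          [exact Hf | apply (is_derive_const (V := R_NormedModule))].
      - unfold minus, plus, opp, zero; simpl. ring. }
    eapply is_derive_eq.
    - apply is_derive_scal. apply (is_derive_plus (V := R_NormedModule)); [apply (H _ _ H1) | apply (H _ _ H2)].
    - unfold plus; simpl; ring. }
  assert (B0 : B s = 0) by (unfold B; ring).
  assert (HL : cder (fun y => F (g s) + F' (g s) * (g y - g s))%C s (F' (g s) * d)%C).
  { eapply cder_eq.
    - apply cder_plus; [apply cder_const|]. apply cder_mult; [apply cder_const|].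
      apply cder_minus; [exact Hg | apply cder_const].
    - simpl. ring. }
  assert (Hb : locally s (fun y => Cmod (F (g y) - (F (g s) + F' (g s) * (g y - g s)))%C <= B y)).
  { revert Hloc; apply filter_imp. intros y Hy.
    assert (Hs : Cmod (g s) <= Cmod (g s) + 2) by lra.
    destruct (HM _ _ Hy Hs) as [_ [_ H3]].
    replace (F (g y) - (F (g s) + F' (g s) * (g y - g s)))%C with (F (g y) - F (g s) - F' (g s) * (g y - g
      s))%C by ring.
    eapply Rle_trans; [exact H3|]. unfold B. right. f_equal. apply Cmod_sqr. }
  destruct HL as [L1 L2].
  split.
  - refine (is_derive_squeeze _ _ B _ _ L1 _ HB B0 _).
    + f_equal. ring.
    + revert Hb; apply filter_imp; intros y Hy. eapply Rle_trans; [|exact Hy].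
      eapply Rle_trans; [|apply Cmod_fst]. right. simpl. reflexivity.
  - refine (is_derive_squeeze _ _ B _ _ L2 _ HB B0 _).
    + f_equal. ring.
    + revert Hb; apply filter_imp; intros y Hy. eapply Rle_trans; [|exact Hy].
      eapply Rle_trans; [|apply Cmod_snd]. right. simpl. reflexivity.
Qed.

Lemma cder_Hol_line F F' w k s : Hol F F' ->
  cder (fun y => F (w + RtoC y * k)%C) s (F' (w + RtoC s * k) * k)%C.
Proof. intros H. apply cder_Hol with (1 := H), cder_line. Qed.

Lemma Hol_const_of_0 F : Hol F (fun _ => 0%C) -> forall v w, F v = F w.
Proof.
  intros H v w. apply Ceq_minus.
  apply Cmod_eq_0, Rle_antisym; [|apply Cmod_ge_0].
  set (g := fun s : R => F (w + RtoC s * (v - w))%C).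
  replace (F v - F w)%C with (g 1 - g 0)%C.
  2: { unfold g. f_equal; f_equal; ring. }
  replace 0 with (0 - 0) by ring.
  apply (curve_mvt g (fun s => 0 * (v - w))%C (fun _ => 0) (fun _ => 0)); try lra.
  - intros s _. apply (cder_Hol_line F (fun _ => 0%C)), H.
  - intros s _. apply (is_derive_const (V := R_NormedModule)).
  - intros s _. rewrite Cmult_0_l, Cmod_0. lra.
Qed.

(** * Exponential series *)

Definition csum (u : nat -> C) := ex_series (fun k => Re (u k)) /\ ex_series (fun k => Im (u k)).

Lemma csum_dom u b : (forall k, Cmod (u k) <= b k) -> ex_series b -> csum u.
Proof.
  intros Hu Hb. split; apply (ex_series_le (V := R_CompleteNormedModule) _ b); auto; intro k;
  (eapply Rle_trans; [|apply Hu]); [apply Cmod_fst | apply Cmod_snd].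
Qed.

Lemma CSeries_ext u v : (forall k, u k = v k) -> CSeries u = CSeries v.
Proof. intros E. unfold CSeries. f_equal; apply Series_ext; intro k; rewrite E; reflexivity. Qed.

Lemma CSeries_plus u v : csum u -> csum v -> CSeries (fun k => u k + v k)%C = (CSeries u + CSeries v)%C.
Proof.
  intros [H1 H2] [H3 H4]. unfold CSeries. apply C_eq; simpl; apply (Series_plus); assumption.
Qed.

Lemma csum_plus u v : csum u -> csum v -> csum (fun k => u k + v k)%C.
Proof. intros [H1 H2] [H3 H4]. split; apply (ex_series_plus (V := R_NormedModule)); assumption. Qed.

Lemma ex_series_Rscal a (u : nat -> R) : ex_series u -> ex_series (fun k => a * u k).
Proof. apply (ex_series_scal (V := R_NormedModule)). Qed.

Lemma csum_scal a u : csum u -> csum (fun k => a * u k)%C.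
Proof.
  intros [H1 H2]. split; simpl.
  - apply (ex_series_minus (V := R_NormedModule)); apply ex_series_Rscal; assumption.
  - apply (ex_series_plus (V := R_NormedModule)); apply ex_series_Rscal; assumption.
Qed.

Lemma CSeries_scal a u : csum u -> CSeries (fun k => a * u k)%C = (a * CSeries u)%C.
Proof.
  intros [H1 H2]. unfold CSeries. apply C_eq; simpl.
  - rewrite <- !Series_scal_l, <- Series_minus; try (apply ex_series_Rscal; assumption).
    reflexivity.
  - rewrite <- !Series_scal_l, <- Series_plus; try (apply ex_series_Rscal; assumption).
    reflexivity.
Qed.

Lemma CSeries_minus u v : csum u -> csum v -> CSeries (fun k => u k - v k)%C = (CSeries u - CSeries v)%C.
Proof.
  intros Hu Hv. rewrite (CSeries_ext _ (fun k => u k + (- (1)) * v k)%C) by (intro; ring).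
  rewrite CSeries_plus, CSeries_scal; auto; [ring | now apply csum_scal].
Qed.

Lemma CSeries_incr u : csum u -> CSeries u = (u O + CSeries (fun k => u (S k)))%C.
Proof. intros [H1 H2]. unfold CSeries. apply C_eq; simpl; apply Series_incr_1; assumption. Qed.

Lemma Series_zero : Series (fun _ => 0) = 0.
Proof.
  rewrite (Series_ext _ (fun k => 0 * 0)) by (intro; ring). rewrite Series_scal_l. ring.
Qed.

(** Multiply by the conjugate of the sum [D]: |D|^2 = Re (conj D * D) is bounded termwise by |D|
    b_k. Bounding the two components separately would lose a constant factor. *)
Lemma CSeries_bound u b : (forall k, Cmod (u k) <= b k) -> ex_series b -> Cmod (CSeries u) <= Series b.
Proof.
  intros Hu Hb. destruct (csum_dom u b Hu Hb) as [H1 H2].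
  set (D := CSeries u).
  assert (P : 0 <= Series b).
  { rewrite <- Series_zero. apply Series_le; auto. intro k; split; [lra|].
    eapply Rle_trans; [apply Cmod_ge_0 | apply Hu]. }
  destruct (Req_dec (Cmod D) 0) as [H0|H0]; [lra|].
  assert (HD : 0 < Cmod D) by (generalize (Cmod_ge_0 D); lra).
  assert (E : Cmod D ^ 2 = fst D * fst D + snd D * snd D) by (rewrite Cmod2_alt; unfold Re, Im; ring).
  assert (Cmod D * Cmod D <= Cmod D * Series b); [|nra].
  replace (Cmod D * Cmod D) with (Cmod D ^ 2) by ring. rewrite E.
  unfold D at 2 4, CSeries; simpl fst; simpl snd.
  rewrite <- !Series_scal_l, <- Series_plus by (apply ex_series_Rscal; assumption).
  eapply Rle_trans; [apply Rle_abs|].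
  assert (K : forall k, Rabs (fst D * Re (u k) + snd D * Im (u k)) <= Cmod D * b k).
  { intro k. replace (fst D * Re (u k) + snd D * Im (u k)) with (Re (Cconj D * u k)%C) by (unfold Re, Im,
      Cconj; simpl; ring).
    eapply Rle_trans; [apply re_le_Cmod|]. rewrite Cmod_mult, Cmod_conj.
    apply Rmult_le_compat_l; auto. lra. }
  assert (X : ex_series (fun k => Cmod D * b k)) by (apply ex_series_Rscal; auto).
  eapply Rle_trans; [apply Series_Rabs|].
  - apply (ex_series_le (V := R_CompleteNormedModule) _ (fun k => Cmod D * b k)); auto.
    intro k. unfold norm; simpl; unfold abs; simpl. rewrite Rabs_Rabsolu. apply K.
  - apply Series_le; auto. intro k; split; [apply Rabs_pos | apply K].
Qed.

Lemma ex_series_exp x : ex_series (fun k => x ^ k / INR (fact k)).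
Proof.
  exists (exp x). generalize (is_exp_Reals x). unfold is_pseries.
  apply is_series_ext. intro k. rewrite pow_n_pow. unfold scal; simpl; unfold mult; simpl. unfold Rdiv. ring.
Qed.

(** The factorial makes sum c_k t^(2k) entire in t, and it survives both operations that the
    differential equation performs on coefficients: multiplication by mu + 2k and the index
    shift. *)
Definition Fast (c : nat -> R) := exists B L, 0 <= B /\ 0 <= L /\ forall k,
  Rabs (c k) <= B * (L ^ k / INR (fact k)).

Lemma INR_le_pow2 k : INR k + 1 <= 2 ^ k.
Proof. induction k; [simpl; lra|]. rewrite S_INR; simpl. generalize (pos_INR k); lra. Qed.

Lemma fact_pos k : 0 < INR (fact k).
Proof. apply INR_fact_lt_0. Qed.

Lemma Fast_mul (mu : R) c : Fast c -> Fast (fun k => (mu + 2 * INR k) * c k).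
Proof.
  intros [B [L [B0 [L0 H]]]]. exists ((Rabs mu + 2) * B), (2 * L).
  repeat split; [generalize (Rabs_pos mu); nra | lra |]. intro k.
  rewrite Rabs_mult.
  replace ((Rabs mu + 2) * B * ((2 * L) ^ k / INR (fact k))) with
    (((Rabs mu + 2) * 2 ^ k) * (B * (L ^ k / INR (fact k)))).
  2: { rewrite Rpow_mult_distr. field. apply INR_fact_neq_0. }
  apply Rmult_le_compat; auto using Rabs_pos.
  eapply Rle_trans; [apply Rabs_triang|]. rewrite (Rabs_pos_eq (2 * INR k)) by (generalize (pos_INR k); lra).
  generalize (INR_le_pow2 k) (pos_INR k) (Rabs_pos mu); intros. nra.
Qed.

Definition shift0 (c : nat -> R) (k : nat) := match k with O => 0 | S j => c j end.

Lemma Fast_shift c : Fast c -> Fast (shift0 c).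
Proof.
  intros [B [L [B0 [L0 H]]]]. exists B, (2 * (L + 1)). repeat split; [auto|lra|].
  intros [|j]; simpl shift0.
  - rewrite Rabs_R0. simpl. lra.
  - eapply Rle_trans; [apply H|]. apply Rmult_le_compat_l; auto.
    rewrite fact_simpl, mult_INR.
    replace (L ^ j / INR (fact j)) with ((INR (S j) * L ^ j) / (INR (S j) * INR (fact j))).
    2: { field. split; [apply INR_fact_neq_0 | apply not_0_INR; lia]. }
    unfold Rdiv. apply Rmult_le_compat_r.
    { apply Rlt_le, Rinv_0_lt_compat, Rmult_lt_0_compat; [apply lt_0_INR; lia | apply fact_pos]. }
    rewrite Rpow_mult_distr.
    assert (L ^ j <= (L + 1) ^ S j).
    { simpl. assert (L ^ j <= (L + 1) ^ j) by (apply pow_incr; lra).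
      assert (0 <= (L+1)^j) by (apply pow_le; lra). nra. }
    apply Rmult_le_compat; auto using pos_INR, pow_le.
    rewrite S_INR. generalize (INR_le_pow2 j). simpl. generalize (pow_le 2 j); lra.
Qed.

(** The generalized power series t^mu sum c_k t^(2k) at t = e^w: single-valued in w for every real
    exponent, and d/dw multiplies the coefficients by mu + 2k. *)
Definition Phi (mu : R) (c : nat -> R) (w : C) : C :=
  CSeries (fun k => RtoC (c k) * cexp (RtoC (mu + 2 * INR k) * w))%C.

Definition Phi_dom (mu : R) B L r k := B * exp (r * Rabs mu) * ((L * exp (2 * r)) ^ k / INR (fact k)).

Lemma Phi_dom_ex mu B L r : ex_series (Phi_dom mu B L r).
Proof. apply ex_series_Rscal, ex_series_exp. Qed.

Lemma exp_INR_mul a k : exp (INR k * a) = exp a ^ k.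
Proof.
  induction k; [simpl; rewrite Rmult_0_l; apply exp_0|].
  rewrite S_INR, Rmult_plus_distr_r, exp_plus, IHk, Rmult_1_l. simpl; ring.
Qed.

Lemma Phi_dom_le mu B L r c k x : 0 <= B -> 0 <= L -> 0 <= r -> Rabs c <= B * (L ^ k / INR (fact k)) ->
  0 <= x -> x <= exp (r * Rabs (mu + 2 * INR k)) -> Rabs c * x <= Phi_dom mu B L r k.
Proof.
  intros B0 L0 r0 H x0 Hx. unfold Phi_dom.
  rewrite Rpow_mult_distr. rewrite <- exp_INR_mul.
  replace (B * exp (r * Rabs mu) * (L ^ k * exp (INR k * (2 * r)) / INR (fact k))) with
   ((B * (L ^ k / INR (fact k))) * (exp (r * Rabs mu) * exp (INR k * (2 * r)))) by (field;
     apply INR_fact_neq_0).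
  apply Rmult_le_compat; auto using Rabs_pos.
  eapply Rle_trans; [exact Hx|]. rewrite <- exp_plus. apply exp_le.
  replace (r * Rabs mu + INR k * (2 * r)) with (r * (Rabs mu + 2 * INR k)) by ring.
  apply Rmult_le_compat_l; auto. eapply Rle_trans; [apply Rabs_triang|].
  rewrite (Rabs_pos_eq (2 * INR k)); [lra | generalize (pos_INR k); lra].
Qed.

Lemma Phi_csum mu c w : Fast c -> csum (fun k => RtoC (c k) * cexp (RtoC (mu + 2 * INR k) * w))%C.
Proof.
  intros [B [L [B0 [L0 H]]]]. apply csum_dom with (Phi_dom mu B L (Cmod w)); [|apply Phi_dom_ex].
  intro k. rewrite Cmod_mult, Cmod_R. apply Phi_dom_le; auto using Cmod_ge_0.
  eapply Rle_trans; [apply Cmod_cexp_le|]. rewrite Cmod_mult, Cmod_R, Rmult_comm. lra.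
Qed.

Lemma Hol_Phi mu c : Fast c -> Hol (Phi mu c) (Phi mu (fun k => (mu + 2 * INR k) * c k)).
Proof.
  intros Hc r.
  assert (Hc' := Fast_mul mu c Hc).
  assert (Bd : forall d, Fast d -> exists M, 0 <= M /\ forall w, Cmod w <= r -> Cmod (Phi mu d w) <= M).
  { intros d [B [L [B0 [L0 H]]]].
    exists (Series (Phi_dom mu B L (Rabs r))).
    assert (G : forall w, Cmod w <= r -> Cmod (Phi mu d w) <= Series (Phi_dom mu B L (Rabs r))).
    { intros w Hw. apply CSeries_bound; [|apply Phi_dom_ex].
      intro k. rewrite Cmod_mult, Cmod_R. apply Phi_dom_le; auto using Cmod_ge_0, Rabs_pos.
      eapply Rle_trans; [apply Cmod_cexp_le|]. apply exp_le. rewrite Cmod_mult, Cmod_R, Rmult_comm.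
      apply Rmult_le_compat_r; [apply Rabs_pos|]. generalize (Rle_abs r); lra. }
    split; auto.
    rewrite <- Series_zero. apply Series_le; [|apply Phi_dom_ex].
    intro k; split; [lra|]. unfold Phi_dom. apply Rmult_le_pos.
    - apply Rmult_le_pos; auto. apply Rlt_le, exp_pos.
    - apply Rmult_le_pos; [apply pow_le, Rmult_le_pos; auto; apply Rlt_le, exp_pos|].
      apply Rlt_le, Rinv_0_lt_compat, fact_pos. }
  destruct (Bd c Hc) as [M1 [M10 H1]], (Bd _ Hc') as [M2 [M20 H2]].
  destruct Hc as [B [L [B0 [L0 H]]]].
  (* With lam = mu + 2k and h = v - w, the k-th remainder is at most |c_k| e^(|lam| r) |lam h|^2
     e^(2 |lam| r), and lam^2 <= e^(2 |lam|): together e^((3 r + 2) |lam|). *)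
  set (r' := 3 * Rabs r + 2).
  assert (r'0 : 0 <= r') by (unfold r'; generalize (Rabs_pos r); lra).
  set (S3 := Series (Phi_dom mu B L r')).
  exists (M1 + M2 + Rabs S3). split; [generalize (Rabs_pos S3); lra|].
  intros v w Hv Hw. specialize (H1 w Hw). specialize (H2 w Hw).
  repeat split; try (generalize (Rabs_pos S3); lra).
  assert (Hr : 0 <= r) by (eapply Rle_trans; [apply (Cmod_ge_0 w) | auto]).
  replace (Phi mu c v - Phi mu c w - Phi mu (fun k => ((mu + 2 * INR k) * c k)%R) w * (v - w))%C with
    (CSeries (fun k => RtoC (c k) * cexp (RtoC (mu + 2 * INR k) * v) - RtoC (c k) * cexp (RtoC (mu + 2 * INR k)
      * w)
       - (v - w) * (RtoC ((mu + 2 * INR k) * c k) * cexp (RtoC (mu + 2 * INR k) * w)))%C).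
  2: { rewrite CSeries_minus, CSeries_minus, CSeries_scal.
       - unfold Phi. ring.
       - now apply (Phi_csum mu (fun k => (mu + 2 * INR k) * c k)).
       - apply Phi_csum. now exists B, L.
       - apply Phi_csum. now exists B, L.
       - unfold Cminus at 1. eapply csum_plus; [apply Phi_csum; now exists B, L|].
         assert (X := csum_scal (- (1))%C _ (Phi_csum mu c w (ex_intro _ B (ex_intro _ L (conj B0 (conj L0
           H)))))).
         destruct X as [X1 X2]. split; [eapply ex_series_ext; [|exact X1] | eapply ex_series_ext; [|exact X2]];
           intro k; f_equal; simpl; ring.
       - now apply csum_scal, (Phi_csum mu (fun k => (mu + 2 * INR k) * c k)). }
  apply Rle_trans with (Series (fun k => Cmod (v - w)%C ^ 2 * Phi_dom mu B L r' k)).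
  - apply CSeries_bound; [|apply ex_series_Rscal, Phi_dom_ex]. intro k.
    set (lam := mu + 2 * INR k). set (h := (v - w)%C).
    replace (RtoC (c k) * cexp (lam * v) - c k * cexp (lam * w) - h * (RtoC (lam * c k) * cexp (lam * w)))%C
      with
     (c k * (cexp (lam * w) * (cexp (lam * h) - 1 - lam * h)))%C.
    2: { replace (lam * v)%C with (lam * w + lam * h)%C by (unfold h; ring). rewrite cexp_plus, RtoC_mult.
         ring. }
    rewrite !Cmod_mult, Cmod_R.
    apply Rle_trans with (Rabs (c k) * (exp (Rabs lam * Rabs r) * ((Rabs lam * Cmod h) ^ 2 * exp (Rabs lam * (2
      * Rabs r))))).
    + apply Rmult_le_compat_l; [apply Rabs_pos|]. apply Rmult_le_compat; auto using Cmod_ge_0.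
      * eapply Rle_trans; [apply Cmod_cexp_le|]. apply exp_le. rewrite Cmod_mult, Cmod_R.
        apply Rmult_le_compat_l; [apply Rabs_pos|]. generalize (Rle_abs r); lra.
      * eapply Rle_trans; [apply cexp_rest2|]. rewrite Cmod_mult, Cmod_R.
        apply Rmult_le_compat_l; [apply pow2_ge_0|]. apply exp_le. apply Rmult_le_compat_l; [apply Rabs_pos|].
        eapply Rle_trans; [apply Cmod_minus_le|]. generalize (Rle_abs r); lra.
    + replace (Rabs (c k) * (exp (Rabs lam * Rabs r) * ((Rabs lam * Cmod h) ^ 2 * exp (Rabs lam * (2 * Rabs
        r)))))
       with (Cmod h ^ 2 * (Rabs (c k) * (Rabs lam ^ 2 * exp (Rabs lam * Rabs r) * exp (Rabs lam * (2 * Rabs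
         r))))) by ring.
      apply Rmult_le_compat_l; [apply pow2_ge_0|].
      apply Phi_dom_le; auto.
      * apply Rmult_le_pos; [apply Rmult_le_pos; [apply pow2_ge_0|]|]; apply Rlt_le, exp_pos.
      * fold lam. rewrite Rmult_assoc, <- exp_plus.
        apply Rle_trans with (exp (2 * Rabs lam) * exp (Rabs lam * Rabs r + Rabs lam * (2 * Rabs r))).
        -- apply Rmult_le_compat_r; [apply Rlt_le, exp_pos|].
           replace (2 * Rabs lam) with (Rabs lam + Rabs lam) by ring. rewrite exp_plus.
           generalize (exp_ineq1_le (Rabs lam)) (Rabs_pos lam); intros; nra.
        -- rewrite <- exp_plus. apply exp_le. unfold r'. right; ring.
  - rewrite Series_scal_l. rewrite Rmult_comm. apply Rmult_le_compat_r; [apply pow2_ge_0|].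
    fold S3. generalize (Rle_abs S3); lra.
Qed.

Lemma Phi_ext mu c d w : (forall k, c k = d k) -> Phi mu c w = Phi mu d w.
Proof. intros E. apply CSeries_ext. intro k; rewrite E; reflexivity. Qed.

Lemma Phi_plus mu c d w : Fast c -> Fast d -> Phi mu (fun k => c k + d k) w = (Phi mu c w + Phi mu d w)%C.
Proof.
  intros. unfold Phi. rewrite <- CSeries_plus; auto using Phi_csum. apply CSeries_ext; intro k.
  rewrite RtoC_plus. ring.
Qed.

Lemma Phi_scal mu a c w : Fast c -> Phi mu (fun k => a * c k) w = (a * Phi mu c w)%C.
Proof.
  intros. unfold Phi. rewrite <- CSeries_scal; auto using Phi_csum. apply CSeries_ext; intro k.
  rewrite RtoC_mult. ring.
Qed.

Lemma Phi_shift mu c w : Fast c -> Phi mu (shift0 c) w = (cexp (2 * w) * Phi mu c w)%C.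
Proof.
  intros H. unfold Phi. rewrite CSeries_incr by (apply Phi_csum, Fast_shift; auto).
  rewrite <- CSeries_scal by auto using Phi_csum. simpl shift0. rewrite Cmult_0_l, Cplus_0_l.
  apply CSeries_ext; intro k.
  replace (RtoC (mu + 2 * INR (S k)) * w)%C with (2 * w + RtoC (mu + 2 * INR k) * w)%C.
  - rewrite cexp_plus. ring.
  - rewrite S_INR, !RtoC_plus, !RtoC_mult, !RtoC_plus. ring.
Qed.

Lemma Phi_drop mu c w : Fast c -> c O = 0 -> Phi mu c w = (cexp (2 * w) * Phi mu (fun k => c (S k)) w)%C.
Proof.
  intros H H0. unfold Phi. rewrite CSeries_incr by (apply Phi_csum; auto).
  rewrite H0, Cmult_0_l, Cplus_0_l.
  rewrite <- CSeries_scal.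
  - apply CSeries_ext; intro k.
    replace (RtoC (mu + 2 * INR (S k)) * w)%C with (2 * w + RtoC (mu + 2 * INR k) * w)%C.
    + rewrite cexp_plus. ring.
    + rewrite S_INR, !RtoC_plus, !RtoC_mult, !RtoC_plus. ring.
  - destruct (csum_scal (cexp (- (2 * w))) _ (Phi_csum mu c w H)) as [H1 H2].
    apply ex_series_incr_1 in H1. apply ex_series_incr_1 in H2.
    split; [eapply ex_series_ext; [|exact H1] | eapply ex_series_ext; [|exact H2]]; intro k;
    first [apply (f_equal Re) | apply (f_equal Im)];
    (replace (RtoC (mu + 2 * INR (S k)) * w)%C with (2 * w + RtoC (mu + 2 * INR k) * w)%C;
     [rewrite cexp_plus, cexp_opp; field; apply cexp_neq_0
     |rewrite S_INR, !RtoC_plus, !RtoC_mult, !RtoC_plus; ring]).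
Qed.

Lemma Phi_order mu nu c w : Fast c -> Phi (mu + nu) c w = (cexp (nu * w) * Phi mu c w)%C.
Proof.
  intros. unfold Phi. rewrite <- CSeries_scal by auto using Phi_csum. apply CSeries_ext; intro k.
  replace (RtoC (mu + nu + 2 * INR k) * w)%C with (nu * w + RtoC (mu + 2 * INR k) * w)%C.
  - rewrite cexp_plus. ring.
  - rewrite !RtoC_plus. ring.
Qed.

(** For x <= 0 every term beyond the first carries e^(2kx) <= e^(2x). *)
Lemma Phi_limit mu c : Fast c -> exists M, 0 <= M /\ forall x : R, x <= 0 ->
  Cmod (cexp (- RtoC mu * RtoC x) * Phi mu c (RtoC x) - c O)%C <= M * exp (2 * x).
Proof.
  intros [B [L [B0 [L0 H]]]].
  assert (Hc : Fast c) by (now exists B, L).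
  exists (Series (fun k => B * (L ^ k / INR (fact k)))). split.
  { rewrite <- Series_zero. apply Series_le; [|apply ex_series_Rscal, ex_series_exp].
    intro k; split; [lra|]. eapply Rle_trans; [apply Rabs_pos | apply H]. }
  intros x Hx. rewrite Rmult_comm, <- Series_scal_l.
  replace (cexp (- mu * x) * Phi mu c x - c O)%C with
    (CSeries (fun k => match k with O => 0 | S _ => RtoC (c k) * cexp (RtoC (2 * INR k) * x) end)%C).
  - apply CSeries_bound; [|apply ex_series_Rscal, ex_series_Rscal, ex_series_exp].
    intros [|k].
    + rewrite Cmod_0. generalize (exp_pos (2 * x)); intros.
      apply Rmult_le_pos; [lra|]. eapply Rle_trans; [apply Rabs_pos | apply (H O)].
    + rewrite Cmod_mult, Cmod_R, Cmod_cexp, Rmult_comm.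
      apply Rmult_le_compat; auto using Rabs_pos. apply Rlt_le, exp_pos.
      apply exp_le. rewrite S_INR. simpl. generalize (pos_INR k); nra.
  - unfold Phi. rewrite <- CSeries_scal by auto using Phi_csum.
    rewrite (CSeries_ext (fun k => cexp (- mu * x) * (c k * cexp (RtoC (mu + 2 * INR k) * x)))%C
      (fun k => RtoC (c k) * cexp (RtoC (0 + 2 * INR k) * x))%C).
    2: { intro k. replace (RtoC (mu + 2 * INR k) * x)%C with (RtoC mu * x + RtoC (0 + 2 * INR k) * x)%C.
         - rewrite cexp_plus. replace (- RtoC mu * x)%C with (- (RtoC mu * x))%C by ring. rewrite cexp_opp.
           field. apply cexp_neq_0.
         - rewrite !RtoC_plus. ring. }
    rewrite (CSeries_incr (fun k => RtoC (c k) * cexp (RtoC (0 + 2 * INR k) * x))%C) by (now apply Phi_csum).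
    simpl INR at 1. rewrite Rmult_0_r, Rplus_0_r, Cmult_0_l, cexp_0.
    rewrite CSeries_incr.
    + rewrite Cplus_0_l, Cmult_1_r. unfold Cminus.
      rewrite (Cplus_comm (c O)), <- Cplus_assoc, Cplus_opp_r, Cplus_0_r.
      apply CSeries_ext. intro k. do 4 f_equal. ring.
    + destruct (Phi_csum 0 c x Hc) as [H1 H2].
      apply ex_series_incr_1 in H1. apply ex_series_incr_1 in H2.
      split; apply <- (ex_series_incr_1 (V := R_NormedModule));
      [eapply ex_series_ext; [|exact H1] | eapply ex_series_ext; [|exact H2]]; intro k;
      cbv beta iota; rewrite Rplus_0_l; reflexivity.
Qed.

(** * Solutions of the modified Bessel equation in the variable w *)

(* Limits as [x] tends to minus infinity, that is as [t = e^x] tends to 0. *)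
Definition clim (f : R -> C) (l : C) :=
  forall eps, 0 < eps -> exists X, forall x, x <= X -> Cmod (f x - l)%C <= eps.

Lemma clim_ext f g l : (forall x, f x = g x) -> clim f l -> clim g l.
Proof. intros E H eps He. destruct (H eps He) as [X HX]. exists X. intros x Hx. rewrite <- E. auto. Qed.

Lemma clim_const c : clim (fun _ => c) c.
Proof. intros eps He. exists 0. intros x _. replace (c - c)%C with (RtoC 0) by ring. rewrite Cmod_0. lra. Qed.

Lemma clim_plus f g l m : clim f l -> clim g m -> clim (fun x => f x + g x)%C (l + m)%C.
Proof.
  intros Hf Hg eps He. destruct (Hf (eps / 2)) as [X HX]; [lra|]. destruct (Hg (eps / 2)) as [Y HY]; [lra|].
  exists (Rmin X Y). intros x Hx.
  specialize (HX x (Rle_trans _ _ _ Hx (Rmin_l _ _))). specialize (HY x (Rle_trans _ _ _ Hx (Rmin_r _ _))).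
  replace (f x + g x - (l + m))%C with ((f x - l) + (g x - m))%C by ring.
  eapply Rle_trans; [apply Cmod_triangle|]. lra.
Qed.

Lemma clim_mult f g l m : clim f l -> clim g m -> clim (fun x => f x * g x)%C (l * m)%C.
Proof.
  intros Hf Hg eps He.
  set (K := Cmod l + Cmod m + 2).
  assert (HK : 0 < K) by (unfold K; generalize (Cmod_ge_0 l) (Cmod_ge_0 m); lra).
  set (d := Rmin 1 (eps / K)).
  assert (Hd : 0 < d) by (apply Rmin_pos; [lra | now apply Rdiv_lt_0_compat]).
  destruct (Hf d Hd) as [X HX]. destruct (Hg d Hd) as [Y HY].
  exists (Rmin X Y). intros x Hx.
  specialize (HX x (Rle_trans _ _ _ Hx (Rmin_l _ _))). specialize (HY x (Rle_trans _ _ _ Hx (Rmin_r _ _))).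
  replace (f x * g x - l * m)%C with ((f x - l) * (g x - m) + (f x - l) * m + l * (g x - m))%C by ring.
  eapply Rle_trans; [apply Cmod_triangle|]. eapply Rle_trans; [apply Rplus_le_compat_r, Cmod_triangle|].
  rewrite !Cmod_mult.
  assert (d1 : d <= 1) by apply Rmin_l. assert (d2 : d * K <= eps).
  { apply Rle_trans with (eps / K * K); [apply Rmult_le_compat_r; [lra | apply Rmin_r] | right; field; lra]. }
  generalize (Cmod_ge_0 l) (Cmod_ge_0 m) (Cmod_ge_0 (f x - l)%C) (Cmod_ge_0 (g x - m)%C); intros.
  assert (Cmod (f x - l)%C * Cmod (g x - m)%C <= d * 1) by (apply Rmult_le_compat; lra).
  assert (Cmod (f x - l)%C * Cmod m <= d * Cmod m) by (apply Rmult_le_compat; lra).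
  assert (Cmod l * Cmod (g x - m)%C <= Cmod l * d) by (apply Rmult_le_compat; lra).
  unfold K in d2. nra.
Qed.

Lemma clim_scal c f l : clim f l -> clim (fun x => c * f x)%C (c * l)%C.
Proof. intros; apply clim_mult; auto using clim_const. Qed.

Lemma clim_minus f g l m : clim f l -> clim g m -> clim (fun x => f x - g x)%C (l - m)%C.
Proof.
  intros Hf Hg. replace (l - m)%C with (l + (- (1)) * m)%C by ring.
  apply clim_ext with (fun x => f x + (- (1)) * g x)%C; [intro; ring|].
  apply clim_plus; auto using clim_scal.
Qed.

Lemma clim_unique f l m : clim f l -> clim f m -> l = m.
Proof.
  intros Hf Hg. apply Ceq_minus, Cmod_eq_0, Rle_antisym; [|apply Cmod_ge_0].
  apply le_epsilon. intros eps He. destruct (Hf (eps / 2)) as [X HX]; [lra|].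
  destruct (Hg (eps / 2)) as [Y HY]; [lra|].
  specialize (HX _ (Rmin_l X Y)). specialize (HY _ (Rmin_r X Y)).
  eapply Rle_trans; [apply (Cmod_triangle3 _ (f (Rmin X Y)))|]. rewrite Cmod_minus_sym. lra.
Qed.

Lemma clim_exp a : 0 < a -> clim (fun x => RtoC (exp (a * x))) 0%C.
Proof.
  intros Ha eps He. exists (ln eps / a). intros x Hx.
  replace (exp (a * x) - 0)%C with (RtoC (exp (a * x))) by ring.
  rewrite Cmod_R, Rabs_pos_eq by (apply Rlt_le, exp_pos). rewrite <- (exp_ln eps) at 1 by auto.
  apply exp_le. apply Rle_trans with (a * (ln eps / a)); [apply Rmult_le_compat_l; lra | right; field; lra].
Qed.

Lemma clim_le f g : (exists X, forall x, x <= X -> Cmod (f x) <= Cmod (g x)) -> clim g 0%C -> clim f 0%C.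
Proof.
  intros [X HX] Hg eps He. destruct (Hg eps He) as [Y HY]. exists (Rmin X Y). intros x Hx.
  specialize (HX x (Rle_trans _ _ _ Hx (Rmin_l _ _))). specialize (HY x (Rle_trans _ _ _ Hx (Rmin_r _ _))).
  replace (f x - 0)%C with (f x) by ring. replace (g x - 0)%C with (g x) in HY by ring. lra.
Qed.

Lemma Phi_clim mu c : Fast c -> clim (fun x => cexp (- RtoC mu * RtoC x) * Phi mu c (RtoC x))%C (RtoC (c O)).
Proof.
  intros Hc. destruct (Phi_limit mu c Hc) as [M [M0 H]]. intros eps He.
  destruct (clim_exp 2 Rlt_0_2 (eps / (M + 1))) as [X HX]; [apply Rdiv_lt_0_compat; lra|].
  exists (Rmin 0 X). intros x Hx. eapply Rle_trans; [apply H, (Rle_trans _ _ _ Hx), Rmin_l|].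
  specialize (HX x (Rle_trans _ _ _ Hx (Rmin_r _ _))).
  replace (exp (2 * x) - 0)%C with (RtoC (exp (2 * x))) in HX by ring.
  rewrite Cmod_R, Rabs_pos_eq in HX by (apply Rlt_le, exp_pos).
  apply Rle_trans with ((M + 1) * (eps / (M + 1))); [|right; field; lra].
  apply Rmult_le_compat; try lra. apply Rlt_le, exp_pos.
Qed.

(** * Frobenius series at t = 0 *)

Fixpoint poch (a : R) (k : nat) : R := match k with O => 1 | S j => poch a j * (a + INR j) end.

Definition nonpole (mu : R) := forall j, 1 + mu + INR j <> 0.

(** Frobenius coefficients normalized by c_0 = 1 instead of 1 / Gamma (1 + mu), so that the equation
    and the recurrences involve no Gamma function. *)
Definition cf (mu : R) (k : nat) : R := / (4 ^ k * INR (fact k) * poch (1 + mu) k).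

Lemma poch_neq_0 mu k : nonpole mu -> poch (1 + mu) k <> 0.
Proof. intros H. induction k; simpl; [lra|]. apply Rmult_integral_contrapositive_currified; auto. Qed.

Lemma nonpole_S mu : nonpole mu -> nonpole (mu + 1).
Proof. intros H j. generalize (H (S j)). rewrite S_INR. intros; lra. Qed.

Lemma nonpole_pos mu : 0 <= mu -> nonpole mu.
Proof. intros H j. generalize (pos_INR j); lra. Qed.

Lemma poch_S_l a k : poch a (S k) = a * poch (1 + a) k.
Proof. induction k; [simpl; ring|]. change (poch a (S (S k))) with (poch a (S k) * (a + INR (S k))).
  rewrite IHk, S_INR. simpl. ring. Qed.

(** Finitely many factors need a minimum, the others are at least 1 in absolute value. The uniform
    gap [d] gives |(1 + mu)_k| >= d^k, hence [Fast] with L = 1 / (4 d). *)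
Lemma nonpole_gap mu : nonpole mu -> exists d, 0 < d /\ forall j, d <= Rabs (1 + mu + INR j).
Proof.
  intros H.
  assert (F : forall N, exists d, 0 < d /\ forall j, (j <= N)%nat -> d <= Rabs (1 + mu + INR j)).
  { induction N as [|N [d [d0 Hd]]].
    - exists (Rabs (1 + mu + INR 0)). split; [apply Rabs_pos_lt, H|]. intros j Hj. replace j with O by lia. lra.
    - exists (Rmin d (Rabs (1 + mu + INR (S N)))). split; [apply Rmin_pos; auto; apply Rabs_pos_lt, H|].
      intros j Hj. destruct (Nat.eq_dec j (S N)) as [->|]; [apply Rmin_r|].
      eapply Rle_trans; [apply Rmin_l | apply Hd; lia]. }
  destruct (INR_unbounded (Rabs (1 + mu) + 1)) as [N HN].
  destruct (F N) as [d [d0 Hd]]. exists (Rmin d 1). split; [apply Rmin_pos; lra|].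
  intros j. destruct (le_lt_dec j N) as [Hj|Hj].
  - eapply Rle_trans; [apply Rmin_l | auto].
  - eapply Rle_trans; [apply Rmin_r|]. apply lt_INR in Hj.
    generalize (Rabs_triang_inv (INR j) (- (1 + mu))).
    rewrite Rabs_Ropp, (Rabs_pos_eq (INR j)) by apply pos_INR.
    replace (INR j - - (1 + mu)) with (1 + mu + INR j) by ring. lra.
Qed.

Lemma poch_ge a d : 0 < d -> (forall j, d <= Rabs (a + INR j)) -> forall k, d ^ k <= Rabs (poch a k).
Proof.
  intros d0 Hd. induction k; simpl; [rewrite Rabs_R1; lra|]. rewrite Rabs_mult, Rmult_comm.
  apply Rmult_le_compat; auto; [apply pow_le | ]; lra.
Qed.

Lemma Fast_cf mu : nonpole mu -> Fast (cf mu).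
Proof.
  intros H. destruct (nonpole_gap mu H) as [d [d0 Hd]].
  exists 1, (/ (4 * d)). repeat split; [lra | apply Rlt_le, Rinv_0_lt_compat; lra |]. intro k.
  unfold cf. rewrite Rmult_1_l, Rabs_inv, !Rabs_mult.
  rewrite (Rabs_pos_eq (4 ^ k)) by (apply pow_le; lra).
  rewrite (Rabs_pos_eq (INR (fact k))) by (apply Rlt_le, fact_pos).
  rewrite pow_inv. unfold Rdiv. rewrite <- Rinv_mult.
  assert (0 < (4 * d) ^ k) by (apply pow_lt; lra).
  apply Rinv_le_contravar; [apply Rmult_lt_0_compat; auto using fact_pos|].
  rewrite Rpow_mult_distr. generalize (poch_ge _ d d0 Hd k) (fact_pos k) (pow_lt 4 k); intros.
  replace (4 ^ k * d ^ k * INR (fact k)) with (4 ^ k * INR (fact k) * d ^ k) by ring.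
  apply Rmult_le_compat_l; auto. apply Rlt_le, Rmult_lt_0_compat; auto; lra.
Qed.

Lemma cf_0 mu : cf mu 0 = 1.
Proof. unfold cf; simpl. field. Qed.

Lemma cf_S mu j : nonpole mu -> cf mu j = 4 * (INR j + 1) * (INR j + 1 + mu) * cf mu (S j).
Proof.
  intros H. unfold cf. rewrite fact_simpl, mult_INR, S_INR. simpl.
  generalize (poch_neq_0 mu j H) (H j) (INR_fact_neq_0 j) (pos_INR j); intros.
  assert (4 ^ j <> 0) by (apply pow_nonzero; lra).
  field. repeat split; auto; lra.
Qed.

Definition Sol (nu : R) (f f' : C -> C) :=
  Hol f f' /\ Hol f' (fun w => (RtoC (nu ^ 2) + cexp (2 * w)) * f w)%C.

Definition phi mu := Phi mu (cf mu).
Definition dphi mu := Phi mu (fun k => (mu + 2 * INR k) * cf mu k).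

Lemma Fast_scal a c : Fast c -> Fast (fun k => a * c k).
Proof.
  intros [B [L [B0 [L0 H]]]]. exists (Rabs a * B), L. repeat split; auto.
  - apply Rmult_le_pos; auto using Rabs_pos.
  - intro k. rewrite Rabs_mult, Rmult_assoc. apply Rmult_le_compat_l; auto using Rabs_pos.
Qed.

Lemma Sol_phi mu : nonpole mu -> Sol mu (phi mu) (dphi mu).
Proof.
  intros H. assert (Hc := Fast_cf mu H). split; [exact (Hol_Phi mu _ Hc)|].
  refine (Hol_ext_r _ _ _ _ (Hol_Phi mu _ (Fast_mul mu _ Hc))). intro w. unfold phi.
  rewrite Cmult_plus_distr_r, <- Phi_shift, <- Phi_scal, <- Phi_plus by auto using Fast_shift, Fast_scal.
  (* Comparing coefficients of t^(mu + 2k): ((mu + 2k)^2 - mu^2) c_k = c_(k-1), which is [cf_S]. *)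
  apply Phi_ext. intros [|j]; simpl shift0.
  - simpl INR. ring.
  - rewrite (cf_S mu j H), S_INR. ring.
Qed.

Lemma phi_clim mu : nonpole mu -> clim (fun x => cexp (- RtoC mu * RtoC x) * phi mu (RtoC x))%C 1%C.
Proof. intros H. rewrite <- (cf_0 mu). apply Phi_clim, Fast_cf, H. Qed.

Lemma dphi_clim mu : nonpole mu -> clim (fun x => cexp (- RtoC mu * RtoC x) * dphi mu (RtoC x))%C (RtoC mu).
Proof.
  intros H. generalize (Phi_clim mu _ (Fast_mul mu _ (Fast_cf mu H))). cbv beta.
  rewrite cf_0. replace ((mu + 2 * INR 0) * 1) with mu by (simpl; ring). auto.
Qed.

Definition Wr (f f' g g' : C -> C) (w : C) : C := (f w * g' w - f' w * g w)%C.

Lemma Hol_Wr nu mu f f' g g' : Sol nu f f' -> Sol mu g g' ->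
  Hol (Wr f f' g g') (fun w => RtoC (mu ^ 2 - nu ^ 2) * (f w * g w))%C.
Proof.
  intros [F1 F2] [G1 G2]. eapply Hol_ext_r.
  2: apply Hol_minus; apply Hol_mult; eassumption.
  intro w; simpl. rewrite RtoC_minus. ring.
Qed.

Lemma Wr_const nu f f' g g' v w : Sol nu f f' -> Sol nu g g' -> Wr f f' g g' v = Wr f f' g g' w.
Proof.
  intros F G. apply Hol_const_of_0. eapply Hol_ext_r; [|apply (Hol_Wr nu nu); eassumption].
  intro; simpl. replace (nu * (nu * 1) - nu * (nu * 1)) with 0 by ring. ring.
Qed.

Lemma Wr_of_clim nu f f' g g' w l : Sol nu f f' -> Sol nu g g' ->
  clim (fun x => Wr f f' g g' (RtoC x)) l -> Wr f f' g g' w = l.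
Proof.
  intros F G H. apply (clim_unique (fun x => Wr f f' g g' (RtoC x))); auto.
  apply clim_ext with (fun _ => Wr f f' g g' w); [intro; eapply Wr_const; eassumption | apply clim_const].
Qed.

(** The Wronskian is constant, hence equal to its limit at t = 0, where the powers t^nu and t^(-nu)
    cancel. *)
Lemma Wr_phi nu w : nonpole nu -> nonpole (- nu) -> Wr (phi nu) (dphi nu) (phi (- nu)) (dphi (- nu)) w = RtoC
  (- (2 * nu)).
Proof.
  intros H1 H2. apply (Wr_of_clim nu); auto using Sol_phi.
  (* The equation depends only on the square of the order. *)
  - destruct (Sol_phi (- nu) H2) as [A B]. split; auto. eapply Hol_ext_r; [|exact B].
    intro; simpl. f_equal. f_equal. f_equal. ring.
  - replace (RtoC (- (2 * nu))) with (1 * RtoC (- nu) - RtoC nu * 1)%C by (rewrite !RtoC_opp, RtoC_mult; ring).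
    eapply clim_ext; [|apply clim_minus; apply clim_mult;
      [apply (phi_clim nu H1) | apply (dphi_clim (- nu) H2) | apply (dphi_clim nu H1) | apply (phi_clim (- nu)
        H2)]].
    intro x; simpl. unfold Wr.
    replace (- RtoC (- nu) * x)%C with (- (- RtoC nu * x))%C by (rewrite RtoC_opp; ring).
    rewrite cexp_opp. field. apply cexp_neq_0.
Qed.

(* The recurrence [K_{nu+1} = (nu / t) K_nu - dK_nu/dt], which raises the order of any solution. *)
Definition Tu (nu : R) (u u' : C -> C) (w : C) : C := (cexp (- w) * (RtoC nu * u w - u' w))%C.
Definition dTu (nu : R) (u u' : C -> C) (w : C) : C := (- RtoC (nu + 1) * Tu nu u u' w - cexp w * u w)%C.

Lemma Hol_cexp_scal c : Hol (fun w => cexp (c * w))%C (fun w => c * cexp (c * w))%C.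
Proof.
  eapply Hol_ext_r; [|apply (Hol_comp _ _ (fun w => c * w)%C (fun w => c * 1)%C Hol_cexp)].
  - intro; simpl; ring.
  - apply Hol_scal, Hol_id.
Qed.

Lemma Hol_cexp_opp : Hol (fun w => cexp (- w))%C (fun w => - cexp (- w))%C.
Proof.
  eapply Hol_ext; [| |apply (Hol_cexp_scal (- (1))%C)]; intro w; simpl;
  replace (- (1) * w)%C with (- w)%C by ring; ring.
Qed.

Lemma cexp_2 w : cexp (2 * w)%C = (cexp w * cexp w)%C.
Proof. rewrite <- cexp_plus. f_equal. ring. Qed.

Lemma Sol_T nu u u' : Sol nu u u' -> Sol (nu + 1) (Tu nu u u') (dTu nu u u').
Proof.
  intros [H1 H2].
  assert (HT : Hol (Tu nu u u') (dTu nu u u')).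
  { eapply Hol_ext_r.
    2: apply Hol_mult; [apply Hol_cexp_opp | apply Hol_minus; [apply Hol_scal, H1 | apply H2]].
    intro w; simpl. unfold dTu, Tu. rewrite cexp_opp, cexp_2, RtoC_plus, !RtoC_mult. field. apply cexp_neq_0. }
  split; auto.
  eapply Hol_ext_r.
  2: apply Hol_minus; [apply Hol_scal, HT | apply Hol_mult; [apply Hol_cexp | apply H1]].
  intro w; simpl. unfold dTu, Tu. rewrite cexp_opp, cexp_2, RtoC_mult, RtoC_mult, !RtoC_plus. field.
  apply cexp_neq_0.
Qed.

(** The relation between I_mu and I_(mu+1) in the normalization of [phi]. The constant coefficient
    of mu phi - phi' vanishes; the factor t^2 split off by [Phi_drop], divided by t, raises the
    exponent to mu + 1. *)
Lemma phi_rec_up mu w : nonpole mu -> Tu mu (phi mu) (dphi mu) w = (RtoC (- / (2 * (1 + mu))) * phi (mu + 1)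
  w)%C.
Proof.
  intros H. assert (Hc := Fast_cf mu H). assert (Hc' := Fast_mul mu _ Hc). unfold Tu.
  assert (H0 : 1 + mu <> 0) by (generalize (H O); simpl; lra).
  replace (RtoC mu * phi mu w - dphi mu w)%C with (Phi mu (fun k => (0 + 2 * INR k) * (-1 * cf mu k)) w).
  - rewrite Phi_drop; [| apply Fast_mul, Fast_scal, Hc | simpl; ring].
    unfold phi. rewrite Phi_order by (apply Fast_cf, nonpole_S, H). rewrite Cmult_1_l.
    rewrite (Phi_ext mu _ (fun k => (- / (2 * (1 + mu))) * cf (mu + 1) k)).
    + rewrite Phi_scal by (apply Fast_cf, nonpole_S, H). rewrite cexp_opp, cexp_2. field. apply cexp_neq_0.
    + intro k. unfold cf. rewrite S_INR, fact_simpl, mult_INR, S_INR. rewrite poch_S_l.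
      replace (1 + (mu + 1)) with (1 + (1 + mu)) by ring. simpl.
      assert (poch (1 + (1 + mu)) k <> 0).
      { replace (1 + (1 + mu)) with (1 + (mu + 1)) by ring. apply poch_neq_0, nonpole_S, H. }
      generalize (INR_fact_neq_0 k) (pos_INR k); intros.
      assert (4 ^ k <> 0) by (apply pow_nonzero; lra).
      field. repeat split; auto; lra.
  - unfold phi, dphi. rewrite <- Phi_scal by auto.
    replace (Phi mu (fun k => (mu * cf mu k)%R) w - Phi mu (fun k => ((mu + 2 * INR k) * cf mu k)%R) w)%C with
     (Phi mu (fun k => (mu * cf mu k)%R) w + RtoC (- (1)) * Phi mu (fun k => ((mu + 2 * INR k) * cf mu k)%R)
       w)%C
     by (rewrite RtoC_opp; ring).
    rewrite <- Phi_scal, <- Phi_plus; auto using Fast_scal. apply Phi_ext. intro k. ring.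
Qed.

(** Coefficientwise this is (2 mu + 2k) (mu)_k = 2 mu (1 + mu)_k, the two factorizations of
    (mu)_(k+1). *)
Lemma phi_rec_down mu w : nonpole (mu - 1) ->
  (cexp (- w) * (RtoC mu * phi mu w + dphi mu w) = RtoC (2 * mu) * phi (mu - 1) w)%C.
Proof.
  intros H0. assert (H : nonpole mu) by (replace mu with (mu - 1 + 1) by ring; now apply nonpole_S).
  assert (Hc := Fast_cf mu H). assert (Hc' := Fast_mul mu _ Hc).
  assert (M0 : mu <> 0) by (generalize (H0 O); simpl; lra).
  unfold phi, dphi. rewrite <- Phi_scal, <- Phi_plus; auto using Fast_scal.
  rewrite (Phi_ext mu _ (fun k => 2 * mu * cf (mu - 1) k)).
  - rewrite Phi_scal by (now apply Fast_cf).
    replace mu with ((mu - 1) + 1) at 2 by ring. rewrite Phi_order by (now apply Fast_cf).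
    rewrite Cmult_1_l, cexp_opp. field. apply cexp_neq_0.
  - intro k. unfold cf.
    assert (E := poch_S_l mu k). simpl in E. replace (1 + (mu - 1)) with mu by ring.
    assert (P1 := poch_neq_0 mu k H). assert (P2 := poch_neq_0 (mu - 1) k H0).
    replace (1 + (mu - 1)) with mu in P2 by ring.
    assert (4 ^ k <> 0) by (apply pow_nonzero; lra). generalize (INR_fact_neq_0 k); intros.
    apply Rmult_eq_reg_r with (4 ^ k * INR (fact k) * poch (1 + mu) k * poch mu k);
      [|repeat apply Rmult_integral_contrapositive_currified; auto].
    transitivity ((2 * mu + 2 * INR k) * poch mu k); [field; auto|].
    transitivity (2 * (mu * poch (1 + mu) k)); [|field; auto]. rewrite <- E. ring.
Qed.

(** * The logarithmic solution of order 0 *)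

Fixpoint harm (k : nat) : R := match k with O => 0 | S j => harm j + / (INR j + 1) end.

Lemma harm_bound k : 0 <= harm k <= INR k.
Proof.
  induction k as [|k IH]; [simpl; lra|]. rewrite S_INR. simpl harm.
  assert (0 < / (INR k + 1) <= 1).
  { generalize (pos_INR k); intros. split; [apply Rinv_0_lt_compat; lra|]. rewrite <- Rinv_1.
    apply Rinv_le_contravar; lra. }
  lra.
Qed.

(** The derivative of [cf mu k] in mu at mu = 0, since (1 + mu)_k has logarithmic derivative H_k
    there. Thus [psi0] is formally the derivative of [phi mu] at mu = 0; that it solves the equation
    is checked on coefficients. *)
Definition dlog (k : nat) := - harm k * cf 0 k.

Lemma Fast_dlog : Fast dlog.
Proof.
  destruct (Fast_mul 0 _ (Fast_cf 0 (nonpole_pos 0 (Rle_refl 0)))) as [B [L [B0 [L0 H]]]].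
  exists B, L. repeat split; auto. intro k. eapply Rle_trans; [|apply H]. unfold dlog.
  rewrite !Rabs_mult, Rabs_Ropp. apply Rmult_le_compat_r; [apply Rabs_pos|].
  generalize (harm_bound k); intros. rewrite !Rabs_pos_eq; generalize (pos_INR k); lra.
Qed.

(* The second solution of order 0 has a logarithm, which is the variable [w] itself. *)
Definition psi0 (w : C) : C := (w * phi 0 w + Phi 0 dlog w)%C.
Definition dpsi0 (w : C) : C := (phi 0 w + w * dphi 0 w + Phi 0 (fun k => ((0 + 2 * INR k) * dlog k)%R) w)%C.

Lemma Sol_psi0 : Sol 0 psi0 dpsi0.
Proof.
  assert (N0 := nonpole_pos 0 (Rle_refl 0)).
  destruct (Sol_phi 0 N0) as [H1 H2]. assert (Hc := Fast_cf 0 N0). assert (Hd := Fast_dlog).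
  assert (Hd' := Fast_mul 0 _ Hd).
  split.
  - eapply Hol_ext_r; [|apply Hol_plus; [apply Hol_mult; [apply Hol_id | apply H1] | apply Hol_Phi, Hd]].
    intro w; simpl. unfold dpsi0. ring.
  - eapply Hol_ext_r; [|apply Hol_plus; [apply Hol_plus; [apply H1 | apply Hol_mult;
      [apply Hol_id | apply H2]] | apply Hol_Phi, Hd']].
    intro w. cbv beta. unfold psi0. replace (0 ^ 2) with 0 by ring. fold (dphi 0) (phi 0).
    (* The cross term 2 phi' of (w phi)'' must be absorbed by the power series; on coefficients, 4k
       c_k + 4k^2 d_k = d_(k-1). *)
    assert (E : (2 * dphi 0 w + Phi 0 (fun k => ((0 + 2 * INR k) * ((0 + 2 * INR k) * dlog k))%R) w = cexp (2 *
      w) * Phi 0 dlog w)%C).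
    { rewrite <- Phi_shift by auto. unfold dphi.
      rewrite <- Phi_scal, <- Phi_plus; auto using Fast_mul, Fast_scal.
      - apply Phi_ext. intros [|j]; simpl shift0; [simpl; ring|]. unfold dlog. rewrite (cf_S 0 j) by auto.
        rewrite S_INR. simpl harm.
        field. generalize (pos_INR j); lra. }
    transitivity (w * ((0 + cexp (2 * w)) * phi 0 w) + (2 * dphi 0 w + Phi 0 (fun k => ((0 + 2 * INR k) * ((0 +
      2 * INR k) * dlog k))%R) w))%C; [replace (0 ^ 2) with 0 by ring; ring|].
    rewrite E. ring.
Qed.

(** The terms with a bare factor w cancel in the Wronskian, leaving phi^2 + phi D' - phi' D with D
    the series of [dlog]; the limit at t = 0 is therefore free of logarithms. *)
Lemma Wr_psi0 w : Wr (phi 0) (dphi 0) psi0 dpsi0 w = 1%C.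
Proof.
  assert (N0 := nonpole_pos 0 (Rle_refl 0)). assert (Hc := Fast_cf 0 N0). assert (Hd := Fast_dlog).
  assert (Hd' := Fast_mul 0 _ Hd).
  apply (Wr_of_clim 0); auto using Sol_phi, Sol_psi0.
  replace (RtoC 1) with (1 * 1 + 1 * RtoC ((fun k => ((0 + 2 * INR k) * dlog k)%R) O) - 0 * RtoC (dlog O))%C.
  2: { simpl. unfold dlog. simpl. replace ((0 + 2 * 0) * (- 0 * cf 0 0)) with 0 by ring. ring. }
  eapply clim_ext; [|apply clim_minus; [apply clim_plus; apply clim_mult;
    [apply (phi_clim 0 N0) | apply (phi_clim 0 N0) | apply (phi_clim 0 N0) | apply (Phi_clim 0 _ Hd')] | apply
      clim_mult; [apply (dphi_clim 0 N0) | apply (Phi_clim 0 _ Hd)]]].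
  intro x; simpl. unfold Wr, psi0, dpsi0. replace (- 0 * x)%C with (RtoC 0) by ring. rewrite cexp_0. ring.
Qed.

(** * The integral representation of K on the positive axis *)

(** An improper integral over [0, +oo[ reached along integer upper bounds: a sequential limit, which
    loses nothing under the exponential domination [Idom]. *)
Definition Int (f : R -> R) : R := real (Lim_seq (fun n => RInt f 0 (INR n))).

Definition Idom (f : R -> R) := (forall u, continuous f u) /\
  exists M, 0 <= M /\ forall u, 0 <= u -> Rabs (f u) <= M * exp (- u).

Lemma ex_RInt_cont (f : R -> R) a b : (forall u, continuous f u) -> ex_RInt f a b.
Proof. intros H. apply (ex_RInt_continuous (V := R_CompleteNormedModule)). auto. Qed.

Lemma RInt_exp_opp M a b : is_RInt (fun u => M * exp (- u)) a b (M * (exp (- a) - exp (- b))).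
Proof.
  replace (M * (exp (- a) - exp (- b))) with (minus (- M * exp (- b)) (- M * exp (- a))) by (unfold minus,
    plus, opp; simpl; ring).
  apply (is_RInt_derive (V := R_CompleteNormedModule) (fun u => - M * exp (- u))).
  - intros u _. auto_derive; auto; ring.
  - intros u _. apply (ex_derive_continuous (V := R_NormedModule)). auto_derive; auto.
Qed.

Lemma Int_lim f : Idom f -> is_lim_seq (fun n => RInt f 0 (INR n)) (Int f).
Proof.
  intros [Hc [M [M0 HM]]]. apply Lim_seq_correct'. apply ex_lim_seq_cauchy_corr.
  assert (G : forall n m, (n <= m)%nat -> Rabs (RInt f 0 (INR m) - RInt f 0 (INR n)) <= M * exp (- INR n)).
  { intros n m Hnm. apply le_INR in Hnm.
    rewrite <- (RInt_Chasles f 0 (INR n) (INR m)) by (apply ex_RInt_cont; auto).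
    unfold plus; simpl. rewrite Rplus_minus_l.
    apply Rle_trans with (M * (exp (- INR n) - exp (- INR m))).
    - apply (norm_RInt_le (V := R_NormedModule) f (fun u => M * exp (- u)) (INR n) (INR m)); auto.
      + intros u Hu. apply HM. generalize (pos_INR n); lra.
      + apply (RInt_correct (V := R_CompleteNormedModule)), ex_RInt_cont, Hc.
      + apply RInt_exp_opp.
    - generalize (exp_pos (- INR m)); nra. }
  intros eps.
  (* Since e^(-N) < 1 / N, any N above M / eps makes the tail small. *)
  destruct (INR_unbounded (M / eps)) as [N HN]. exists N.
  assert (S : M * exp (- INR N) < eps).
  { assert (INR N < exp (INR N)) by (generalize (exp_ineq1_le (INR N)); lra).
    rewrite exp_Ropp. apply Rmult_lt_reg_r with (exp (INR N)); [apply exp_pos|].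
    rewrite Rmult_assoc, Rinv_l by (apply Rgt_not_eq, exp_pos).
    generalize (cond_pos eps); intros. apply (Rmult_lt_compat_l eps) in HN; auto.
    replace (eps * (M / eps)) with M in HN by (field; lra). nra. }
  assert (K : forall n, (N <= n)%nat -> M * exp (- INR n) <= M * exp (- INR N)).
  { intros n Hn. apply le_INR in Hn. apply Rmult_le_compat_l; auto. apply exp_le; lra. }
  intros n m Hn Hm. destruct (Nat.le_ge_cases n m) as [H|H].
  - rewrite Rabs_minus_sym. eapply Rle_lt_trans; [apply G; auto|]. generalize (K n Hn); lra.
  - eapply Rle_lt_trans; [apply G; auto|]. generalize (K m Hm); lra.
Qed.

Lemma Int_unique f (l : R) : is_lim_seq (fun n => RInt f 0 (INR n)) l -> Int f = l.
Proof. intros H. unfold Int. rewrite (is_lim_seq_unique _ _ H). reflexivity. Qed.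

Lemma Idom_plus f g : Idom f -> Idom g -> Idom (fun u => f u + g u).
Proof.
  intros [F1 [M [M0 HM]]] [G1 [N [N0 HN]]]. split.
  - intro u. apply (continuous_plus (V := R_NormedModule)); auto.
  - exists (M + N). split; [lra|]. intros u Hu. eapply Rle_trans; [apply Rabs_triang|]. specialize (HM u Hu).
    specialize (HN u Hu). lra.
Qed.

Lemma Idom_scal a f : Idom f -> Idom (fun u => a * f u).
Proof.
  intros [F1 [M [M0 HM]]]. split.
  - intro u. apply (continuous_scal_r (V := R_NormedModule)); auto.
  - exists (Rabs a * M). split; [apply Rmult_le_pos; auto using Rabs_pos|]. intros u Hu.
    rewrite Rabs_mult, Rmult_assoc. apply Rmult_le_compat_l; auto using Rabs_pos.
Qed.

Lemma Int_plus f g : Idom f -> Idom g -> Int (fun u => f u + g u) = Int f + Int g.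
Proof.
  intros Hf Hg. apply Int_unique. eapply is_lim_seq_ext; [|apply is_lim_seq_plus';
    [apply (Int_lim f Hf) | apply (Int_lim g Hg)]].
  intro n. simpl. symmetry. apply (RInt_plus (V := R_CompleteNormedModule)); apply ex_RInt_cont;
    [apply Hf | apply Hg].
Qed.

Lemma Int_scal a f : Idom f -> Int (fun u => a * f u) = a * Int f.
Proof.
  intros Hf. apply Int_unique. eapply is_lim_seq_ext; [|apply (is_lim_seq_scal_l _ a _ (Int_lim f Hf))].
  intro n. simpl. symmetry. apply (RInt_scal (V := R_CompleteNormedModule)); apply ex_RInt_cont; apply Hf.
Qed.

Lemma Int_ext f g : (forall u, f u = g u) -> Int f = Int g.
Proof. intros E. unfold Int. f_equal. apply Lim_seq_ext. intro n. apply RInt_ext. auto. Qed.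

Lemma Int_le f g : Idom f -> Idom g -> (forall u, 0 <= u -> f u <= g u) -> Int f <= Int g.
Proof.
  intros Hf Hg H. apply (is_lim_seq_le (fun n => RInt f 0 (INR n)) (fun n => RInt g 0 (INR n)) (Int f) (Int
    g)); auto using Int_lim.
  intro n. apply RInt_le; [apply pos_INR | apply ex_RInt_cont, Hf | apply ex_RInt_cont, Hg |].
  intros; apply H; lra.
Qed.

Lemma Int_FTC (F f : R -> R) : (forall u, is_derive F u (f u)) -> (forall u, continuous f u) ->
  (exists M, forall u, 0 <= u -> Rabs (F u) <= M * exp (- u)) -> Int f = - F 0.
Proof.
  intros HF Hc [M HM]. apply Int_unique.
  apply is_lim_seq_ext with (fun n => F (INR n) - F 0).
  - intro n. symmetry. apply is_RInt_unique. apply (is_RInt_derive (V := R_CompleteNormedModule) F f); auto.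
  - replace (- F 0) with (0 - F 0) by ring. apply is_lim_seq_minus'; [|apply is_lim_seq_const].
    apply is_lim_seq_abs_0.
    apply is_lim_seq_le_le with (fun _ => 0) (fun n => Rabs M * / (INR n + 1)).
    + intro n. split; [apply Rabs_pos|]. eapply Rle_trans; [apply HM, pos_INR|].
      generalize (pos_INR n) (Rle_abs M) (Rabs_pos M) (exp_pos (- INR n)); intros.
      apply Rle_trans with (Rabs M * exp (- INR n)); [nra|]. apply Rmult_le_compat_l; auto.
      rewrite exp_Ropp. apply Rinv_le_contravar; [lra|]. generalize (exp_ineq1_le (INR n)); lra.
    + apply is_lim_seq_const.
    + replace (Finite 0) with (Rbar_mult (Rabs M) 0) by (simpl; f_equal; ring).
      apply is_lim_seq_scal_l. apply is_lim_seq_ext with (fun n => / INR (S n)); [intro; rewrite S_INR; auto|].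
      apply (is_lim_seq_incr_1 (fun n => / INR n)). replace (Finite 0) with (Rbar_inv p_infty) by reflexivity.
      apply is_lim_seq_inv; [apply is_lim_seq_INR | discriminate].
Qed.

(** At most exponential growth: closed under sums and products, satisfied by every cosh (nu u), and
    beaten by the double exponential weight e^(-x cosh u) for every x > 0. *)
Definition Eb (f : R -> R) := (forall u, continuous f u) /\
  exists A a, 0 <= A /\ forall u, 0 <= u -> Rabs (f u) <= A * exp (a * u).

Lemma is_derive_cosh u : is_derive cosh u (sinh u).
Proof. apply is_derive_Reals, derivable_pt_lim_cosh. Qed.
Lemma is_derive_sinh u : is_derive sinh u (cosh u).
Proof. apply is_derive_Reals, derivable_pt_lim_sinh. Qed.

Lemma cosh_half u : cosh u - 1 = 2 * sinh (u / 2) ^ 2.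
Proof.
  unfold cosh, sinh.
  replace (exp u) with (exp (u / 2) * exp (u / 2)) by (rewrite <- exp_plus; f_equal; field).
  replace (exp (- u)) with (exp (- (u / 2)) * exp (- (u / 2))) by (rewrite <- exp_plus; f_equal; field).
  assert (exp (u / 2) * exp (- (u / 2)) = 1) by (rewrite <- exp_plus, Rplus_opp_r; apply exp_0).
  nra.
Qed.

Lemma sinh_ge u : 0 <= u -> u <= sinh u.
Proof.
  intros Hu.
  assert (sinh 0 - 0 <= sinh u - u); [|rewrite sinh_0 in H; lra].
  assert (- (sinh u - u) <= - (sinh 0 - 0)); [|lra].
  apply (nonincreasing_of_derive (fun y => - (sinh y - y)) (fun y => - (cosh y - 1))); auto.
  - intros y _. apply (is_derive_opp (V := R_NormedModule)).
    apply (is_derive_minus (V := R_NormedModule));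
      [apply is_derive_sinh | apply (is_derive_id (K := R_AbsRing))].
  - intros y _. generalize (cosh_half y) (pow2_ge_0 (sinh (y / 2))); lra.
Qed.

Lemma cosh_ge u : 0 <= u -> 1 + u ^ 2 / 2 <= cosh u.
Proof. intros Hu. generalize (cosh_half u) (sinh_ge (u / 2)); intros. nra. Qed.

Lemma cosh_ge_1 u : 1 <= cosh u.
Proof. generalize (cosh_half u) (pow2_ge_0 (sinh (u / 2))); lra. Qed.

Lemma cosh_neg u : cosh (- u) = cosh u.
Proof. unfold cosh. rewrite Ropp_involutive. lra. Qed.

Lemma sinh_pos u : 0 <= u -> 0 <= sinh u.
Proof. intros Hu. generalize (sinh_ge u Hu); lra. Qed.

Lemma cosh_incr a b : 0 <= a <= b -> cosh a <= cosh b.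
Proof.
  intros H. generalize (cosh_half a) (cosh_half b).
  assert (sinh (a / 2) <= sinh (b / 2)).
  { unfold sinh. generalize (exp_le (a / 2) (b / 2)) (exp_le (- (b / 2)) (- (a / 2))); lra. }
  generalize (sinh_pos (a / 2)); intros. assert (0 <= a / 2) by lra. specialize (H1 H4). nra.
Qed.

Lemma cosh_le_exp nu u : 0 <= u -> cosh (nu * u) <= exp (Rabs nu * u).
Proof.
  intros Hu. unfold cosh.
  assert (exp (nu * u) <= exp (Rabs nu * u)) by (apply exp_le; generalize (Rle_abs nu); nra).
  assert (exp (- (nu * u)) <= exp (Rabs nu * u)).
  { apply exp_le. generalize (Rle_abs (- nu)). rewrite Rabs_Ropp. nra. }
  lra.
Qed.

Lemma cont_of_derive (f : R -> R) u d : is_derive f u d -> continuous f u.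
Proof. intros. apply (ex_derive_continuous (V := R_NormedModule)). now exists d. Qed.

Lemma is_derive_lin nu u : is_derive (fun y => nu * y) u nu.
Proof. auto_derive; auto; ring. Qed.

Lemma is_derive_cosh_lin nu u : is_derive (fun y => cosh (nu * y)) u (nu * sinh (nu * u)).
Proof. apply (is_derive_comp cosh (fun y => nu * y)); [apply is_derive_cosh | apply is_derive_lin]. Qed.
Lemma is_derive_sinh_lin nu u : is_derive (fun y => sinh (nu * y)) u (nu * cosh (nu * u)).
Proof. apply (is_derive_comp sinh (fun y => nu * y)); [apply is_derive_sinh | apply is_derive_lin]. Qed.

Lemma sinh_le_cosh u : Rabs (sinh u) <= cosh u.
Proof. unfold sinh, cosh. generalize (exp_pos u) (exp_pos (- u)); intros. apply Rabs_le; lra. Qed.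

Lemma Eb_cosh nu : Eb (fun u => cosh (nu * u)).
Proof.
  split; [intro u; eapply cont_of_derive, is_derive_cosh_lin|].
  exists 1, (Rabs nu). split; [lra|]. intros u Hu. rewrite Rmult_1_l, Rabs_pos_eq; [now apply cosh_le_exp|].
  generalize (cosh_ge_1 (nu * u)); lra.
Qed.

Lemma Eb_sinh nu : Eb (fun u => sinh (nu * u)).
Proof.
  split; [intro u; eapply cont_of_derive, is_derive_sinh_lin|].
  exists 1, (Rabs nu). split; [lra|]. intros u Hu. rewrite Rmult_1_l.
  eapply Rle_trans; [apply sinh_le_cosh | now apply cosh_le_exp].
Qed.

Lemma Eb_exp a : Eb (fun u => exp (a * u)).
Proof.
  split; [intro u; apply (ex_derive_continuous (V := R_NormedModule)); auto_derive; auto|].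
  exists 1, a. split; [lra|]. intros u Hu. rewrite Rmult_1_l, Rabs_pos_eq; [lra | apply Rlt_le, exp_pos].
Qed.

Lemma Eb_plus f g : Eb f -> Eb g -> Eb (fun u => f u + g u).
Proof.
  intros [F1 [A [a [A0 HA]]]] [G1 [B [b [B0 HB]]]]. split.
  - intro u. apply (continuous_plus (V := R_NormedModule)); auto.
  - exists (A + B), (Rmax a b). split; [lra|]. intros u Hu. eapply Rle_trans; [apply Rabs_triang|].
    rewrite Rmult_plus_distr_r. apply Rplus_le_compat.
    + eapply Rle_trans; [apply HA; auto|]. apply Rmult_le_compat_l; auto.
      apply exp_le, Rmult_le_compat_r; auto; apply Rmax_l.
    + eapply Rle_trans; [apply HB; auto|]. apply Rmult_le_compat_l; auto.
      apply exp_le, Rmult_le_compat_r; auto; apply Rmax_r.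
Qed.

Lemma Eb_mult f g : Eb f -> Eb g -> Eb (fun u => f u * g u).
Proof.
  intros [F1 [A [a [A0 HA]]]] [G1 [B [b [B0 HB]]]]. split.
  - intro u. apply (continuous_mult (K := R_AbsRing)); auto.
  - exists (A * B), (a + b). split; [nra|]. intros u Hu. rewrite Rabs_mult, Rmult_plus_distr_r, exp_plus.
    replace (A * B * (exp (a * u) * exp (b * u))) with ((A * exp (a * u)) * (B * exp (b * u))) by ring.
    apply Rmult_le_compat; auto using Rabs_pos.
Qed.

Lemma Eb_const c : Eb (fun _ => c).
Proof.
  split; [intro; apply continuous_const|]. exists (Rabs c), 0. split; [apply Rabs_pos|]. intros u _.
  rewrite Rmult_0_l, exp_0. lra.
Qed.

Lemma Eb_ext f g : (forall u, f u = g u) -> Eb f -> Eb g.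
Proof.
  intros E [F1 [A [a [A0 HA]]]]. split.
  - intro u. apply (continuous_ext f); auto.
  - exists A, a. split; auto. intros u Hu. rewrite <- E; auto.
Qed.

Lemma Idom_J x f : 0 < x -> Eb f -> Idom (fun u => exp (- x * cosh u) * f u).
Proof.
  intros Hx [F1 [A [a [A0 HA]]]]. split.
  - intro u. apply (continuous_mult (K := R_AbsRing)); auto.
    apply continuous_comp; [|apply (ex_derive_continuous (V := R_NormedModule)); auto_derive; auto].
    apply (continuous_scal_r (V := R_NormedModule)). eapply cont_of_derive, is_derive_cosh.
  (* As cosh u >= 1 + u^2/2, completing the square in (a + 1) u - x u^2/2 gives the maximum (a +
     1)^2 / (2 x). *)
  - exists (A * exp ((a + 1) ^ 2 / (2 * x))). split; [apply Rmult_le_pos; auto; apply Rlt_le, exp_pos|].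
    intros u Hu. rewrite Rabs_mult, (Rabs_pos_eq (exp _)) by (apply Rlt_le, exp_pos).
    apply Rle_trans with (exp (- x * cosh u) * (A * exp (a * u))).
    { apply Rmult_le_compat_l; auto. apply Rlt_le, exp_pos. }
    replace (exp (- x * cosh u) * (A * exp (a * u))) with (A * (exp (- x * cosh u) * exp (a * u))) by ring.
    rewrite Rmult_assoc. apply Rmult_le_compat_l; auto. rewrite <- !exp_plus. apply exp_le.
    generalize (cosh_ge u Hu); intros.
    assert ((a + 1) ^ 2 / (2 * x) - (a + 1) * u + x * u ^ 2 / 2 = (x * u - (a + 1)) ^ 2 / (2 * x)) by (field;
      lra).
    assert (0 <= (x * u - (a + 1)) ^ 2 / (2 * x)).
    { apply Rmult_le_pos; [apply pow2_ge_0 | apply Rlt_le, Rinv_0_lt_compat; lra]. }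
    assert (x * (1 + u ^ 2 / 2) <= x * cosh u) by (apply Rmult_le_compat_l; lra). nra.
Qed.

Definition J (x : R) (f : R -> R) : R := Int (fun u => exp (- x * cosh u) * f u).

Lemma J_ext x f g : (forall u, f u = g u) -> J x f = J x g.
Proof. intros E. apply Int_ext. intro u. rewrite E. reflexivity. Qed.

Lemma J_plus x f g : 0 < x -> Eb f -> Eb g -> J x (fun u => f u + g u) = J x f + J x g.
Proof.
  intros Hx Hf Hg. unfold J. rewrite <- Int_plus by (apply Idom_J; auto). apply Int_ext. intro u; ring.
Qed.

Lemma J_scal x a f : 0 < x -> Eb f -> J x (fun u => a * f u) = a * J x f.
Proof.
  intros Hx Hf. unfold J. rewrite <- Int_scal by (apply Idom_J; auto). apply Int_ext. intro u; ring.
Qed.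

Lemma J_le x f g : 0 < x -> Eb f -> Eb g -> (forall u, 0 <= u -> f u <= g u) -> J x f <= J x g.
Proof.
  intros Hx Hf Hg H. apply Int_le; [apply Idom_J; auto | apply Idom_J; auto |].
  intros u Hu. apply Rmult_le_compat_l; auto. apply Rlt_le, exp_pos.
Qed.

Lemma J_0 x : J x (fun _ => 0) = 0.
Proof.
  apply Int_unique. apply is_lim_seq_ext with (fun _ => 0); [|apply is_lim_seq_const].
  intro n. rewrite (RInt_ext _ (fun _ => 0)) by (intros; apply Rmult_0_r). rewrite RInt_const.
  symmetry; apply Rmult_0_r.
Qed.

Lemma J_pos x f : 0 < x -> Eb f -> (forall u, 0 <= u -> 0 <= f u) -> 0 <= J x f.
Proof. intros. rewrite <- (J_0 x). apply J_le; auto using Eb_const. Qed.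

Lemma J_abs x f g : 0 < x -> Eb f -> Eb g -> (forall u, 0 <= u -> Rabs (f u) <= g u) -> Rabs (J x f) <= J x g.
Proof.
  intros Hx Hf Hg H. apply Rabs_le. split.
  - assert (J x (fun u => (-1) * g u) <= J x f).
    { apply J_le; auto; [apply Eb_mult; auto using Eb_const|]. intros u Hu.
      generalize (H u Hu) (Rle_abs (- f u)). rewrite Rabs_Ropp. lra. }
    rewrite J_scal in H0; auto. lra.
  - apply J_le; auto. intros u Hu. generalize (H u Hu) (Rle_abs (f u)). lra.
Qed.

(** * The integral k_nu(x): recurrence, derivative, decay and dependence on the order *)

Definition kt (nu x : R) : R := J x (fun u => cosh (nu * u)).

Lemma kt_neg nu x : kt (- nu) x = kt nu x.
Proof. apply J_ext. intro u. rewrite <- cosh_neg. f_equal. ring. Qed.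

Lemma kt_pos nu x : 0 < x -> 0 <= kt nu x.
Proof. intros. apply J_pos; auto using Eb_cosh. intros. generalize (cosh_ge_1 (nu * u)); lra. Qed.

Lemma cosh_prod a u : cosh u * cosh (a * u) = / 2 * (cosh ((a + 1) * u) + cosh ((a - 1) * u)).
Proof.
  unfold cosh. replace ((a + 1) * u) with (a * u + u) by ring. replace ((a - 1) * u) with (a * u + - u) by ring.
  rewrite !Ropp_plus_distr, !exp_plus, Ropp_involutive. field.
Qed.

Lemma sinh_prod a u : sinh u * sinh (a * u) = / 2 * (cosh ((a + 1) * u) - cosh ((a - 1) * u)).
Proof.
  unfold cosh, sinh. replace ((a + 1) * u) with (a * u + u) by ring.
  replace ((a - 1) * u) with (a * u + - u) by ring.
  rewrite !Ropp_plus_distr, !exp_plus, Ropp_involutive. field.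
Qed.

(** The derivative of e^(-x cosh u) F(u) is e^(-x cosh u) (F' - x sinh u F), so only the boundary
    term at 0 remains. With F = sinh (nu u) this yields the recurrence in the order, with F = -1/x
    the integral of sinh. *)
Lemma J_FTC x (F f : R -> R) : 0 < x -> Eb F -> Eb f ->
  (forall u, is_derive F u (f u + x * sinh u * F u)) -> J x f = - (exp (- x) * F 0).
Proof.
  intros Hx HF Hf HD. unfold J.
  replace (exp (- x)) with (exp (- x * cosh 0)) by (f_equal; rewrite cosh_0; ring).
  destruct (Idom_J x F Hx HF) as [_ [M [_ HM]]].
  apply (Int_FTC (fun u => exp (- x * cosh u) * F u)).
  - intro u. eapply is_derive_eq.
    + apply is_derive_Rmult; [|apply HD]. apply (is_derive_comp exp (fun y => - x * cosh y));
        [apply is_derive_exp|].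
      apply is_derive_scal, is_derive_cosh.
    + unfold scal; simpl; unfold mult; simpl. ring.
  - apply (Idom_J x f Hx Hf).
  - now exists M.
Qed.

Lemma kt_rec nu x : 0 < x -> kt (nu + 1) x - kt (nu - 1) x = 2 * nu / x * kt nu x.
Proof.
  intros Hx.
  assert (E1 : Eb (fun u => nu * cosh (nu * u))) by exact (Eb_mult _ _ (Eb_const nu) (Eb_cosh nu)).
  assert (E2 : Eb (fun u => -1 * cosh ((nu - 1) * u))) by exact (Eb_mult _ _ (Eb_const (-1)) (Eb_cosh (nu -
    1))).
  assert (E3 : Eb (fun u => cosh ((nu + 1) * u) + -1 * cosh ((nu - 1) * u))) by exact (Eb_plus _ _ (Eb_cosh (nu
    + 1)) E2).
  assert (E4 : Eb (fun u => - x / 2 * (cosh ((nu + 1) * u) + -1 * cosh ((nu - 1) * u)))) by exact (Eb_mult _ _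
    (Eb_const (- x / 2)) E3).
  assert (E : J x (fun u => nu * cosh (nu * u) + - x / 2 * (cosh ((nu + 1) * u) + -1 * cosh ((nu - 1) * u))) =
    0).
  { rewrite (J_FTC x (fun u => sinh (nu * u)) _ Hx (Eb_sinh nu) (Eb_plus _ _ E1 E4)).
    - rewrite Rmult_0_r, sinh_0. ring.
    - intro u. eapply is_derive_eq; [apply is_derive_sinh_lin|].
      generalize (sinh_prod nu u). nra. }
  rewrite (J_plus x _ _ Hx E1 E4), (J_scal x nu _ Hx (Eb_cosh nu)), (J_scal x (- x / 2) _ Hx E3),
    (J_plus x _ _ Hx (Eb_cosh (nu + 1)) E2), (J_scal x (-1) _ Hx (Eb_cosh (nu - 1))) in E.
  fold (kt nu x) (kt (nu + 1) x) (kt (nu - 1) x) in E.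
  apply Rmult_eq_reg_l with (x / 2); [|lra]. field_simplify; [|lra]. lra.
Qed.

Lemma exp_rest2 y : Rabs (exp y - 1 - y) <= y ^ 2 * exp (Rabs y).
Proof.
  generalize (cexp_rest2 (RtoC y)). rewrite cexp_R, <- !RtoC_minus, !Cmod_R, pow2_abs. auto.
Qed.

(** The second order remainder of e^(-(y - x) c), c = cosh u, is integrated. For |y - x| < x/2 its
    growth e^(|y - x| c) uses up at most half of the weight e^(-x c), whence the integral [D] at
    x/2. *)
Lemma kt_derive nu x : 0 < x -> is_derive (fun y => kt nu y) x (- / 2 * (kt (nu + 1) x + kt (nu - 1) x)).
Proof.
  intros Hx.
  assert (E : J x (fun u => cosh u * cosh (nu * u)) = / 2 * (kt (nu + 1) x + kt (nu - 1) x)).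
  { rewrite (J_ext _ _ _ (cosh_prod nu)), J_scal, J_plus; auto using Eb_plus, Eb_cosh. }
  assert (Ec : Eb cosh) by (apply (Eb_ext (fun u => cosh (1 * u))); [intro; f_equal; ring | apply Eb_cosh]).
  set (D := J (x / 2) (fun u => (cosh u * cosh u) * cosh (nu * u))).
  apply (is_derive_squeeze _ (fun y => kt nu x + (y - x) * (- / 2 * (kt (nu + 1) x + kt (nu - 1) x))) (fun y =>
    D * (y - x) ^ 2)).
  - auto_derive; auto; ring.
  - ring.
  - auto_derive; auto; ring.
  - ring.
  - assert (Hx2 : 0 < x / 2) by lra. exists (mkposreal _ Hx2). intros y Hy.
    assert (Hy' : Rabs (y - x) < x / 2) by exact Hy. clear Hy.
    assert (y0 : 0 < y) by (apply Rabs_def2 in Hy'; lra).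
    rewrite <- Ropp_mult_distr_l, <- E.
    assert (I0 : Idom (fun u => exp (- x * cosh u) * cosh (nu * u))) by (apply Idom_J; auto using Eb_cosh).
    assert (I1 : Idom (fun u => exp (- x * cosh u) * (cosh u * cosh (nu * u)))) by (apply Idom_J;
      auto using Eb_cosh, Eb_mult).
    assert (I2 : Idom (fun u => exp (- y * cosh u) * cosh (nu * u))) by (apply Idom_J; auto using Eb_cosh).
    assert (I3 : Idom (fun u => exp (- (x / 2) * cosh u) * ((cosh u * cosh u) * cosh (nu * u)))) by (apply
      Idom_J; auto using Eb_cosh, Eb_mult).
    assert (P : forall u, Rabs (exp (- y * cosh u) * cosh (nu * u) + (-1) * (exp (- x * cosh u) * cosh (nu *
      u)) + (y - x) * (exp (- x * cosh u) * (cosh u * cosh (nu * u))))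
       <= (y - x) ^ 2 * (exp (- (x / 2) * cosh u) * ((cosh u * cosh u) * cosh (nu * u)))).
    { intro u. set (c := cosh u). set (d := cosh (nu * u)).
      assert (c1 : 1 <= c) by apply cosh_ge_1. assert (d1 : 1 <= d) by apply cosh_ge_1.
      replace (exp (- y * c) * d + -1 * (exp (- x * c) * d) + (y - x) * (exp (- x * c) * (c * d))) with
        (exp (- x * c) * d * (exp (- (y - x) * c) - 1 - (- (y - x) * c))).
      2: { replace (exp (- y * c)) with (exp (- x * c) * exp (- (y - x) * c)) by (rewrite <- exp_plus; f_equal;
             ring). ring. }
      rewrite Rabs_mult, (Rabs_pos_eq (exp (- x * c) * d)).
      2: { apply Rmult_le_pos; [apply Rlt_le, exp_pos | lra]. }
      replace ((y - x) ^ 2 * (exp (- (x / 2) * c) * (c * c * d))) with (d * ((- (y - x) * c) ^ 2 * exp (- (x /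
        2) * c))) by ring.
      rewrite (Rmult_comm _ d), Rmult_assoc. apply Rmult_le_compat_l; [lra|].
      apply Rle_trans with (exp (- x * c) * ((- (y - x) * c) ^ 2 * exp (Rabs (- (y - x) * c)))).
      - apply Rmult_le_compat_l; [apply Rlt_le, exp_pos | apply exp_rest2].
      - replace (exp (- x * c) * ((- (y - x) * c) ^ 2 * exp (Rabs (- (y - x) * c)))) with
         ((- (y - x) * c) ^ 2 * (exp (- x * c) * exp (Rabs (- (y - x) * c)))) by ring.
        apply Rmult_le_compat_l; [apply pow2_ge_0|]. rewrite <- exp_plus. apply exp_le.
        rewrite Rabs_mult, Rabs_Ropp, (Rabs_pos_eq c) by lra. nra. }
    replace (kt nu y - (kt nu x + (y - x) * - J x (fun u => cosh u * cosh (nu * u)))) with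
      (Int (fun u => exp (- y * cosh u) * cosh (nu * u) + (-1) * (exp (- x * cosh u) * cosh (nu * u)) + (y - x)
        * (exp (- x * cosh u) * (cosh u * cosh (nu * u))))).
    2: { rewrite !Int_plus, !Int_scal; auto using Idom_plus, Idom_scal. unfold kt, J. ring. }
    assert (I4 : Idom (fun u => exp (- y * cosh u) * cosh (nu * u) + (-1) * (exp (- x * cosh u) * cosh (nu *
      u)) + (y - x) * (exp (- x * cosh u) * (cosh u * cosh (nu * u)))))
      by auto using Idom_plus, Idom_scal.
    unfold D, J. rewrite Rmult_comm, <- Int_scal by auto.
    apply Rabs_le. split.
    + replace (- Int (fun u => (y - x) ^ 2 * (exp (- (x / 2) * cosh u) * (cosh u * cosh u * cosh (nu * u)))))
        with
       (Int (fun u => (-1) * ((y - x) ^ 2 * (exp (- (x / 2) * cosh u) * (cosh u * cosh u * cosh (nu * u))))))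
         by (rewrite Int_scal; auto using Idom_scal; ring).
      apply Int_le; auto using Idom_scal. intros u _. generalize (P u). intros Q. apply Rabs_le_between in Q.
      lra.
    + apply Int_le; auto using Idom_scal. intros u _. generalize (P u). intros Q. apply Rabs_le_between in Q.
      lra.
Qed.

Lemma kt_decay nu x y : 0 < x -> x <= y -> kt nu y <= exp (- (y - x)) * kt nu x.
Proof.
  intros Hx Hy. unfold kt, J. rewrite <- Int_scal by (apply Idom_J; auto using Eb_cosh).
  apply Int_le; [apply Idom_J; auto using Eb_cosh; lra | apply Idom_scal, Idom_J; auto using Eb_cosh |].
  intros u _. rewrite <- Rmult_assoc. apply Rmult_le_compat_r; [generalize (cosh_ge_1 (nu * u)); lra|].
  rewrite <- exp_plus. apply exp_le. generalize (cosh_ge_1 u); nra.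
Qed.

Lemma sinh_le_mul u : 0 <= u -> sinh u <= u * cosh u.
Proof.
  intros Hu.
  assert (sinh u - u * cosh u <= sinh 0 - 0 * cosh 0); [|rewrite sinh_0 in H; lra].
  apply (nonincreasing_of_derive (fun y => sinh y - y * cosh y) (fun y => - (y * sinh y))); auto.
  - intros y _. eapply is_derive_eq.
    + apply (is_derive_minus (V := R_NormedModule)); [apply is_derive_sinh|].
      apply is_derive_Rmult; [apply (is_derive_id (K := R_AbsRing)) | apply is_derive_cosh].
    + unfold minus, plus, opp, one; simpl. ring.
  - intros y Hy. generalize (sinh_pos y); nra.
Qed.

(** The mean value theorem in the order; sinh v <= v cosh v supplies the second factor u. *)
Lemma cosh_diff mu nu M u : 0 <= u -> Rabs mu <= M -> Rabs nu <= M ->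
  Rabs (cosh (mu * u) - cosh (nu * u)) <= Rabs (mu - nu) * (M * (u ^ 2 * cosh (M * u))).
Proof.
  intros Hu H1 H2.
  destruct (MVT_gen (fun s => cosh (u * s)) nu mu (fun s => u * sinh (u * s))) as [c [Hc E]].
  - intros; apply is_derive_cosh_lin.
  - intros s _. apply derivable_continuous_pt. eexists. apply is_derive_Reals, is_derive_cosh_lin.
  - rewrite (Rmult_comm mu), (Rmult_comm nu), E, Rabs_mult, Rmult_comm.
    apply Rmult_le_compat_l; [apply Rabs_pos|].
    assert (Hc' : Rabs c <= M).
    { apply Rabs_le_between in H1. apply Rabs_le_between in H2. apply Rabs_le.
      unfold Rmin, Rmax in Hc; destruct (Rle_dec nu mu); lra. }
    rewrite Rabs_mult, (Rabs_pos_eq u) by auto.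
    assert (M0 : 0 <= M) by (generalize (Rabs_pos c); lra).
    assert (A : Rabs (sinh (u * c)) <= u * Rabs c * cosh (u * Rabs c)).
    { replace (Rabs (sinh (u * c))) with (sinh (u * Rabs c)).
      - apply sinh_le_mul. generalize (Rabs_pos c); nra.
      - unfold Rabs at 1; destruct (Rcase_abs c).
        + replace (u * - c) with (- (u * c)) by ring.
          replace (sinh (- (u * c))) with (- sinh (u * c)) by (unfold sinh; rewrite Ropp_involutive; field).
          assert (0 <= sinh (- (u * c))) by (apply sinh_pos; nra).
          assert (sinh (- (u * c)) = - sinh (u * c)) by (unfold sinh; rewrite Ropp_involutive; field).
          rewrite Rabs_left1; lra.
        + rewrite Rabs_pos_eq; auto. apply sinh_pos; nra. }
    assert (B : cosh (u * Rabs c) <= cosh (M * u)).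
    { apply cosh_incr. generalize (Rabs_pos c); nra. }
    assert (1 <= cosh (u * Rabs c)) by apply cosh_ge_1.
    assert (u * Rabs c * cosh (u * Rabs c) <= u * M * cosh (M * u)).
    { apply Rmult_le_compat; generalize (Rabs_pos c); try nra. }
    replace (M * (u ^ 2 * cosh (M * u))) with (u * (u * M * cosh (M * u))) by ring.
    apply Rmult_le_compat_l; auto. lra.
Qed.

(** The factor u^2 from [cosh_diff] is absorbed by u^2 <= (4/x) e^((x/2)(cosh u - 1)), at the cost
    of half of the weight; what is left is e^(-x/2) times the weight e^(-(x/2) cosh u) of
    k_M(x/2). *)
Lemma kt_diff mu nu M x : 0 < x -> Rabs mu <= M -> Rabs nu <= M ->
  Rabs (kt mu x - kt nu x) <= Rabs (mu - nu) * (M * (4 / x) * (exp (- (x / 2)) * kt M (x / 2))).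
Proof.
  intros Hx H1 H2.
  assert (M0 : 0 <= M) by (generalize (Rabs_pos mu); lra).
  assert (Ex : Eb (fun u => u ^ 2 * cosh (M * u))).
  { apply Eb_mult; [|apply Eb_cosh]. split.
    - intro u. apply (ex_derive_continuous (V := R_NormedModule)). auto_derive; auto.
    - exists 4, 1. split; [lra|]. intros u Hu. rewrite Rabs_pos_eq by apply pow2_ge_0.
      replace (1 * u) with (u / 2 + u / 2) by field. rewrite exp_plus.
      generalize (exp_ineq1_le (u / 2)); intros. nra. }
  replace (kt mu x - kt nu x) with (J x (fun u => cosh (mu * u) + (-1) * cosh (nu * u))).
  2: { rewrite J_plus, J_scal; auto using Eb_cosh, Eb_mult, Eb_const. unfold kt; ring. }
  apply Rle_trans with (J x (fun u => Rabs (mu - nu) * (M * (u ^ 2 * cosh (M * u))))).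
  - apply J_abs; auto using Eb_cosh, Eb_mult, Eb_const, Eb_plus.
    intros u Hu. replace (cosh (mu * u) + -1 * cosh (nu * u)) with (cosh (mu * u) - cosh (nu * u)) by ring.
    now apply cosh_diff.
  - rewrite !J_scal; auto using Eb_mult, Eb_const. apply Rmult_le_compat_l; [apply Rabs_pos|].
    rewrite Rmult_assoc. apply Rmult_le_compat_l; auto.
    unfold kt, J. rewrite <- Rmult_assoc, <- Int_scal by (apply Idom_J; auto using Eb_cosh; lra).
    apply Int_le; [apply Idom_J; auto | apply Idom_scal, Idom_J; auto using Eb_cosh; lra |].
    intros u Hu. rewrite <- !Rmult_assoc. apply Rmult_le_compat_r; [generalize (cosh_ge_1 (M * u)); lra|].
    assert (Y := exp_ineq1_le (x / 2 * (cosh u - 1))). assert (Z := cosh_ge u Hu).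
    assert (u ^ 2 <= 4 / x * exp (x / 2 * (cosh u - 1))).
    { apply Rmult_le_reg_l with (x / 4); [lra|].
      replace (x / 4 * (4 / x * exp (x / 2 * (cosh u - 1)))) with (exp (x / 2 * (cosh u - 1))) by (field; lra).
      nra. }
    apply Rle_trans with (exp (- x * cosh u) * (4 / x * exp (x / 2 * (cosh u - 1)))).
    + apply Rmult_le_compat_l; auto. apply Rlt_le, exp_pos.
    + right. replace (exp (- x * cosh u)) with (exp (- (x / 2)) * exp (- (x / 2) * cosh u) * exp (- (x / 2 *
        (cosh u - 1)))).
      * rewrite (exp_Ropp (x / 2 * (cosh u - 1))). field. split; [lra | apply Rgt_not_eq, exp_pos].
      * rewrite <- !exp_plus. f_equal. field.
Qed.

(** Split cosh u = sinh u + e^(-u): the first part integrates exactly to e^(-x)/x, the second to at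
    most 1. This gives the value [ak_1] at order 1, which normalizes the Bohr-Mollerup argument. *)
Lemma kt_1_small x : 0 < x -> Rabs (x * kt 1 x - exp (- x)) <= x.
Proof.
  intros Hx.
  assert (Es : J x (fun u => sinh (1 * u)) = exp (- x) / x).
  { rewrite (J_FTC x (fun u => - / x)); auto using Eb_const, Eb_sinh.
    - field; lra.
    - intro u. eapply is_derive_eq; [apply (is_derive_const (V := R_NormedModule))|]. unfold zero; simpl.
      rewrite Rmult_1_l. field; lra. }
  assert (E : kt 1 x = exp (- x) / x + J x (fun u => exp (-1 * u))).
  { rewrite <- Es, <- J_plus; auto using Eb_exp, Eb_sinh. apply J_ext. intro u. unfold cosh, sinh.
    rewrite Rmult_1_l. replace (-1 * u) with (- u) by ring. field. }
  assert (B : 0 <= J x (fun u => exp (-1 * u)) <= 1).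
  { split; [apply J_pos; auto using Eb_exp; intros; apply Rlt_le, exp_pos|].
    assert (I : Idom (fun u => exp (- u))).
    { split; [intro u; apply (ex_derive_continuous (V := R_NormedModule)); auto_derive; auto|].
      exists 1. split; [lra|]. intros u _. rewrite Rabs_pos_eq; [lra | apply Rlt_le, exp_pos]. }
    replace 1 with (Int (fun u => exp (- u))).
    - apply Int_le; auto; [apply Idom_J; auto using Eb_exp|]. intros u _.
      replace (-1 * u) with (- u) by ring. rewrite <- (Rmult_1_l (exp (- u))) at 2.
      apply Rmult_le_compat_r; [apply Rlt_le, exp_pos|].
      rewrite <- exp_0. apply exp_le. generalize (cosh_ge_1 u); nra.
    - rewrite (Int_FTC (fun u => - exp (- u))).
      + rewrite Ropp_0, exp_0. ring.
      + intro u. auto_derive; auto; ring.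
      + apply I.
      + exists 1. intros u _. rewrite Rabs_Ropp, Rabs_pos_eq; [lra | apply Rlt_le, exp_pos]. }
  rewrite E. replace (x * (exp (- x) / x + J x (fun u => exp (-1 * u))) - exp (- x)) with (x * J x (fun u =>
    exp (-1 * u))) by (field; lra).
  rewrite Rabs_pos_eq; nra.
Qed.

Lemma kt_0_le_1 x : 0 < x -> kt 0 x <= kt 1 x.
Proof.
  intros. apply J_le; auto using Eb_cosh. intros u Hu. rewrite Rmult_0_l, cosh_0. apply cosh_ge_1.
Qed.

Lemma exp_interp s l : 0 <= s <= 1 -> exp (s * l) <= (1 - s) + s * exp l.
Proof.
  intros Hs.
  assert (E1 : exp l = exp (s * l) * exp ((1 - s) * l)) by (rewrite <- exp_plus; f_equal; ring).
  assert (E2 : 1 = exp (s * l) * exp (- (s * l))) by (rewrite <- exp_plus, Rplus_opp_r, exp_0; auto).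
  generalize (exp_ineq1_le ((1 - s) * l)) (exp_ineq1_le (- (s * l))) (exp_pos (s * l)); intros.
  assert (exp (s * l) * (1 + (1 - s) * l) <= exp l) by (rewrite E1; apply Rmult_le_compat_l; lra).
  assert (exp (s * l) * (1 + - (s * l)) <= 1) by (rewrite E2; apply Rmult_le_compat_l; lra).
  assert (s * (exp (s * l) * (1 + (1 - s) * l)) <= s * exp l) by (apply Rmult_le_compat_l; lra).
  assert ((1 - s) * (exp (s * l) * (1 + - (s * l))) <= (1 - s) * 1) by (apply Rmult_le_compat_l; lra).
  nra.
Qed.

(** Convexity in the order, applied to the integrand. The free shift [l] of the exponent makes the
    linear interpolation of [exp_interp] as strong as logarithmic convexity; [ak_interp] chooses
    it. *)
Lemma kt_interp n s l x : 0 < x -> 0 <= s <= 1 ->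
  exp (- (s * l)) * kt (n + s) x <= (1 - s) * kt n x + s * exp (- l) * kt (n + 1) x.
Proof.
  intros Hx Hs. unfold kt.
  rewrite <- !J_scal, <- J_plus; auto using Eb_cosh, Eb_mult, Eb_const.
  apply J_le; auto using Eb_cosh, Eb_mult, Eb_const, Eb_plus.
  intros u _. unfold cosh.
  replace (exp (- (s * l)) * ((exp ((n + s) * u) + exp (- ((n + s) * u))) / 2)) with
   ((exp (n * u) * exp (s * (u - l)) + exp (- (n * u)) * exp (s * (- u - l))) / 2).
  2: { rewrite <- !exp_plus. unfold Rdiv. rewrite <- Rmult_assoc, Rmult_plus_distr_l, <- !exp_plus.
       do 2 f_equal; f_equal; ring. }
  assert (A := exp_interp s (u - l) Hs). assert (B := exp_interp s (- u - l) Hs).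
  replace (exp (u - l)) with (exp u * exp (- l)) in A by (rewrite <- exp_plus; f_equal; ring).
  replace (exp (- u - l)) with (exp (- u) * exp (- l)) in B by (rewrite <- exp_plus; f_equal; ring).
  replace (exp ((n + 1) * u)) with (exp (n * u) * exp u) by (rewrite <- exp_plus; f_equal; ring).
  replace (exp (- ((n + 1) * u))) with (exp (- (n * u)) * exp (- u)) by (rewrite <- exp_plus; f_equal; ring).
  assert (P1 := exp_pos (n * u)). assert (P2 := exp_pos (- (n * u))).
  apply (Rmult_le_compat_l (exp (n * u))) in A; [|lra].
  apply (Rmult_le_compat_l (exp (- (n * u)))) in B; [|lra]. lra.
Qed.

(** * The sine product and Gauss's limit *)

(** These integrals satisfy a two-step recurrence; dividing the one for a = 2 nu by the one for a =
    0 produces the factors of Euler's product for the sine. *)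
Definition cosint (a : R) (n : nat) : R := RInt (fun t => cos (a * t) * cos t ^ n) 0 (PI / 2).

Lemma cont_cosint a n t : continuous (fun t => cos (a * t) * cos t ^ n) t.
Proof. apply (ex_derive_continuous (V := R_NormedModule)). auto_derive; auto. Qed.

Lemma RInt_FTC (F f : R -> R) a b : (forall t, is_derive F t (f t)) -> (forall t, continuous f t) ->
  @eq R (RInt f a b) (F b - F a).
Proof.
  intros HF Hc. apply is_RInt_unique. apply (is_RInt_derive (V := R_CompleteNormedModule) F f); auto.
Qed.

Lemma cosint_rec a m :
  (2 * INR m + 2) * (2 * INR m + 1) * cosint a (2 * m) = ((2 * INR m + 2) ^ 2 - a ^ 2) * cosint a (2 * m + 2).
Proof.
  set (N := 2 * INR m + 2).
  (* F is the Wronskian of cos (a t) and cos^N t, N = 2m + 2; it vanishes at both ends. *)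
  set (F := fun t => - N * cos t ^ (2 * m + 1) * sin t * cos (a * t) + a * cos t ^ (2 * m + 2) * sin (a * t)).
  assert (E : RInt (fun t => N * (N - 1) * (cos (a * t) * cos t ^ (2 * m)) + (- (N ^ 2 - a ^ 2)) * (cos (a * t)
    * cos t ^ (2 * m + 2))) 0 (PI / 2) = 0 :> R).
  { rewrite (RInt_FTC F).
    - unfold F. replace (a * 0) with 0 by ring. rewrite cos_PI2, sin_0, !pow_i by lia. ring.
    - intro t. unfold F.
      replace (2 * m + 1)%nat with (S (2 * m)) by lia. replace (2 * m + 2)%nat with (S (S (2 * m))) by lia.
      auto_derive; auto.
      change (match (m + (m + 0))%nat with 0%nat => 1 | S _ => INR (m + (m + 0)) + 1 end) with (INR (S (2 *
        m))).
      change (m + (m + 0))%nat with (2 * m)%nat. unfold N. rewrite !S_INR, mult_INR. simpl (INR 2).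
      assert (S2 : sin t * sin t = 1 - cos t * cos t) by (generalize (sin2_cos2 t); unfold Rsqr; lra).
      replace (cos t ^ S (2 * m)) with (cos t * cos t ^ (2 * m)) by reflexivity.
      replace (cos t ^ S (S (2 * m))) with (cos t * cos t * cos t ^ (2 * m)) by (simpl; ring).
      set (P := cos t ^ (2 * m)).
      transitivity ((2 * INR m + 2) * (2 * INR m + 1) * P * (sin t * sin t) * cos (a * t) - (2 * INR m + 2) *
        (cos t * P) * cos t * cos (a * t) + a * a * (cos t * cos t * P) * cos (a * t)); [unfold P; simpl;
          ring|].
      rewrite S2. ring.
    - intro t. apply (continuous_plus (V := R_NormedModule));
        apply (continuous_scal_r (V := R_NormedModule)), cont_cosint. }
  rewrite (RInt_plus (V := R_CompleteNormedModule)) in E.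
  2, 3: apply ex_RInt_cont; intro t; apply (continuous_scal_r (V := R_NormedModule)), cont_cosint.
  rewrite !(RInt_scal (V := R_CompleteNormedModule)) in E by (apply ex_RInt_cont; intro t; apply cont_cosint).
  unfold plus, scal in E; simpl in E; unfold mult in E; simpl in E.
  fold (cosint a (2 * m)) in E. fold (cosint a (2 * m + 2)) in E.
  change (N * (N - 1) * cosint a (2 * m) + - (N ^ 2 - a ^ 2) * cosint a (2 * m + 2) = 0) in E.
  unfold N in *. lra.
Qed.

Lemma cosint_0_pos m : 0 < cosint 0 (2 * m).
Proof.
  induction m as [|m IH].
  - unfold cosint. rewrite (RInt_ext _ (fun _ => 1)).
    + rewrite RInt_const. unfold scal; simpl; unfold mult; simpl. generalize PI_RGT_0; lra.
    + intros t _. change (cos (0 * t) * 1 = 1). rewrite Rmult_0_l, cos_0. ring.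
  - generalize (cosint_rec 0 m). replace (2 * S m)%nat with (2 * m + 2)%nat by lia. intros E.
    generalize (pos_INR m); intros. apply Rmult_lt_reg_l with ((2 * INR m + 2) ^ 2 - 0 ^ 2); [nra|].
    rewrite Rmult_0_r, <- E. apply Rmult_lt_0_compat; nra.
Qed.

Lemma cos_ge_quad y : 1 - y ^ 2 / 2 <= cos y.
Proof.
  replace (cos y) with (cos (2 * (y / 2))) by (f_equal; field). rewrite cos_2a_sin.
  assert (H : sin (y / 2) * sin (y / 2) <= (y / 2) * (y / 2)).
  { assert (G : forall z, 0 <= z -> Rabs (sin z) <= z).
    { intros z Hz. generalize (MVT_gen sin 0 z cos). intros M. destruct M as [c [_ E]].
      - intros; apply is_derive_sin.
      - intros; apply continuity_sin.
      - rewrite sin_0, !Rminus_0_r in E. rewrite E, Rabs_mult, (Rabs_pos_eq z) by auto.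
        assert (Rabs (cos c) <= 1) by (apply Rabs_le, COS_bound). nra. }
    assert (Rabs (sin (y / 2)) <= Rabs (y / 2)).
    { unfold Rabs at 2; destruct (Rcase_abs (y / 2)).
      - rewrite <- Rabs_Ropp, <- sin_neg. apply G; lra.
      - apply G; lra. }
    apply Rsqr_le_abs_1 in H. exact H. }
  nra.
Qed.

Lemma tcos_le_sin t : 0 <= t <= PI / 2 -> t * cos t <= sin t.
Proof.
  intros Ht.
  assert (t * cos t - sin t <= 0 * cos 0 - sin 0); [|rewrite sin_0 in H; lra].
  apply (nonincreasing_of_derive (fun t => t * cos t - sin t) (fun t => - (t * sin t))); [lra | |].
  - intros x _. auto_derive; auto; ring.
  - intros x Hx. assert (0 <= sin x) by (apply sin_ge_0; generalize PI_RGT_0; lra). nra.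
Qed.

(** For the lower bound, 1 - cos (a t) <= a^2 t^2 / 2 and t cos t <= sin t: what remains is the
    integral of t sin t cos^(2m-1) t, which by parts equals [cosint 0 (2 * m)] / (2m). *)
Lemma cosint_bounds a m : (0 < m)%nat ->
  (1 - a ^ 2 / 2 / (2 * INR m)) * cosint 0 (2 * m) <= cosint a (2 * m) <= cosint 0 (2 * m).
Proof.
  intros Hm.
  assert (cc : forall t, 0 < t < PI / 2 -> 0 <= cos t) by (intros; apply cos_ge_0; lra).
  assert (P2 : 0 <= PI / 2) by (generalize PI_RGT_0; lra).
  assert (m0 : 0 < INR m) by (apply lt_0_INR; auto).
  set (G := fun t => t * sin t * cos t ^ (2 * m - 1)).
  assert (cG : forall t, continuous G t) by (intro t; apply (ex_derive_continuous (V := R_NormedModule));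
    unfold G; auto_derive; auto).
  assert (EG : RInt G 0 (PI / 2) = / (2 * INR m) * cosint 0 (2 * m) :> R).
  { assert (E : RInt (fun t => G t + (- / (2 * INR m)) * (cos (0 * t) * cos t ^ (2 * m))) 0 (PI / 2) = 0 :> R).
    { rewrite (RInt_FTC (fun t => - (t * cos t ^ (2 * m)) * / (2 * INR m))).
      - rewrite cos_PI2, pow_i by lia. ring.
      - intro t. unfold G. auto_derive; auto. rewrite Rmult_0_l, cos_0.
        replace (2 * m - 1)%nat with (pred (2 * m)) by lia.
        replace (m + (m + 0))%nat with (2 * m)%nat by lia.
        rewrite mult_INR. simpl (INR 2).
        replace (cos t ^ (2 * m)) with (cos t * cos t ^ pred (2 * m)) by (destruct m; [lia|]; reflexivity).
        field. lra.
      - intro t. apply (continuous_plus (V := R_NormedModule)); auto.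
        apply (continuous_scal_r (V := R_NormedModule)), cont_cosint. }
    rewrite (RInt_plus (V := R_CompleteNormedModule)), (RInt_scal (V := R_CompleteNormedModule)) in E.
    2: apply ex_RInt_cont; intro t; apply cont_cosint.
    2: apply ex_RInt_cont; auto.
    2: apply ex_RInt_cont; intro t; apply (continuous_scal_r (V := R_NormedModule)), cont_cosint.
    change (RInt G 0 (PI / 2) + - / (2 * INR m) * cosint 0 (2 * m) = 0) in E. lra. }
  split.
  - replace ((1 - a ^ 2 / 2 / (2 * INR m)) * cosint 0 (2 * m)) with (cosint 0 (2 * m) + (- (a ^ 2 / 2)) * RInt
      G 0 (PI / 2)) by (rewrite EG; field; lra).
    assert (E : RInt (fun t => cos (0 * t) * cos t ^ (2 * m) + (- (a ^ 2 / 2)) * G t) 0 (PI / 2) = cosint 0 (2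
      * m) + (- (a ^ 2 / 2)) * RInt G 0 (PI / 2) :> R).
    { rewrite (RInt_plus (V := R_CompleteNormedModule)), (RInt_scal (V := R_CompleteNormedModule)).
      - reflexivity.
      - apply ex_RInt_cont; auto.
      - apply ex_RInt_cont; intro t; apply cont_cosint.
      - apply ex_RInt_cont; intro t; apply (continuous_scal_r (V := R_NormedModule)); auto. }
    rewrite <- E. apply RInt_le; auto.
    + apply ex_RInt_cont; intro t. apply (continuous_plus (V := R_NormedModule));
        [apply cont_cosint | apply (continuous_scal_r (V := R_NormedModule)); auto].
    + apply ex_RInt_cont; intro t; apply cont_cosint.
    + intros t Ht. unfold G. rewrite Rmult_0_l, cos_0.
      replace (cos t ^ (2 * m)) with (cos t * cos t ^ (2 * m - 1)).
      2: { replace (2 * m)%nat with (S (2 * m - 1)) at 2 by lia. reflexivity. }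
      assert (0 <= cos t ^ (2 * m - 1)) by (apply pow_le; auto).
      generalize (cos_ge_quad (a * t)) (tcos_le_sin t) (cc t Ht). intros H1 H2 H3. specialize (H2 ltac:(lra)).
      assert (K : cos t * (1 - cos (a * t)) <= a ^ 2 / 2 * (t * sin t)).
      { apply Rle_trans with (cos t * ((a * t) ^ 2 / 2)); [apply Rmult_le_compat_l; lra|].
        replace (cos t * ((a * t) ^ 2 / 2)) with (a ^ 2 / 2 * (t * (t * cos t))) by field.
        apply Rmult_le_compat_l; [generalize (pow2_ge_0 a); lra|]. apply Rmult_le_compat_l; lra. }
      apply (Rmult_le_compat_r (cos t ^ (2 * m - 1))) in K; auto. lra.
  - apply RInt_le; auto; try (apply ex_RInt_cont; intro t; apply cont_cosint).
    intros t Ht. apply Rmult_le_compat_r; [apply pow_le; auto|]. rewrite Rmult_0_l, cos_0. apply COS_bound.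
Qed.

Definition gauss (x : R) (n : nat) : R :=
  INR (fact n) * Rpower (INR n) x / prod_f_R0 (fun k : nat => x + INR k) n.

(** The finite form of Euler's product, with the ratio of the two integrals as exact remainder: the
    ratio is sin (pi nu) / (pi nu) at n = 0, and each use of [cosint_rec] splits off one factor 1 -
    nu^2 / (n + 1)^2. *)
Lemma sine_product nu n : 0 < nu < 1 ->
  prod_f_R0 (fun k => nu + INR k) n * prod_f_R0 (fun k => 1 - nu + INR k) n * PI *
   (cosint (2 * nu) (2 * n) / cosint 0 (2 * n)) = INR (fact n) ^ 2 * (INR n + 1 - nu) * sin (PI * nu).
Proof.
  intros Hnu. assert (HP := PI_RGT_0).
  induction n as [|n IH].
  - assert (E1 : cosint (2 * nu) 0 = sin (PI * nu) / (2 * nu)).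
    { unfold cosint. rewrite (RInt_FTC (fun t => sin (2 * nu * t) / (2 * nu))).
      - rewrite Rmult_0_r, sin_0. replace (2 * nu * (PI / 2)) with (PI * nu) by field. field. lra.
      - intro t. auto_derive; auto. simpl. field. lra.
      - intro t; apply cont_cosint. }
    assert (E2 : cosint 0 0 = PI / 2).
    { unfold cosint. rewrite (RInt_FTC (fun t => t)).
      - ring.
      - intro t. rewrite Rmult_0_l, cos_0. simpl. auto_derive; auto; ring.
      - intro t; apply cont_cosint. }
    simpl. rewrite E1, E2. field. lra.
  - assert (Q1 := cosint_rec (2 * nu) n). assert (Q2 := cosint_rec 0 n).
    replace (2 * S n)%nat with (2 * n + 2)%nat by lia.
    assert (p1 := cosint_0_pos n). assert (p2 := cosint_0_pos (S n)).
    replace (2 * S n)%nat with (2 * n + 2)%nat in p2 by lia.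
    assert (n0 := pos_INR n).
    change (prod_f_R0 (fun k => nu + INR k) n * (nu + INR (S n)) * (prod_f_R0 (fun k => 1 - nu + INR k) n * (1
      - nu + INR (S n))) * PI *
      (cosint (2 * nu) (2 * n + 2) / cosint 0 (2 * n + 2)) = INR (fact (S n)) ^ 2 * (INR (S n) + 1 - nu) * sin
        (PI * nu)).
    rewrite fact_simpl, mult_INR, S_INR.
    set (A := prod_f_R0 (fun k => nu + INR k) n) in *. set (B := prod_f_R0 (fun k => 1 - nu + INR k) n) in *.
    set (C1 := cosint (2 * nu) (2 * n)) in *. set (C2 := cosint 0 (2 * n)) in *.
    set (D1 := cosint (2 * nu) (2 * n + 2)) in *. set (D2 := cosint 0 (2 * n + 2)) in *.
    set (N := INR n) in *. set (f := INR (fact n)) in *. set (s := sin (PI * nu)) in *.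
    assert (R : C1 / C2 = (1 - nu ^ 2 / (N + 1) ^ 2) * (D1 / D2)).
    { assert (C1 = ((2 * N + 2) ^ 2 - (2 * nu) ^ 2) * D1 / ((2 * N + 2) * (2 * N + 1))) by (rewrite <- Q1;
        field; lra).
      assert (C2 = ((2 * N + 2) ^ 2 - 0 ^ 2) * D2 / ((2 * N + 2) * (2 * N + 1))) by (rewrite <- Q2; field; lra).
      rewrite H, H0. field. repeat split; try lra; nra. }
    rewrite R in IH.
    apply Rmult_eq_reg_l with (N + 1 - nu); [|lra].
    transitivity (A * B * PI * ((1 - nu ^ 2 / (N + 1) ^ 2) * (D1 / D2)) * ((N + 1) ^ 2 * (N + 1 + 1 - nu)));
      [field; lra|].
    rewrite IH. ring.
Qed.

Lemma lim_inv_nat c d : is_lim_seq (fun n => c + d / (INR n + 1)) c.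
Proof.
  replace (Finite c) with (Rbar_plus c (Rbar_mult d 0)) by (simpl; f_equal; ring).
  apply is_lim_seq_plus'; [apply is_lim_seq_const|].
  replace (d * 0) with (real (Rbar_mult d 0)) by (simpl; ring).
  assert (E : Rbar_mult d 0 = Finite (real (Rbar_mult d 0))) by (simpl; reflexivity). rewrite <- E.
  apply is_lim_seq_scal_l. apply is_lim_seq_ext with (fun n => / INR (S n)); [intro; rewrite S_INR; auto|].
  apply (is_lim_seq_incr_1 (fun n => / INR n)). replace (Finite 0) with (Rbar_inv p_infty) by reflexivity.
  apply is_lim_seq_inv; [apply is_lim_seq_INR | discriminate].
Qed.

Lemma prod_pos (f : nat -> R) n : (forall k, 0 < f k) -> 0 < prod_f_R0 f n.
Proof. intros H. induction n; simpl; auto. apply Rmult_lt_0_compat; auto. Qed.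

Lemma sin_PI_pos nu : 0 < nu < 1 -> 0 < sin (PI * nu).
Proof. intros. assert (HP := PI_RGT_0). apply sin_gt_0; nra. Qed.

(** Since n^nu n^(1 - nu) = n, [sine_product] becomes an explicit formula for the product of the two
    Gauss sequences, whose varying factors [R (S n)] and 1 + (1 - nu) / (n + 1) tend to 1. *)
Lemma reflection nu (g1 g2 : R) : 0 < nu < 1 ->
  is_lim_seq (gauss nu) g1 -> is_lim_seq (gauss (1 - nu)) g2 -> g1 * g2 = PI / sin (PI * nu).
Proof.
  intros Hnu H1 H2. assert (HP := PI_RGT_0). assert (Hs := sin_PI_pos nu Hnu).
  assert (L1 : is_lim_seq (fun n => gauss nu n * gauss (1 - nu) n) (g1 * g2)) by (apply is_lim_seq_mult'; auto).
  set (R := fun n : nat => cosint (2 * nu) (2 * n) / cosint 0 (2 * n)).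
  assert (LR : is_lim_seq (fun n => R (S n)) 1).
  { apply is_lim_seq_le_le with (fun n => 1 + (- nu ^ 2) / (INR n + 1)) (fun _ => 1);
      [|apply lim_inv_nat | apply is_lim_seq_const].
    intro n. destruct (cosint_bounds (2 * nu) (S n)) as [B1 B2]; [lia|]. assert (p := cosint_0_pos (S n)).
    unfold R. split; apply Rmult_le_reg_r with (cosint 0 (2 * S n)); auto;
    replace (cosint (2 * nu) (2 * S n) / cosint 0 (2 * S n) * cosint 0 (2 * S n)) with (cosint (2 * nu) (2 * S
      n)) by (field; lra).
    - eapply Rle_trans; [|exact B1]. right. rewrite S_INR. field. generalize (pos_INR n); lra.
    - lra. }
  assert (L2 : is_lim_seq (fun n => gauss nu (S n) * gauss (1 - nu) (S n)) (PI / sin (PI * nu))).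
  { apply is_lim_seq_ext with (fun n => (PI / sin (PI * nu)) * (R (S n) / (1 + (1 - nu) / (INR n + 1)))).
    - intro n. generalize (sine_product nu (S n) Hnu). intros E. unfold gauss, R in *.
      assert (p := cosint_0_pos (S n)). assert (n0 := pos_INR n).
      set (A := prod_f_R0 (fun k => nu + INR k) (S n)) in *.
      set (B := prod_f_R0 (fun k => 1 - nu + INR k) (S n)) in *.
      assert (0 < A) by (apply prod_pos; intro k; generalize (pos_INR k); lra).
      assert (0 < B) by (apply prod_pos; intro k; generalize (pos_INR k); lra).
      assert (f0 := INR_fact_lt_0 (S n)).
      set (Q := cosint (2 * nu) (2 * S n) / cosint 0 (2 * S n)) in *.
      assert (RP : Rpower (INR (S n)) nu * Rpower (INR (S n)) (1 - nu) = INR n + 1).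
      { rewrite <- Rpower_plus. replace (nu + (1 - nu)) with 1 by ring. rewrite Rpower_1, S_INR; auto.
        rewrite S_INR; lra. }
      set (p1 := Rpower (INR (S n)) nu) in *. set (p2 := Rpower (INR (S n)) (1 - nu)) in *.
      rewrite S_INR in E.
      assert (EQ : Q = INR (fact (S n)) ^ 2 * (INR n + 1 + 1 - nu) * sin (PI * nu) / (A * B * PI)) by (rewrite
        <- E; field; lra).
      rewrite EQ. transitivity (INR (fact (S n)) ^ 2 * (p1 * p2) / (A * B)); [rewrite RP; field; repeat split;
        lra | field; lra].
    - replace (Finite (PI / sin (PI * nu))) with (Finite (PI / sin (PI * nu) * (1 / 1))) by (f_equal; field;
        lra).
      apply is_lim_seq_mult'; [apply is_lim_seq_const|].
      apply is_lim_seq_div'; auto. apply lim_inv_nat. }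
  apply is_lim_seq_incr_1 in L1. apply is_lim_seq_unique in L1. apply is_lim_seq_unique in L2.
  rewrite L1 in L2. injection L2. auto.
Qed.

Lemma prod_shift x n : prod_f_R0 (fun k => x + INR k) (S n) = x * prod_f_R0 (fun k => x + 1 + INR k) n.
Proof.
  induction n as [|n IH]; [simpl; ring|].
  change (prod_f_R0 (fun k => x + INR k) (S n) * (x + INR (S (S n))) = x * (prod_f_R0 (fun k => x + 1 + INR k)
    n * (x + 1 + INR (S n)))).
  rewrite IH, !S_INR. ring.
Qed.

Lemma prod_neq_0 (f : nat -> R) n : (forall k, f k <> 0) -> prod_f_R0 f n <> 0.
Proof. intros H. induction n; simpl; auto. Qed.

(** This continues Gauss's limit to negative arguments, which the integral representation does not
    reach and which occur in I_(-nu). *)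
Lemma gauss_down x (g : R) : (forall k,
  x + INR k <> 0) -> is_lim_seq (gauss (x + 1)) g -> is_lim_seq (gauss x) (g / x).
Proof.
  intros Hx H. apply is_lim_seq_incr_1 in H. apply is_lim_seq_incr_1.
  assert (x0 : x <> 0) by (generalize (Hx O); simpl; lra).
  apply is_lim_seq_ext with (fun n => gauss (x + 1) (S n) * ((1 + (x + 1) / (INR n + 1)) / x)).
  - intro n. unfold gauss. assert (n0 := pos_INR n).
    assert (RP : Rpower (INR (S n)) (x + 1) = Rpower (INR (S n)) x * (INR n + 1)).
    { rewrite Rpower_plus, Rpower_1, S_INR; auto. rewrite S_INR; lra. }
    rewrite RP. assert (E := prod_shift x (S n)).
    change (prod_f_R0 (fun k => x + INR k) (S n) * (x + INR (S (S n))) = x * prod_f_R0 (fun k => x + 1 + INR k)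
      (S n)) in E.
    assert (P1 : prod_f_R0 (fun k => x + INR k) (S n) <> 0) by (apply prod_neq_0; auto).
    assert (P2 : prod_f_R0 (fun k => x + 1 + INR k) (S n) <> 0).
    { apply prod_neq_0. intro k. generalize (Hx (S k)). rewrite S_INR. intros; lra. }
    set (A := prod_f_R0 (fun k => x + INR k) (S n)) in *.
    set (B := prod_f_R0 (fun k => x + 1 + INR k) (S n)) in *.
    assert (EB : B = A * (x + INR (S (S n))) / x) by (rewrite E; field; auto).
    assert (H2 := Hx (S (S n))). rewrite EB. rewrite !S_INR in *. field. repeat split; auto; lra.
  - replace (g / x) with (g * (1 / x)) by (field; auto). apply is_lim_seq_mult'; auto.
    apply is_lim_seq_div'; [apply lim_inv_nat | apply is_lim_seq_const | auto].
Qed.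

Lemma Gamma_of_gauss x (g : R) : is_lim_seq (gauss x) g -> Gamma x = g.
Proof. intros H. unfold Gamma. fold (gauss x). rewrite (is_lim_seq_unique _ _ H). reflexivity. Qed.

(** * The solution K and the Bohr-Mollerup theorem *)

Definition kw nu x := kt nu (exp x).
Definition dkw nu x := - (exp x / 2) * (kt (nu + 1) (exp x) + kt (nu - 1) (exp x)).

Lemma kw_derive nu x : is_derive (kw nu) x (dkw nu x).
Proof.
  eapply is_derive_eq.
  - apply (is_derive_comp (kt nu) exp); [apply kt_derive, exp_pos | apply is_derive_exp].
  - unfold scal; simpl; unfold mult; simpl. unfold dkw. field.
Qed.

Lemma kw_rec nu x : exp x * (kw (nu + 1) x - kw (nu - 1) x) = 2 * nu * kw nu x.
Proof. unfold kw. rewrite kt_rec by apply exp_pos. field. apply Rgt_not_eq, exp_pos. Qed.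

Lemma dkw_up nu x : dkw nu x = nu * kw nu x - exp x * kw (nu + 1) x.
Proof. generalize (kw_rec nu x). unfold dkw. fold (kw (nu + 1) x) (kw (nu - 1) x). lra. Qed.

Lemma dkw_down nu x : dkw nu x = - nu * kw nu x - exp x * kw (nu - 1) x.
Proof. generalize (kw_rec nu x). unfold dkw. fold (kw (nu + 1) x) (kw (nu - 1) x). lra. Qed.

Lemma dkw_derive nu x : is_derive (dkw nu) x ((nu ^ 2 + exp x ^ 2) * kw nu x).
Proof.
  (* Raising the order first and lowering it afterwards returns to nu, so that the second derivative
     again comes from [kw_derive]. *)
  apply is_derive_ext with (fun y => nu * kw nu y - exp y * kw (nu + 1) y); [intro; symmetry; apply dkw_up|].
  eapply is_derive_eq.
  - apply (is_derive_minus (V := R_NormedModule)); [apply is_derive_scal, kw_derive|].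
    apply is_derive_Rmult; [apply is_derive_exp | apply kw_derive].
  - unfold minus, plus, opp; simpl. rewrite (dkw_up nu), (dkw_down (nu + 1)).
    replace (nu + 1 - 1) with nu by ring. ring.
Qed.

Lemma kw_pos nu x : 0 <= kw nu x.
Proof. apply kt_pos, exp_pos. Qed.

Lemma kw_neg nu x : kw (- nu) x = kw nu x.
Proof. apply kt_neg. Qed.

Lemma cder_RtoC f x d : is_derive f x d -> cder (fun y => RtoC (f y)) x (RtoC d).
Proof. intros H. split; simpl; [exact H | apply (is_derive_const (V := R_NormedModule))]. Qed.

Lemma cder_Hol_R F F' x : Hol F F' -> cder (fun y => F (RtoC y)) x (F' (RtoC x)).
Proof.
  intros H. eapply cder_eq; [apply cder_Hol with (1 := H);
    apply (cder_RtoC (fun y => y) x 1), (is_derive_id (K := R_AbsRing))|].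
  ring.
Qed.

Lemma curve_const (g : R -> C) : (forall s, cder g s 0%C) -> forall a b, g a = g b.
Proof.
  intros H. assert (G : forall a b, a <= b -> g b = g a).
  { intros a b Hab. apply Ceq_minus, Cmod_eq_0, Rle_antisym; [|apply Cmod_ge_0].
    replace 0 with (0 - 0) by ring.
    apply (curve_mvt g (fun _ => 0%C) (fun _ => 0) (fun _ => 0)); auto.
    - intros; apply (is_derive_const (V := R_NormedModule)).
    - intros; rewrite Cmod_0; lra. }
  intros a b. destruct (Rle_dec a b); [symmetry; auto | apply G; lra].
Qed.

Lemma kw_Wr_const nu f f' : Sol nu f f' -> forall x y : R,
  (RtoC (kw nu x) * f' x - RtoC (dkw nu x) * f x = RtoC (kw nu y) * f' y - RtoC (dkw nu y) * f y)%C.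
Proof.
  intros [H1 H2]. apply (curve_const (fun x => (RtoC (kw nu x) * f' x - RtoC (dkw nu x) * f x)%C)).
  intro s. eapply cder_eq.
  - apply cder_minus; apply cder_mult.
    + apply cder_RtoC, kw_derive.
    + exact (cder_Hol_R _ _ s H2).
    + apply cder_RtoC, dkw_derive.
    + exact (cder_Hol_R _ _ s H1).
  - cbv beta. rewrite cexp_2, cexp_R, (RtoC_mult (nu ^ 2 + exp s ^ 2)), RtoC_plus.
    replace (RtoC (exp s ^ 2)) with (RtoC (exp s) * RtoC (exp s))%C by (rewrite <- RtoC_mult; f_equal; ring).
    ring.
Qed.

(** The continuation of K_nu off the positive axis, stated as a predicate because the solution is
    constructed differently for orders in ]0, 1[, for order 0, and by raising the order; later
    arguments use only the equation and the values on the real axis. *)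
Definition IsK nu U U' := Sol nu U U' /\ forall x : R,
  U (RtoC x) = RtoC (kw nu x) /\ U' (RtoC x) = RtoC (dkw nu x).

Lemma Sol_lin nu a b f f' g g' : Sol nu f f' -> Sol nu g g' ->
  Sol nu (fun w => a * f w + b * g w)%C (fun w => a * f' w + b * g' w)%C.
Proof.
  intros [F1 F2] [G1 G2]. split.
  - apply Hol_plus; apply Hol_scal; assumption.
  - eapply Hol_ext_r; [|apply Hol_plus; apply Hol_scal; eassumption]. intro w; simpl. ring.
Qed.

(** Cramer's rule: the Wronskians of [kw] with both basis solutions are constant on the real axis,
    so their values at 0 give coefficients valid at every x. *)
Lemma IsK_span nu f f' g g' om : Sol nu f f' -> Sol nu g g' -> (forall w, Wr f f' g g' w = om) -> om <> 0%C ->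
  exists a b, IsK nu (fun w => a * f w + b * g w)%C (fun w => a * f' w + b * g' w)%C.
Proof.
  intros Hf Hg HW Hom.
  set (P := (RtoC (kw nu 0) * g' 0%C - RtoC (dkw nu 0) * g 0%C)%C).
  set (Q := (RtoC (kw nu 0) * f' 0%C - RtoC (dkw nu 0) * f 0%C)%C).
  exists (P / om)%C, (- Q / om)%C. split; [apply Sol_lin; auto|]. intro x.
  assert (EP := kw_Wr_const nu g g' Hg x 0). assert (EQ := kw_Wr_const nu f f' Hf x 0).
  fold P in EP. fold Q in EQ. rewrite <- EP, <- EQ, <- (HW x). unfold Wr.
  assert (N : (f x * g' x - f' x * g x)%C <> 0%C) by (fold (Wr f f' g g' x); rewrite HW; auto).
  split; field; auto.
Qed.

Lemma IsK_T nu U U' : IsK nu U U' -> IsK (nu + 1) (Tu nu U U') (dTu nu U U').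
Proof.
  intros [HS HR]. split; [now apply Sol_T|]. intro x. destruct (HR x) as [E1 E2].
  assert (E : Tu nu U U' x = RtoC (kw (nu + 1) x)).
  { unfold Tu. rewrite E1, E2, dkw_up, RtoC_minus, !RtoC_mult, cexp_opp, cexp_R. field.
    intro H. apply (f_equal fst) in H. simpl in H. generalize (exp_pos x); lra. }
  split; auto. unfold dTu. rewrite E, E1, (dkw_down (nu + 1)), cexp_R. replace (nu + 1 - 1) with nu by ring.
  rewrite RtoC_minus, !RtoC_mult, RtoC_opp. ring.
Qed.

Lemma nonpole_neg nu : 0 < nu < 1 -> nonpole (- nu).
Proof. intros H j. generalize (pos_INR j); lra. Qed.

Lemma RtoC_neq_0 x : x <> 0 -> RtoC x <> 0%C.
Proof. intros H E. apply H. apply (f_equal fst) in E. exact E. Qed.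

Lemma IsK_frac nu : 0 < nu < 1 -> exists a b,
  IsK nu (fun w => a * phi nu w + b * phi (- nu) w)%C (fun w => a * dphi nu w + b * dphi (- nu) w)%C.
Proof.
  intros H. apply IsK_span with (RtoC (- (2 * nu))).
  - apply Sol_phi, nonpole_pos; lra.
  - assert (S := Sol_phi (- nu) (nonpole_neg nu H)). destruct S as [A B]. split; auto.
    eapply Hol_ext_r; [|exact B]. intro; simpl. f_equal. f_equal. f_equal. ring.
  - intro w. apply Wr_phi; [apply nonpole_pos; lra | now apply nonpole_neg].
  - apply RtoC_neq_0; lra.
Qed.

(** Order 0 takes the logarithmic solution, orders in ]0, 1[ the basis [phi nu], [phi (- nu)];
    raising the order reaches all others, in particular the positive integers, without further
    series. *)
Lemma IsK_exists nu : 0 <= nu -> exists U U', IsK nu U U'.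
Proof.
  intros H0.
  assert (G : forall n nu, INR n <= nu < INR n + 1 -> exists U U', IsK nu U U').
  { induction n as [|n IH]; intros mu Hmu.
    - simpl in Hmu. destruct (Req_dec mu 0) as [->|Hn].
      + destruct (IsK_span 0 (phi 0) (dphi 0) psi0 dpsi0 1%C) as [a [b H]].
        * apply Sol_phi, nonpole_pos; lra.
        * apply Sol_psi0.
        * apply Wr_psi0.
        * apply RtoC_neq_0; lra.
        * eauto.
      + destruct (IsK_frac mu) as [a [b H]]; [lra | eauto].
    - rewrite S_INR in Hmu. destruct (IH (mu - 1)) as [U [U' H]]; [lra|].
      exists (Tu (mu - 1) U U'), (dTu (mu - 1) U U'). replace mu with (mu - 1 + 1) at 1 by ring.
      now apply IsK_T. }
  destruct (nfloor_ex nu H0) as [n Hn]. apply (G n); auto.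
Qed.

(* [ak nu a] : [2 (x/2)^nu K_nu(x)] tends to [a] as [x] tends to [0]; this [a] will be Gamma nu. *)
Definition ak (nu a : R) := clim (fun x => RtoC (2 * exp (nu * (x - ln 2)) * kw nu x)) (RtoC a).

Lemma clim_real f l : clim (fun x => RtoC (f x)) l -> clim (fun x => RtoC (f x)) (RtoC (fst l)).
Proof.
  intros H eps He. destruct (H eps He) as [X HX]. exists X. intros x Hx. specialize (HX x Hx).
  rewrite <- RtoC_minus, Cmod_R. eapply Rle_trans; [|exact HX]. eapply Rle_trans; [|apply Cmod_fst]. right.
  f_equal.
Qed.

Lemma clim_R_le f g a b : (forall x, f x <= g x) -> clim (fun x => RtoC (f x)) (RtoC a) -> clim (fun x => RtoC
  (g x)) (RtoC b) -> a <= b.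
Proof.
  intros H Hf Hg. apply le_epsilon. intros eps He.
  destruct (Hf (eps / 2)) as [X HX]; [lra|]. destruct (Hg (eps / 2)) as [Y HY]; [lra|].
  specialize (HX _ (Rmin_l X Y)). specialize (HY _ (Rmin_r X Y)). specialize (H (Rmin X Y)).
  rewrite <- RtoC_minus, Cmod_R in HX, HY. apply Rabs_le_between in HX. apply Rabs_le_between in HY. lra.
Qed.

Lemma ak_unique nu a b : ak nu a -> ak nu b -> a = b.
Proof. intros Ha Hb. assert (H := clim_unique _ _ _ Ha Hb). now apply RtoC_inj. Qed.

Lemma ak_1 : ak 1 1.
Proof.
  intros eps He.
  destruct (clim_exp 1 Rlt_0_1 (Rmin (eps / 4) 1)) as [X HX]; [apply Rmin_pos; lra|].
  exists X. intros x Hx. specialize (HX x Hx).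
  replace (exp (1 * x) - 0)%C with (RtoC (exp x)) in HX by (rewrite Rmult_1_l; ring).
  rewrite Cmod_R, Rabs_pos_eq in HX by (apply Rlt_le, exp_pos).
  rewrite <- RtoC_minus, Cmod_R.
  replace (2 * exp (1 * (x - ln 2)) * kw 1 x) with (exp x * kt 1 (exp x)).
  2: { unfold kw. rewrite Rmult_1_l. unfold Rminus. rewrite exp_plus, exp_Ropp, exp_ln by lra. field. }
  assert (E := kt_1_small (exp x) (exp_pos x)). set (y := exp x) in *.
  assert (0 < y) by apply exp_pos.
  assert (y1 : y <= eps / 4) by (eapply Rle_trans; [exact HX | apply Rmin_l]).
  assert (E2 : Rabs (exp (- y) - 1) <= y).
  { generalize (exp_ineq1_le (- y)); intros. assert (exp (- y) <= 1) by (rewrite <- exp_0; apply exp_le; lra).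
    apply Rabs_le; lra. }
  replace (y * kt 1 y - 1) with ((y * kt 1 y - exp (- y)) + (exp (- y) - 1)) by ring.
  eapply Rle_trans; [apply Rabs_triang|]. lra.
Qed.

(** After multiplication by t^nu, [phi (- nu)] tends to 1 while [phi nu] becomes of size t^(2 nu):
    only b survives. *)
Lemma kw_leading nu a b : 0 < nu < 1 -> (forall x : R, (a * phi nu x + b * phi (- nu) x)%C = RtoC (kw nu x)) ->
  clim (fun x => RtoC (2 * exp (nu * (x - ln 2)) * kw nu x)) (RtoC (2 * exp (- (nu * ln 2))) * b)%C.
Proof.
  intros H HR.
  assert (N1 : nonpole nu) by (apply nonpole_pos; lra). assert (N2 := nonpole_neg nu H).
  replace b with (a * (0 * 1) + b * 1)%C at 1 by ring.
  eapply clim_ext; [|apply clim_scal; apply clim_plus; apply clim_scal; [apply clim_mult;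
    [apply (clim_exp (2 * nu)); lra | apply (phi_clim nu N1)] | apply (phi_clim (- nu) N2)]].
  intro x. cbv beta.
  replace (2 * exp (nu * (x - ln 2)) * kw nu x) with ((2 * exp (- (nu * ln 2))) * (exp (nu * x) * kw nu x)).
  2: { replace (nu * (x - ln 2)) with (- (nu * ln 2) + nu * x) by ring. rewrite exp_plus. ring. }
  rewrite (RtoC_mult (2 * exp (- (nu * ln 2))) (exp (nu * x) * kw nu x)), (RtoC_mult (exp (nu * x)) (kw nu x)),
    <- HR.
  replace (- RtoC nu * x)%C with (- RtoC (nu * x))%C by (rewrite RtoC_mult; ring).
  replace (- RtoC (- nu) * x)%C with (RtoC (nu * x))%C by (rewrite RtoC_opp, RtoC_mult; ring).
  rewrite cexp_opp, !cexp_R. replace (exp (2 * nu * x)) with (exp (nu * x) * exp (nu * x)) by (rewrite <-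
    exp_plus; f_equal; ring).
  rewrite (RtoC_mult (exp (nu * x)) (exp (nu * x))). field. apply RtoC_neq_0, Rgt_not_eq, exp_pos.
Qed.

Lemma ak_frac nu : 0 < nu < 1 -> exists a, ak nu a.
Proof.
  intros H. destruct (IsK_frac nu H) as [a [b [_ HR]]].
  eexists. exact (clim_real _ _ (kw_leading nu a b H (fun x => proj1 (HR x)))).
Qed.

Lemma clim_R_0 f a c : 0 < c -> (forall x, x <= 0 -> f x = exp (c * x) * a x) -> (exists l,
  clim (fun x => RtoC (a x)) l) ->
  clim (fun x => RtoC (f x)) 0%C.
Proof.
  intros Hc E [l Hl].
  assert (L := clim_mult _ _ _ _ (clim_exp c Hc) Hl). rewrite Cmult_0_l in L.
  apply (clim_le _ (fun x => (RtoC (exp (c * x)) * RtoC (a x))%C)); auto.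
  exists 0. intros x Hx. rewrite E by auto. rewrite RtoC_mult. lra.
Qed.

(* The error term in [L_{nu+1} = nu L_nu + (x/2)^2 L_{nu-1}], where [L_nu = 2 (x/2)^nu K_nu(x)]. *)
Lemma ak_S_aux nu a : ak nu a -> clim (fun x => RtoC (2 * exp ((nu + 1) * (x - ln 2)) * kw (nu - 1) x)) 0%C ->
  ak (nu + 1) (nu * a).
Proof.
  intros Ha H0. unfold ak. replace (RtoC (nu * a)) with (RtoC nu * RtoC a + 0)%C by (rewrite RtoC_mult; ring).
  eapply clim_ext; [|apply clim_plus; [apply clim_scal, Ha | exact H0]].
  intro x. cbv beta. rewrite <- RtoC_mult, <- RtoC_plus. f_equal.
  assert (E := kw_rec nu x). assert (e0 := exp_pos x).
  replace (kw (nu + 1) x) with (kw (nu - 1) x + 2 * nu * kw nu x / exp x) by (rewrite <- E; field; lra).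
  replace ((nu + 1) * (x - ln 2)) with (nu * (x - ln 2) + (x + - ln 2)) by ring.
  rewrite !exp_plus, exp_Ropp, exp_ln by lra. field. lra.
Qed.

Lemma kw_0_le_1 x : kw 0 x <= kw 1 x.
Proof. apply kt_0_le_1, exp_pos. Qed.

(** The error term of [ak_S_aux] has order nu - 1: for nu > 1 it is smaller by t^2; for nu < 1 it is
    k_(1-nu), smaller by t^(2 nu); at nu = 1 the logarithmic k_0 is bounded by k_1. The induction
    runs over the intervals ]n, n + 1], closed on the right so that the integers start from
    [ak_1]. *)
Lemma ak_exists_S nu : 0 < nu -> (exists a, ak nu a) /\ (forall a, ak nu a -> ak (nu + 1) (nu * a)).
Proof.
  intros H0.
  assert (F : forall c b mu, 0 < c -> ak mu b -> clim (fun x => RtoC (exp (c * x) * (2 * exp (mu * (x - ln 2))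
    * kw mu x))) 0%C).
  { intros c b mu Hc Hb. eapply clim_R_0; [exact Hc | intros; reflexivity | exists (RtoC b); exact Hb]. }
  assert (Q : forall a b mu k, a - b = mu -> 0 < mu -> ak b k -> clim (fun x => RtoC (2 * exp (a * (x - ln 2))
    * kw b x)) 0%C).
  { intros a b mu k E Hm Hk.
    assert (L := clim_scal (RtoC (exp (- (mu * ln 2)))) _ _ (F mu k b Hm Hk)). rewrite Cmult_0_r in L.
    eapply clim_ext; [|exact L]. intro x. cbv beta. rewrite <- RtoC_mult. f_equal.
    replace (a * (x - ln 2)) with (- (mu * ln 2) + mu * x + b * (x - ln 2)) by (rewrite <- E; ring).
    rewrite !exp_plus. ring. }
  assert (Z : clim (fun x => RtoC (2 * exp ((1 + 1) * (x - ln 2)) * kw (1 - 1) x)) 0%C).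
  { apply clim_le with (fun x => RtoC (2 * exp (2 * (x - ln 2)) * kw 1 x)); [|apply (Q 2 1 1 1); try lra;
      apply ak_1].
    exists 0. intros x _. rewrite !Cmod_R. replace (1 - 1) with 0 by ring. replace (1 + 1) with 2 by ring.
    generalize (exp_pos (2 * (x - ln 2))) (kw_pos 0 x) (kw_pos 1 x) (kw_0_le_1 x); intros.
    rewrite !Rabs_pos_eq by nra. nra. }
  assert (G : forall n nu, INR n < nu <= INR n + 1 -> (exists a, ak nu a) /\ (forall a,
    ak nu a -> ak (nu + 1) (nu * a))).
  { induction n as [|n IH]; intros mu Hmu.
    - simpl in Hmu. destruct (Req_dec mu 1) as [->|Hn].
      + split; [exists 1; apply ak_1|]. intros a Ha. apply ak_S_aux; auto.
      + split; [apply ak_frac; lra|]. intros a Ha. apply ak_S_aux; auto.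
        destruct (ak_frac (1 - mu)) as [b Hb]; [lra|].
        assert (L := Q (mu + 1) (1 - mu) (2 * mu) b ltac:(lra) ltac:(lra) Hb).
        eapply clim_ext; [|exact L]. intro x. cbv beta. rewrite <- (kw_neg (mu - 1)). do 3 f_equal. ring.
    - rewrite S_INR in Hmu. destruct (IH (mu - 1)) as [[b Hb] Hs]; [lra|].
      assert (Hm : ak mu ((mu - 1) * b)) by (replace mu with (mu - 1 + 1) at 1 by ring; apply Hs, Hb).
      split; [eexists; exact Hm|]. intros a Ha. apply ak_S_aux; auto.
      apply (Q (mu + 1) (mu - 1) 2 b); auto; lra. }
  destruct (nfloor_ex nu) as [n Hn]; [lra|]. destruct (Req_dec nu (INR n)) as [E|E]; [|apply (G n); lra].
  destruct n as [|n]; [simpl in E; lra|]. rewrite S_INR in *. apply (G n). lra.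
Qed.

(** The choice l = ln n - (x - ln 2) in [kt_interp] balances the powers of t/2 in the three terms,
    so that the inequality passes to the limit t = 0. With D = n A the right side is A, that is,
    Gamma (n + s) <= n^s Gamma n. *)
Lemma ak_interp n s A B D : 0 < n -> 0 <= s <= 1 -> ak n A -> ak (n + s) B -> ak (n + 1) D ->
  exp (- (s * ln n)) * B <= (1 - s) * A + s / n * D.
Proof.
  intros Hn Hs HA HB HD.
  apply (clim_R_le (fun x => exp (- (s * ln n)) * (2 * exp ((n + s) * (x - ln 2)) * kw (n + s) x))
    (fun x => (1 - s) * (2 * exp (n * (x - ln 2)) * kw n x) + s / n * (2 * exp ((n + 1) * (x - ln 2)) * kw (n +
      1) x))).
  - intro x. assert (E := kt_interp n s (ln n - (x - ln 2)) (exp x) (exp_pos x) Hs).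
    fold (kw (n + s) x) (kw n x) (kw (n + 1) x) in E.
    replace (- (s * (ln n - (x - ln 2)))) with (- (s * ln n) + s * (x - ln 2)) in E by ring.
    replace (- (ln n - (x - ln 2))) with (- ln n + (x - ln 2)) in E by ring.
    rewrite !exp_plus, (exp_Ropp (ln n)), exp_ln in E by auto.
    replace ((n + s) * (x - ln 2)) with (n * (x - ln 2) + s * (x - ln 2)) by ring.
    replace ((n + 1) * (x - ln 2)) with (n * (x - ln 2) + (x - ln 2)) by ring.
    rewrite !exp_plus.
    assert (p := exp_pos (n * (x - ln 2))).
    apply (Rmult_le_compat_l (2 * exp (n * (x - ln 2)))) in E; [|lra].
    eapply Rle_trans; [|eapply Rle_trans; [exact E|]]; right; [ring | field; lra].
  - eapply clim_ext; [|rewrite RtoC_mult; apply clim_scal, HB]. intro x. cbv beta.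
    rewrite (RtoC_mult (exp (- (s * ln n)))). reflexivity.
  - rewrite RtoC_plus, !RtoC_mult. eapply clim_ext; [|apply clim_plus;
      [apply clim_scal, HA | rewrite <- RtoC_mult, RtoC_mult; apply clim_scal, HD]].
    intro x. cbv beta. rewrite RtoC_plus, (RtoC_mult (1 - s)), (RtoC_mult (s / n)). reflexivity.
Qed.

Lemma ak_fact n : ak (INR n + 1) (INR (fact n)).
Proof.
  induction n as [|n IH]; [simpl; replace (0 + 1) with 1 by ring; apply ak_1|].
  rewrite S_INR, fact_simpl, mult_INR, S_INR. apply ak_exists_S; auto. generalize (pos_INR n); lra.
Qed.

Lemma ak_prod s a n : 0 < s -> ak s a -> ak (s + INR n + 1) (a * prod_f_R0 (fun k => s + INR k) n).
Proof.
  intros Hs Ha. induction n as [|n IH].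
  - simpl. rewrite Rplus_0_r, Rmult_comm. apply ak_exists_S; auto.
  - change (prod_f_R0 (fun k => s + INR k) (S n)) with (prod_f_R0 (fun k => s + INR k) n * (s + INR (S n))).
    rewrite S_INR. replace (a * (prod_f_R0 (fun k => s + INR k) n * (s + (INR n + 1)))) with
     ((s + INR n + 1) * (a * prod_f_R0 (fun k => s + INR k) n)) by ring.
    replace (s + (INR n + 1) + 1) with ((s + INR n + 1) + 1) by ring.
    apply ak_exists_S; auto. generalize (pos_INR n); lra.
Qed.

(* Bohr-Mollerup: the convexity inequality [ak_interp] squeezes [a] between Gauss's products. *)
Lemma ak_gauss_1 s a : 0 < s <= 1 -> ak s a -> 0 < a /\ is_lim_seq (gauss s) a.
Proof.
  intros Hs Ha.
  assert (Bd : forall n, 0 < a /\ INR (fact n) * (INR n + 1) <= exp ((1 - s) * ln (INR n + 1 + s)) * (a *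
    prod_f_R0 (fun k => s + INR k) n)
     /\ a * prod_f_R0 (fun k => s + INR k) n <= exp (s * ln (INR n + 1)) * INR (fact n)).
  { intro n. assert (n0 := pos_INR n).
    set (X := a * prod_f_R0 (fun k => s + INR k) n).
    assert (H1 : ak (INR n + 1 + s) X) by (replace (INR n + 1 + s) with (s + INR n + 1) by ring; apply ak_prod;
      auto; lra).
    assert (H2 := ak_fact n).
    assert (H3 : ak (INR n + 1 + 1) ((INR n + 1) * INR (fact n))) by (apply ak_exists_S; auto; lra).
    assert (H4 : ak (INR n + 1 + s + 1) ((INR n + 1 + s) * X)) by (apply ak_exists_S; auto; lra).
    assert (I1 := ak_interp (INR n + 1) s _ _ _ ltac:(lra) ltac:(lra) H2 H1 H3).
    assert (H3' : ak (INR n + 1 + s + (1 - s)) ((INR n + 1) * INR (fact n))) by (replace (INR n + 1 + s + (1 -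
      s)) with (INR n + 1 + 1) by ring; auto).
    (* The same inequality started at n + 1 + s with step 1 - s ends at the integer n + 2, and
       bounds the product from below. *)
    assert (I2 := ak_interp (INR n + 1 + s) (1 - s) _ _ _ ltac:(lra) ltac:(lra) H1 H3' H4).
    assert (I1' : exp (- (s * ln (INR n + 1))) * X <= INR (fact n)) by (eapply Rle_trans; [exact I1 | right;
      field; lra]).
    assert (I2' : exp (- ((1 - s) * ln (INR n + 1 + s))) * ((INR n + 1) * INR (fact n)) <= X) by (eapply
      Rle_trans; [exact I2 | right; field; lra]).
    rewrite exp_Ropp in I1', I2'. assert (p1 := exp_pos (s * ln (INR n + 1))).
    assert (p2 := exp_pos ((1 - s) * ln (INR n + 1 + s))).
    assert (f0 := fact_pos n).
    assert (X0 : 0 < X).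
    { eapply Rlt_le_trans; [|exact I2']. apply Rmult_lt_0_compat;
        [now apply Rinv_0_lt_compat | apply Rmult_lt_0_compat; lra]. }
    split; [|split].
    - unfold X in X0. assert (0 < prod_f_R0 (fun k => s + INR k) n) by (apply prod_pos; intro k;
        generalize (pos_INR k); lra).
      apply Rmult_lt_reg_r with (prod_f_R0 (fun k => s + INR k) n); lra.
    - apply (Rmult_le_compat_l _ _ _ (Rlt_le _ _ p2)) in I2'. rewrite <- Rmult_assoc, Rinv_r in I2' by lra. lra.
    - apply (Rmult_le_compat_l _ _ _ (Rlt_le _ _ p1)) in I1'. rewrite <- Rmult_assoc, Rinv_r in I1' by lra.
      lra. }
  assert (a0 : 0 < a) by apply (Bd O). split; auto.
  apply is_lim_seq_incr_1.
  apply is_lim_seq_le_le with (fun n => a + (- (2 * a)) / (INR n + 1)) (fun n => a + (a * s) / (INR n + 1));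
    try apply lim_inv_nat.
  intro m. destruct (Bd (S m)) as [_ [B1 B2]]. assert (m0 := pos_INR m).
  set (Pn := prod_f_R0 (fun k => s + INR k) (S m)) in *.
  assert (P0 : 0 < Pn) by (apply prod_pos; intro k; generalize (pos_INR k); lra).
  assert (f0 := fact_pos (S m)). unfold gauss. fold Pn. rewrite S_INR in *. unfold Rpower.
  set (f := INR (fact (S m))) in *.
  set (n := INR m + 1) in *. assert (n1 : 1 <= n) by (unfold n; lra).
  (* Since 0 < s <= 1, rational bounds for the powers are enough: they cost a relative error of
     order 1/n, harmless for the squeeze. *)
  assert (e1 : exp (s * ln (n + 1)) <= exp (s * ln n) * ((n + 1) / n)).
  { replace ((n + 1) / n) with (exp (ln (n + 1) - ln n)).
    - rewrite <- exp_plus. apply exp_le. assert (ln n <= ln (n + 1)) by (apply ln_le; lra). nra.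
    - unfold Rminus. rewrite exp_plus, exp_Ropp, !exp_ln by lra. field; lra. }
  assert (e2 : exp (s * ln n) * exp ((1 - s) * ln (n + 1 + s)) <= n + 1 + s).
  { rewrite <- (exp_ln (n + 1 + s)) at 2 by lra. rewrite <- exp_plus. apply exp_le.
    assert (ln n <= ln (n + 1 + s)) by (apply ln_le; lra). nra. }
  set (E := exp (s * ln n)) in *. assert (E0 : 0 < E) by apply exp_pos.
  split; apply Rmult_le_reg_r with Pn; auto; replace (f * E / Pn * Pn) with (f * E) by (field; lra).
  - apply Rle_trans with (n / (n + 1) * (a * Pn)).
    + replace ((a + - (2 * a) / n) * Pn) with ((1 - 2 / n) * (a * Pn)) by (field; lra).
      apply Rmult_le_compat_r; [apply Rmult_le_pos; lra|].
      apply Rmult_le_reg_r with (n * (n + 1)); [nra|].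
      replace ((1 - 2 / n) * (n * (n + 1))) with ((n - 2) * (n + 1)) by (field; lra).
      replace (n / (n + 1) * (n * (n + 1))) with (n * n) by (field; lra). nra.
    + apply Rle_trans with (n / (n + 1) * (E * ((n + 1) / n) * f)).
      * apply Rmult_le_compat_l; [apply Rmult_le_pos; [lra | apply Rlt_le, Rinv_0_lt_compat; lra]|].
        eapply Rle_trans; [exact B2|]. apply Rmult_le_compat_r; lra.
      * right; field; lra.
  - apply Rmult_le_reg_r with (n + 1); [lra|].
    apply Rle_trans with (E * (exp ((1 - s) * ln (n + 1 + s)) * (a * Pn))); [|].
    + replace (f * E * (n + 1)) with (E * (f * (n + 1))) by ring. apply Rmult_le_compat_l; lra.
    + rewrite <- Rmult_assoc. apply Rle_trans with ((n + 1 + s) * (a * Pn)).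
      * apply Rmult_le_compat_r; [apply Rmult_le_pos; lra | auto].
      * replace ((a + a * s / n) * Pn * (n + 1)) with ((1 + s / n) * (n + 1) * (a * Pn)) by (field; lra).
        apply Rmult_le_compat_r; [apply Rmult_le_pos; lra|].
        assert (s <= s / n * (n + 1)) by (replace (s / n * (n + 1)) with (s + s / n) by (field; lra);
          assert (0 <= s / n) by (apply Rmult_le_pos; [lra | apply Rlt_le, Rinv_0_lt_compat; lra]); lra). lra.
Qed.

Lemma gauss_up x (g : R) : (forall k, x + INR k <> 0) -> is_lim_seq (gauss x) g -> is_lim_seq (gauss (x + 1))
  (x * g).
Proof.
  intros Hx H. apply is_lim_seq_incr_1 in H. apply is_lim_seq_incr_1.
  assert (x0 : x <> 0) by (generalize (Hx O); simpl; lra).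
  apply is_lim_seq_ext with (fun n => (x / (1 + (x + 1) / (INR n + 1))) * gauss x (S n)).
  - intro n. unfold gauss. assert (n0 := pos_INR n).
    assert (RP : Rpower (INR (S n)) (x + 1) = Rpower (INR (S n)) x * (INR n + 1)).
    { rewrite Rpower_plus, Rpower_1, S_INR; auto. rewrite S_INR; lra. }
    rewrite RP. assert (E := prod_shift x (S n)).
    change (prod_f_R0 (fun k => x + INR k) (S n) * (x + INR (S (S n))) = x * prod_f_R0 (fun k => x + 1 + INR k)
      (S n)) in E.
    assert (P1 : prod_f_R0 (fun k => x + INR k) (S n) <> 0) by (apply prod_neq_0; auto).
    set (A := prod_f_R0 (fun k => x + INR k) (S n)) in *.
    set (B := prod_f_R0 (fun k => x + 1 + INR k) (S n)) in *.
    assert (EB : B = A * (x + INR (S (S n))) / x) by (rewrite E; field; auto).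
    assert (H2 := Hx (S (S n))). rewrite EB. rewrite !S_INR in *. field. repeat split; auto; lra.
  - apply is_lim_seq_mult'; auto.
    assert (L : is_lim_seq (fun n => x / (1 + (x + 1) / (INR n + 1))) (x / 1))
      by (apply is_lim_seq_div'; [apply is_lim_seq_const | apply lim_inv_nat | lra]).
    replace (x / 1) with x in L by field. exact L.
Qed.

Lemma ak_gauss x a : 0 < x -> ak x a -> 0 < a /\ is_lim_seq (gauss x) a.
Proof.
  intros H0.
  assert (G : forall n x a, INR n < x <= INR n + 1 -> ak x a -> 0 < a /\ is_lim_seq (gauss x) a).
  { induction n as [|n IH]; intros y b Hy Hb.
    - apply ak_gauss_1; auto. simpl in Hy; lra.
    - rewrite S_INR in Hy. assert (n0 := pos_INR n). destruct (ak_exists_S (y - 1)) as [[c Hc] Hs]; [lra|].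
      destruct (IH (y - 1) c) as [C0 C1]; auto; [lra|].
      assert (E : b = (y - 1) * c). { apply (ak_unique y); auto. replace y with (y - 1 + 1) at 1 by ring. auto.
      }
      rewrite E. split; [apply Rmult_lt_0_compat; lra|].
      replace y with (y - 1 + 1) at 1 by ring. apply gauss_up; auto. intro k; generalize (pos_INR k); lra. }
  destruct (nfloor_ex x) as [n Hn]; [lra|]. destruct (Req_dec x (INR n)) as [E|E]; [|apply (G n); lra].
  destruct n as [|n]; [simpl in E; lra|]. rewrite S_INR in *. apply (G n). lra.
Qed.

Lemma ak_Gamma x : 0 < x -> ak x (Gamma x).
Proof.
  intros H. destruct (ak_exists_S x H) as [[a Ha] _]. destruct (ak_gauss x a H Ha) as [_ L].
  rewrite (Gamma_of_gauss x a L). auto.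
Qed.

(** For x > 0 the limit is the number given by [ak]; [gauss_down] then moves one unit to the left at
    each step of the induction. *)
Lemma gauss_Gamma x : (forall k, x + INR k <> 0) -> is_lim_seq (gauss x) (Gamma x) /\ Gamma x <> 0.
Proof.
  assert (G : forall n x, 0 < x + INR n -> (forall k,
    x + INR k <> 0) -> is_lim_seq (gauss x) (Gamma x) /\ Gamma x <> 0).
  { induction n as [|n IH]; intros y H0 Hy.
    - simpl in H0. destruct (ak_exists_S y) as [[a Ha] _]; [lra|].
      destruct (ak_gauss y a ltac:(lra) Ha) as [a0 L].
      rewrite (Gamma_of_gauss y a L). split; auto. lra.
    - rewrite S_INR in H0. destruct (IH (y + 1)) as [L N]; [lra | intro k; generalize (Hy (S k));
        rewrite S_INR; lra|].
      apply gauss_down in L; auto. rewrite (Gamma_of_gauss _ _ L). split; auto.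
      assert (y <> 0) by (generalize (Hy O); simpl; lra).
      unfold Rdiv. apply Rmult_integral_contrapositive_currified; auto. apply Rinv_neq_0_compat; auto. }
  destruct (INR_unbounded (- x)) as [n Hn]. apply (G n). lra.
Qed.

Lemma Gamma_S x : (forall k, x + INR k <> 0) -> Gamma (x + 1) = x * Gamma x.
Proof. intros H. apply Gamma_of_gauss, gauss_up; auto. apply gauss_Gamma; auto. Qed.

Lemma Gamma_reflection nu : 0 < nu < 1 -> Gamma nu * Gamma (1 - nu) = PI / sin (PI * nu).
Proof.
  intros H. apply reflection; auto; apply gauss_Gamma; intro k; generalize (pos_INR k); lra.
Qed.

(** * Identification of the Bessel functions *)

Definition rGam (mu : R) : R := / Gamma (1 + mu).

Lemma Gamma_poch mu k : nonpole mu -> Gamma (mu + INR k + 1) = poch (1 + mu) k * Gamma (1 + mu).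
Proof.
  intros H. induction k as [|k IH]; simpl poch.
  - simpl INR. rewrite Rmult_1_l. f_equal. ring.
  - rewrite S_INR. replace (mu + (INR k + 1) + 1) with ((mu + INR k + 1) + 1) by ring.
    rewrite Gamma_S, IH; [ring|]. intro j. generalize (H (k + j)%nat). rewrite plus_INR. lra.
Qed.

Lemma rGam_neq_0 mu : nonpole mu -> Gamma (1 + mu) <> 0.
Proof. intros H. apply gauss_Gamma. intro k. generalize (H k). lra. Qed.

Lemma Cmod_half_cexp w : Cmod (cexp w / 2)%C = exp (fst w - ln 2).
Proof.
  rewrite Cmod_div, Cmod_cexp, Cmod_R, Rabs_pos_eq by (try lra; apply RtoC_neq_0; lra).
  unfold Rminus. rewrite exp_plus, exp_Ropp, exp_ln by lra. reflexivity.
Qed.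

Lemma Cpower_eq w mu : Cpower (cexp w / 2)%C (snd w) mu = (RtoC (exp (- (mu * ln 2))) * cexp (RtoC mu * w))%C.
Proof.
  unfold Cpower. rewrite Cmod_half_cexp. unfold Rpower. rewrite ln_exp.
  replace (mu * (fst w - ln 2)) with (- (mu * ln 2) + mu * fst w) by ring. rewrite exp_plus.
  unfold cexp. apply C_eq; simpl; repeat (rewrite Rmult_0_l || rewrite Rminus_0_r || rewrite Rplus_0_r); ring.
Qed.

Lemma cexp_pow w n : (cexp w ^ n)%C = cexp (RtoC (INR n) * w)%C.
Proof.
  induction n as [|n IH]; [simpl; rewrite Cmult_0_l, cexp_0; reflexivity|].
  rewrite Cpow_S, IH, S_INR, <- cexp_plus. f_equal. rewrite RtoC_plus. ring.
Qed.

Lemma BesselI_eq mu w : nonpole mu ->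
  BesselI mu (cexp w) (snd w) = (RtoC (exp (- (mu * ln 2)) * rGam mu) * phi mu w)%C.
Proof.
  intros H. unfold BesselI. rewrite Cpower_eq.
  assert (Hc := Fast_cf mu H). assert (G0 := rGam_neq_0 mu H).
  rewrite (CSeries_ext _ (fun k => RtoC (rGam mu) * (RtoC (cf mu k) * cexp (RtoC (0 + 2 * INR k) * w)))%C).
  - rewrite CSeries_scal by (apply (Phi_csum 0), Hc). fold (Phi 0 (cf mu) w).
    unfold phi. replace (Phi mu (cf mu) w) with (Phi (0 + mu) (cf mu) w) by (f_equal; ring).
    rewrite Phi_order by auto. rewrite RtoC_mult. ring.
  - intro k. rewrite Gamma_poch by auto. unfold rGam, cf.
    assert (P0 := poch_neq_0 mu k H). assert (F0 := INR_fact_neq_0 k).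
    assert (F4 : 4 ^ k <> 0) by (apply pow_nonzero; lra).
    unfold Cdiv at 2. rewrite Cpow_mult_l, Cpow_inv by (apply RtoC_neq_0; lra). rewrite cexp_pow, mult_INR.
    replace (INR 2) with 2 by (simpl; ring).
    replace (0 + 2 * INR k) with (2 * INR k) by ring.
    replace ((2 ^ (2 * k))%C) with (RtoC (4 ^ k)).
    2: { rewrite <- RtoC_pow. f_equal. rewrite pow_mult. f_equal. ring. }
    rewrite !RtoC_inv, !RtoC_mult; repeat apply Rmult_integral_contrapositive_currified; auto.
    unfold Cdiv. field. repeat split; apply RtoC_neq_0; auto.
Qed.

(** Two candidates for the derivative differ by at most (M + N) d for every small real increment d.
    This transfers a formula for a solution to its derivative component. *)
Lemma Hol_unique F F' G' : Hol F F' -> Hol F G' -> forall w, F' w = G' w.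
Proof.
  intros H1 H2 w. apply Ceq_minus, Cmod_eq_0, Rle_antisym; [|apply Cmod_ge_0].
  destruct (H1 (Cmod w + 1)) as [M [M0 HM]], (H2 (Cmod w + 1)) as [N [N0 HN]].
  apply le_epsilon. intros eps He.
  set (d := Rmin 1 (eps / (M + N + 1))).
  assert (d0 : 0 < d) by (apply Rmin_pos; [lra | apply Rdiv_lt_0_compat; lra]).
  assert (d1 : d <= 1) by apply Rmin_l.
  assert (d2 : (M + N) * d <= eps).
  { apply Rle_trans with ((M + N) * (eps / (M + N + 1))); [apply Rmult_le_compat_l; [lra | apply Rmin_r]|].
    apply Rmult_le_reg_r with (M + N + 1); [lra|]. field_simplify; [|lra]. nra. }
  assert (Wv : Cmod (w + d)%C <= Cmod w + 1) by (eapply Rle_trans; [apply Cmod_triangle|];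
    rewrite Cmod_R, Rabs_pos_eq; lra).
  assert (Ww : Cmod w <= Cmod w + 1) by lra.
  destruct (HM _ _ Wv Ww) as [_ [_ A]]. destruct (HN _ _ Wv Ww) as [_ [_ B]].
  replace (w + d - w)%C with (RtoC d) in A, B by ring.
  rewrite (Cmod_R d), (Rabs_pos_eq d) in A, B by lra.
  assert (E : Cmod ((F' w - G' w) * d)%C <= (M + N) * d ^ 2).
  { replace ((F' w - G' w) * d)%C with ((F (w + d) - F w - G' w * d) - (F (w + d) - F w - F' w * d))%C by ring.
    eapply Rle_trans; [apply Cmod_minus_le|]. lra. }
  rewrite Cmod_mult, Cmod_R, Rabs_pos_eq in E by lra.
  apply Rmult_le_reg_r with d; auto. nra.
Qed.

(** [KA] and [KB] are the coefficients of [phi nu] and [phi (- nu)] in (pi/2) (I_(-nu) - I_nu) / sin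
    (pi nu). *)
Definition KA nu := - (PI / 2) * exp (- (nu * ln 2)) * rGam nu / sin (PI * nu).
Definition KB nu := PI / 2 * exp (nu * ln 2) * rGam (- nu) / sin (PI * nu).

Lemma nonpole_frac n nu : INR n < nu < INR n + 1 -> nonpole (- nu).
Proof.
  intros H j E.
  assert (A : INR (j + 1) = nu) by (rewrite plus_INR; simpl; lra).
  destruct (le_lt_dec (j + 1) n) as [L|L]; apply le_INR in L; rewrite ?S_INR in L; lra.
Qed.

Lemma sin_nonint n nu : INR n < nu < INR n + 1 -> sin (PI * nu) <> 0.
Proof.
  revert nu. induction n as [|n IH]; intros nu H.
  - simpl in H. apply Rgt_not_eq, sin_PI_pos; lra.
  - rewrite S_INR in H. replace (PI * nu) with (PI * (nu - 1) + PI) by ring. rewrite neg_sin.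
    apply Ropp_neq_0_compat, IH. lra.
Qed.

(** For 0 < nu < 1 the leading behaviour at order nu determines only the coefficient of
    [phi (- nu)]; that of [phi nu] is read off from k_(1-nu). Both limits are values of Gamma, and
    the reflection formula brings in sin (pi nu). The other intervals follow by raising the order,
    under which [KA] and [KB] satisfy matching recurrences. *)
Lemma IsK_nonint n nu : INR n < nu < INR n + 1 ->
  exists U U', IsK nu U U' /\ forall w, U w = (RtoC (KA nu) * phi nu w + RtoC (KB nu) * phi (- nu) w)%C.
Proof.
  revert nu. induction n as [|n IH]; intros nu H.
  - simpl in H. assert (H' : 0 < nu < 1) by lra. clear H.
    destruct (IsK_frac nu H') as [a [b HK]].
    assert (N1 : nonpole nu) by (apply nonpole_pos; lra). assert (N2 := nonpole_neg nu H').
    assert (s0 := sin_PI_pos nu H'). assert (HP := PI_RGT_0).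
    assert (G1 : Gamma nu <> 0) by (apply gauss_Gamma; intro k; generalize (pos_INR k); lra).
    assert (G2 : Gamma (1 - nu) <> 0) by (apply gauss_Gamma; intro k; generalize (pos_INR k); lra).
    assert (GS : Gamma (1 + nu) = nu * Gamma nu).
    { rewrite Rplus_comm. apply Gamma_S. intro k; generalize (pos_INR k); lra. }
    assert (GR := Gamma_reflection nu H').
    assert (PE : PI = Gamma nu * Gamma (1 - nu) * sin (PI * nu)) by (rewrite GR; field; lra).
    destruct HK as [HS HR].
    assert (nuC : RtoC nu <> 0%C) by (apply RtoC_neq_0; lra).
    assert (Eb : b = RtoC (KB nu)).
    { assert (L := kw_leading nu a b H' (fun x => proj1 (HR x))).
      assert (E := clim_unique _ _ _ L (ak_Gamma nu ltac:(lra))).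
      assert (e0 : RtoC (2 * exp (- (nu * ln 2))) <> 0%C) by (apply RtoC_neq_0;
        generalize (exp_pos (- (nu * ln 2))); lra).
      transitivity (RtoC (Gamma nu) / RtoC (2 * exp (- (nu * ln 2))))%C; [rewrite <- E; field; auto|].
      rewrite <- RtoC_div by (generalize (exp_pos (- (nu * ln 2))); lra). f_equal.
      unfold KB, rGam. replace (1 + - nu) with (1 - nu) by ring. rewrite PE at 1. rewrite exp_Ropp.
      field. repeat split; auto; try lra. apply Rgt_not_eq, exp_pos. }
    (* Use k_(1-nu) = - (nu k_nu + k_nu') / t: the operator contributes the factor 2 nu on the
       leading term of [phi nu], and sends [phi (- nu)] to a multiple of [phi (- nu + 1)], which
       disappears in the limit. *)
    assert (Ea : a = RtoC (KA nu)).
    { assert (L : clim (fun x => RtoC (2 * exp ((1 - nu) * (x - ln 2)) * kw (1 - nu) x))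
        (RtoC (- (2 * exp (- ((1 - nu) * ln 2)))) * (a * (RtoC nu * 1 + RtoC nu) + b * (RtoC (/ (2 * (1 - nu)))
          * (0 * 1))))%C).
      { assert (N3 : nonpole (- nu + 1)) by (apply nonpole_S, N2).
        assert (N4 : 0 < 2 * (1 - nu)) by lra.
        eapply clim_ext; [|apply clim_scal; apply clim_plus; [apply clim_scal, clim_plus;
          [apply clim_scal, (phi_clim nu N1) | apply (dphi_clim nu N1)] |
          apply clim_scal, clim_scal, clim_mult; [apply (clim_exp (2 * (1 - nu)) N4) | apply (phi_clim (- nu +
            1) N3)]]].
        intro x. cbv beta. destruct (HR x) as [E E'].
        set (r0 := RtoC (/ (2 * (1 - nu)))).
        assert (KD := dkw_down nu x). replace (kw (nu - 1) x) with (kw (1 - nu) x) in KD by (rewrite <- kw_neg;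
          f_equal; ring).
        assert (KE : kw (1 - nu) x = - exp (- x) * (nu * kw nu x + dkw nu x)).
        { rewrite KD, exp_Ropp. field. apply Rgt_not_eq, exp_pos. }
        assert (T := phi_rec_up (- nu) x N2). unfold Tu in T.
        replace (2 * exp ((1 - nu) * (x - ln 2)) * kw (1 - nu) x) with (- (2 * exp (- ((1 - nu) * ln 2))) *
          (exp (- (nu * x)) * (nu * kw nu x + dkw nu x))).
        2: { rewrite KE. replace ((1 - nu) * (x - ln 2)) with (- ((1 - nu) * ln 2) + x + - (nu * x)) by ring.
             rewrite !exp_plus, (exp_Ropp x). field. apply Rgt_not_eq, exp_pos. }
        rewrite (RtoC_mult (- (2 * exp (- ((1 - nu) * ln 2))))), (RtoC_mult (exp (- (nu * x)))),
          (RtoC_plus (nu * kw nu x)), (RtoC_mult nu (kw nu x)), <- E, <- E'.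
        f_equal.
        replace (- RtoC nu * x)%C with (- RtoC (nu * x))%C by (rewrite RtoC_mult; ring).
        replace (- RtoC (- nu + 1) * x)%C with (- RtoC x + RtoC (nu * x))%C by (rewrite RtoC_plus, RtoC_opp,
          RtoC_mult; ring).
        rewrite exp_Ropp, RtoC_inv by apply Rgt_not_eq, exp_pos.
        replace (exp (2 * (1 - nu) * x)) with (exp x * exp x * / (exp (nu * x) * exp (nu * x))).
        2: { rewrite <- !exp_plus, <- exp_Ropp, <- exp_plus. f_equal. ring. }
        assert (p1 := exp_pos x). assert (p2 := exp_pos (nu * x)).
        rewrite (RtoC_mult (exp x * exp x)), RtoC_inv, !(RtoC_mult (exp x)), !(RtoC_mult (exp (nu * x))) by nra.
        rewrite cexp_plus, !cexp_opp, !cexp_R. rewrite cexp_opp, cexp_R in T.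
        replace (1 + - nu) with (1 - nu) in T by ring.
        assert (c1 : RtoC (exp x) <> 0%C) by (apply RtoC_neq_0; lra).
        assert (c2 : RtoC (exp (nu * x)) <> 0%C) by (apply RtoC_neq_0; lra).
        assert (T' : (RtoC (- / (2 * (1 - nu))) * phi (- nu + 1) x = - (/ RtoC (exp x) * (RtoC nu * phi (- nu)
          x + dphi (- nu) x)))%C).
        { rewrite <- T, RtoC_opp. ring. }
        transitivity (/ RtoC (exp (nu * x)) * (a * (RtoC nu * phi nu x + dphi nu x)) - b * (RtoC (exp x) * /
          RtoC (exp (nu * x))) * (RtoC (- / (2 * (1 - nu))) * phi (- nu + 1) x))%C.
        - rewrite RtoC_opp. fold r0. field. auto.
        - rewrite T'. field. auto. }
      assert (E := clim_unique _ _ _ L (ak_Gamma (1 - nu) ltac:(lra))).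
      replace (a * (RtoC nu * 1 + RtoC nu) + b * (RtoC (/ (2 * (1 - nu))) * (0 * 1)))%C with (a * RtoC (2 *
        nu))%C in E by (rewrite RtoC_mult; ring).
      assert (p := exp_pos (- ((1 - nu) * ln 2))).
      transitivity (RtoC (Gamma (1 - nu)) / RtoC (- (2 * exp (- ((1 - nu) * ln 2))) * (2 * nu)))%C.
      { rewrite <- E, (RtoC_mult (- (2 * exp (- ((1 - nu) * ln 2))))). field. split; apply RtoC_neq_0; lra. }
      rewrite <- RtoC_div by nra. f_equal. unfold KA, rGam. rewrite GS. rewrite PE at 1.
      replace (- ((1 - nu) * ln 2)) with (- ln 2 + nu * ln 2) by ring.
      rewrite exp_plus, !exp_Ropp, exp_ln by lra.
      field. repeat split; auto; try lra. apply Rgt_not_eq, exp_pos. }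
    exists (fun w => a * phi nu w + b * phi (- nu) w)%C, (fun w => a * dphi nu w + b * dphi (- nu) w)%C.
    split; [split; auto|]. intro w. rewrite Ea, Eb. reflexivity.
  - rewrite S_INR in H. destruct (IH (nu - 1)) as [U [U' [HK HU]]]; [lra|].
    set (mu := nu - 1) in *. assert (Enu : nu = mu + 1) by (unfold mu; ring). assert (n0 := pos_INR n).
    assert (mu0 : 0 < mu) by (unfold mu; lra).
    assert (N1 : nonpole mu) by (apply nonpole_pos; lra).
    assert (N2 : nonpole (- mu)) by (apply (nonpole_frac n); unfold mu; lra).
    assert (N3 : nonpole (- mu - 1)) by (replace (- mu - 1) with (- nu) by (unfold mu; ring);
      apply (nonpole_frac (S n)); rewrite S_INR; lra).
    assert (s0 : sin (PI * mu) <> 0) by (apply (sin_nonint n); unfold mu; lra).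
    exists (Tu mu U U'), (dTu mu U U'). rewrite Enu. split; [now apply IsK_T|]. intro w.
    assert (HU' : U' w = (RtoC (KA mu) * dphi mu w + RtoC (KB mu) * dphi (- mu) w)%C).
    { destruct HK as [[H1 _] _].
      refine (Hol_unique U U' (fun w => RtoC (KA mu) * dphi mu w + RtoC (KB mu) * dphi (- mu) w)%C H1 _ w).
      apply (Hol_ext (fun w => RtoC (KA mu) * phi mu w + RtoC (KB mu) * phi (- mu) w)%C (fun w => RtoC (KA mu)
        * dphi mu w + RtoC (KB mu) * dphi (- mu) w)%C).
      - intro; symmetry; apply HU.
      - reflexivity.
      - exact (Hol_plus _ _ _ _ (Hol_scal _ _ _ (proj1 (Sol_phi mu N1))) (Hol_scal _ _ _ (proj1 (Sol_phi (- mu)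
          N2)))). }
    assert (R1 := phi_rec_up mu w N1). assert (R2 := phi_rec_down (- mu) w N3). unfold Tu in *.
    rewrite HU, HU'.
    transitivity (RtoC (KA mu) * (cexp (- w) * (RtoC mu * phi mu w - dphi mu w)) - RtoC (KB mu) * (cexp (- w) *
      (RtoC (- mu) * phi (- mu) w + dphi (- mu) w)))%C.
    { rewrite RtoC_opp. ring. }
    rewrite R1, R2. replace (- (mu + 1)) with (- mu - 1) by ring.
    assert (EA : KA (mu + 1) = KA mu * (- / (2 * (1 + mu)))).
    { unfold KA, rGam. replace (PI * (mu + 1)) with (PI * mu + PI) by ring. rewrite neg_sin.
      replace (1 + (mu + 1)) with (1 + mu + 1) by ring.
      rewrite Gamma_S by (intro k; generalize (pos_INR k); lra).
      replace (- ((mu + 1) * ln 2)) with (- (mu * ln 2) + - ln 2) by ring.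
      rewrite exp_plus, (exp_Ropp (ln 2)), exp_ln by lra.
      field. repeat split; auto; try lra. apply rGam_neq_0; auto. }
    assert (EB : KB (mu + 1) = - (KB mu * (2 * - mu))).
    { unfold KB, rGam. replace (PI * (mu + 1)) with (PI * mu + PI) by ring. rewrite neg_sin.
      replace (1 + - (mu + 1)) with (- mu) by ring.
      assert (P : forall k, - mu + INR k <> 0) by (intro k; generalize (N3 k); lra).
      replace (1 + - mu) with (- mu + 1) by ring. rewrite (Gamma_S (- mu)) by auto.
      replace ((mu + 1) * ln 2) with (mu * ln 2 + ln 2) by ring. rewrite exp_plus, exp_ln by lra.
      field. repeat split; auto; try lra. apply gauss_Gamma; auto. }
    rewrite EA, EB, (RtoC_opp (KB mu * (2 * - mu))), (RtoC_mult (KA mu)), (RtoC_mult (KB mu)). ring.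
Qed.

Lemma BesselK_nonint_eq n nu w : INR n < nu < INR n + 1 ->
  BesselK_nonint nu (cexp w) (snd w) = (RtoC (KA nu) * phi nu w + RtoC (KB nu) * phi (- nu) w)%C.
Proof.
  intros H. unfold BesselK_nonint. assert (n0 := pos_INR n). assert (s0 := sin_nonint n nu H).
  rewrite (BesselI_eq nu) by (apply nonpole_pos; lra). rewrite BesselI_eq by (apply (nonpole_frac n); lra).
  unfold KA, KB. unfold Rdiv. rewrite !RtoC_mult, !RtoC_inv, RtoC_opp, !RtoC_mult, RtoC_inv by (auto; lra).
  replace (- (- nu * ln 2)) with (nu * ln 2) by ring. field. apply RtoC_neq_0; auto.
Qed.

Definition BI nu (w : C) : C := (RtoC (exp (- (nu * ln 2)) * rGam nu) * phi nu w)%C.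
Definition dBI nu (w : C) : C := (RtoC (exp (- (nu * ln 2)) * rGam nu) * dphi nu w)%C.

Lemma Sol_BI nu : 0 <= nu -> Sol nu (BI nu) (dBI nu).
Proof.
  intros H. destruct (Sol_phi nu (nonpole_pos nu H)) as [A B]. split.
  - apply Hol_scal, A.
  - eapply Hol_ext_r; [|apply Hol_scal, B]. intro w. unfold BI. ring.
Qed.

(** Eliminating k_nu' by [dkw_up], the Wronskian on the real axis is k_nu (I' - nu I) + t k_(nu+1)
    I. At t = 0 the first term vanishes, and the second tends to Gamma (nu + 1) / Gamma (nu + 1).
    Only [ak] enters, so integral orders are included. *)
Lemma Wr_K_I nu U U' w : 0 < nu -> IsK nu U U' -> Wr U U' (BI nu) (dBI nu) w = 1%C.
Proof.
  intros H0 [HS HR]. apply (Wr_of_clim nu); auto; [apply Sol_BI; lra|].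
  assert (N1 : nonpole nu) by (apply nonpole_pos; lra). assert (Hc := Fast_cf nu N1).
  assert (A1 := ak_Gamma nu H0). assert (A2 := ak_Gamma (nu + 1) ltac:(lra)).
  assert (GS : Gamma (1 + nu) = Gamma (nu + 1)) by (f_equal; ring).
  assert (L : clim (fun x => Wr U U' (BI nu) (dBI nu) (RtoC x))
    (RtoC (rGam nu) * (RtoC (/ 2) * RtoC (Gamma nu) * (RtoC nu * 0)  + RtoC (Gamma (nu + 1)) * 1))%C).
  2: { replace (RtoC 1) with (RtoC (rGam nu) * (RtoC (/ 2) * RtoC (Gamma nu) * (RtoC nu * 0)  + RtoC (Gamma (nu
         + 1)) * 1))%C; auto.
       unfold rGam. rewrite GS, RtoC_inv by (rewrite <- GS; apply rGam_neq_0; auto). field. apply RtoC_neq_0.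
       rewrite <- GS. apply rGam_neq_0; auto. }
  assert (Z : clim (fun x => cexp (- RtoC nu * RtoC x) * (dphi nu (RtoC x) - RtoC nu * phi nu (RtoC x)))%C
    (RtoC nu * 0)%C).
  { replace (RtoC nu * 0)%C with (RtoC nu - RtoC nu * 1)%C by ring.
    eapply clim_ext; [|apply clim_minus; [apply (dphi_clim nu N1) | apply clim_scal, (phi_clim nu N1)]].
    intro x. cbv beta. ring. }
  eapply clim_ext; [|apply clim_scal, clim_plus; [apply clim_mult;
    [apply clim_scal, A1 | apply Z] | apply clim_mult; [apply A2 | apply (phi_clim nu N1)]]].
  intro x. cbv beta. destruct (HR x) as [E E']. unfold Wr, BI, dBI. rewrite E, E', (dkw_up nu).
  replace (- RtoC nu * x)%C with (- RtoC (nu * x))%C by (rewrite RtoC_mult; ring). rewrite cexp_opp, cexp_R.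
  replace (nu * (x - ln 2)) with (- (nu * ln 2) + nu * x) by ring.
  replace ((nu + 1) * (x - ln 2)) with (- (nu * ln 2) + nu * x + (x + - ln 2)) by ring.
  rewrite !exp_plus, (exp_Ropp (ln 2)), exp_ln by lra.
  assert (p1 := exp_pos (nu * x)).
  replace (2 * (exp (- (nu * ln 2)) * exp (nu * x) * (exp x * / 2)) * kw (nu + 1) x) with ((exp (- (nu * ln 2))
    * exp (nu * x) * exp x) * kw (nu + 1) x) by field.
  rewrite RtoC_minus, !RtoC_mult, RtoC_inv by lra. field. apply RtoC_neq_0; lra.
Qed.

(** * Estimates in a sector *)

Lemma kw_bound nu : exists B, 0 <= B /\ forall x, 0 <= x -> kw nu x <= B * exp (- exp x).
Proof.
  exists (exp 1 * kt nu 1). split.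
  { apply Rmult_le_pos; [apply Rlt_le, exp_pos | apply kt_pos; lra]. }
  intros x Hx. unfold kw. assert (H := exp_ge_1 x Hx).
  eapply Rle_trans; [apply (kt_decay nu 1); lra|].
  replace (- (exp x - 1)) with (1 + - exp x) by ring. rewrite exp_plus. right; ring.
Qed.

Lemma dkw_bound nu : exists B, 0 <= B /\ forall x, 0 <= x -> Rabs (dkw nu x) <= B * (exp x * exp (- exp x)).
Proof.
  destruct (kw_bound (nu + 1)) as [B1 [P1 H1]], (kw_bound (nu - 1)) as [B2 [P2 H2]].
  exists (B1 + B2). split; [lra|]. intros x Hx. specialize (H1 x Hx). specialize (H2 x Hx).
  unfold dkw. fold (kw (nu + 1) x) (kw (nu - 1) x).
  generalize (kw_pos (nu + 1) x) (kw_pos (nu - 1) x) (exp_pos x) (exp_pos (- exp x)); intros.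
  rewrite Rabs_left1 by nra.
  apply Rle_trans with (exp x * (kw (nu + 1) x + kw (nu - 1) x)); [nra|].
  replace ((B1 + B2) * (exp x * exp (- exp x))) with (exp x * (B1 * exp (- exp x) + B2 * exp (- exp x))) by
    ring.
  apply Rmult_le_compat_l; lra.
Qed.

(** [kt_decay] from 1 to e^x / 2, available since x >= 1, turns the factor k_M(e^x / 2) of [kt_diff]
    into e^(-e^x / 2) and restores the full decay e^(-e^x). The additional e^(-x) pays for the
    factor e^x in [dkw]. *)
Lemma kw_lip M : exists B, 0 <= B /\ forall mu nu x, Rabs mu <= M -> Rabs nu <= M -> 1 <= x ->
  Rabs (kw mu x - kw nu x) <= Rabs (mu - nu) * (B * (exp (- x) * exp (- exp x))).
Proof.
  exists (Rabs M * 4 * (exp 1 * kt M 1)). split.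
  { repeat apply Rmult_le_pos; try apply Rabs_pos; try lra; [apply Rlt_le, exp_pos | apply kt_pos; lra]. }
  intros mu nu x H1 H2 Hx. assert (0 <= M) by (generalize (Rabs_pos mu); lra).
  rewrite (Rabs_pos_eq M) by auto.
  assert (E2 : 2 <= exp x) by (generalize (exp_ineq1_le x); lra).
  eapply Rle_trans; [apply (kt_diff mu nu M (exp x)); auto; lra|].
  apply Rmult_le_compat_l; [apply Rabs_pos|]. rewrite (exp_Ropp x).
  replace (M * 4 * (exp 1 * kt M 1) * (/ exp x * exp (- exp x))) with (M * (4 / exp x) * (exp (- (exp x / 2)) *
    (exp (- (exp x / 2 - 1)) * kt M 1))).
  - apply Rmult_le_compat_l.
    + repeat apply Rmult_le_pos; try lra. apply Rlt_le, Rinv_0_lt_compat; lra.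
    + apply Rmult_le_compat_l; [apply Rlt_le, exp_pos|]. apply kt_decay; lra.
  - replace (exp (- exp x)) with (exp (- (exp x / 2)) * exp (- (exp x / 2))) by (rewrite <- exp_plus; f_equal;
      field).
    replace (exp (- (exp x / 2 - 1))) with (exp (- (exp x / 2)) * exp 1) by (rewrite <- exp_plus; f_equal;
      ring).
    field. lra.
Qed.

Lemma dkw_lip M : exists B, 0 <= B /\ forall mu nu x, Rabs mu <= M -> Rabs nu <= M -> 1 <= x ->
  Rabs (dkw mu x - dkw nu x) <= Rabs (mu - nu) * (B * exp (- exp x)).
Proof.
  destruct (kw_lip (M + 1)) as [B [B0 H]]. exists B. split; auto. intros mu nu x H1 H2 Hx.
  assert (p := exp_pos x). set (b := B * (exp (- x) * exp (- exp x))) in *.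
  assert (A1 : Rabs (kw (mu + 1) x - kw (nu + 1) x) <= Rabs (mu - nu) * b).
  { replace (mu - nu) with (mu + 1 - (nu + 1)) by ring.
    apply H; auto; (eapply Rle_trans; [apply Rabs_triang|]); rewrite Rabs_R1; lra. }
  assert (A2 : Rabs (kw (mu - 1) x - kw (nu - 1) x) <= Rabs (mu - nu) * b).
  { replace (mu - nu) with (mu - 1 - (nu - 1)) by ring.
    apply H; auto; (eapply Rle_trans; [apply Rabs_triang|]); rewrite Rabs_Ropp, Rabs_R1; lra. }
  unfold dkw. fold (kw (mu + 1) x) (kw (mu - 1) x) (kw (nu + 1) x) (kw (nu - 1) x).
  replace (- (exp x / 2) * (kw (mu + 1) x + kw (mu - 1) x) - - (exp x / 2) * (kw (nu + 1) x + kw (nu - 1) x))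
    with (- (exp x / 2) * ((kw (mu + 1) x - kw (nu + 1) x) + (kw (mu - 1) x - kw (nu - 1) x))) by ring.
  rewrite Rabs_mult, Rabs_Ropp, Rabs_pos_eq by lra.
  apply Rle_trans with (exp x / 2 * (Rabs (mu - nu) * b + Rabs (mu - nu) * b)).
  - apply Rmult_le_compat_l; [lra|]. eapply Rle_trans; [apply Rabs_triang|]. lra.
  - right. unfold b. rewrite (exp_Ropp x). field. lra.
Qed.

(** The maximum m of f exists by continuity and satisfies m <= A + m/2. *)
Lemma bootstrap (f : R -> R) T A : 0 <= T -> (forall s, 0 <= s <= T -> continuity_pt f s) ->
  (forall N, (forall s, 0 <= s <= T -> f s <= N) -> forall s, 0 <= s <= T -> f s <= A + N / 2) ->
  forall s, 0 <= s <= T -> f s <= 2 * A.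
Proof.
  intros HT Hc H s Hs. destruct (continuity_ab_maj f 0 T HT Hc) as [m [Hm Hm']].
  assert (H1 := H (f m) Hm m Hm'). specialize (Hm s Hs). lra.
Qed.

Lemma continuity_Cmod_line F F' w k s : Hol F F' -> continuity_pt (fun s => Cmod (F (w + RtoC s * k)%C)) s.
Proof.
  intros H. destruct (cder_Hol_line F F' w k s H) as [H1 H2].
  apply continuity_pt_filterlim.
  change (continuous (fun s => sqrt (fst (F (w + RtoC s * k)%C) ^ 2 + snd (F (w + RtoC s * k)%C) ^ 2)) s).
  assert (C1 := cont_of_derive _ _ _ H1). assert (C2 := cont_of_derive _ _ _ H2).
  apply (continuous_comp _ sqrt); [|apply continuous_sqrt].
  apply (continuous_plus (V := R_NormedModule)).
  - apply (continuous_comp _ (fun y => y ^ 2)); auto.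
    apply (ex_derive_continuous (V := R_NormedModule)); auto_derive; auto.
  - apply (continuous_comp _ (fun y => y ^ 2)); auto.
    apply (ex_derive_continuous (V := R_NormedModule)); auto_derive; auto.
Qed.

(* Liouville-Green variables for [u'' = (nu^2 + e^{2w}) u]: with [t = e^w],
   [Xs s] is (up to sign) the coefficient of the solution growing like [e^{-s t} / sqrt t]. *)
Definition Xs (u u' : C -> C) (s : R) (w : C) : C :=
  (cexp (RtoC s * cexp w) * cexp (- (RtoC (/ 2) * w)) * (u' w + (RtoC (/ 2) - RtoC s * cexp w) * u w))%C.
Definition Ys (u u' : C -> C) (s : R) (w : C) : C :=
  (cexp (- (RtoC s * cexp w)) * cexp (- (RtoC (/ 2) * w)) * (u' w + (RtoC (/ 2) - RtoC s * cexp w) * u w))%C.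
(** u stripped of the factor e^(s t) / sqrt t. By [hs_eq] it is a combination of [Xs u u' (- s)] and
    [Ys u u' s] in which u' cancels. *)
Definition hs (u : C -> C) (s : R) (w : C) : C := (cexp (- (RtoC s * cexp w)) * cexp (RtoC (/ 2) * w) * u w)%C.

Lemma Hol_cexp_comp F F' : Hol F F' -> Hol (fun w => cexp (F w)) (fun w => cexp (F w) * F' w)%C.
Proof. intros H. exact (Hol_comp _ _ _ _ Hol_cexp H). Qed.

Lemma Hol_opp F F' : Hol F F' -> Hol (fun w => - F w)%C (fun w => - F' w)%C.
Proof. intros H. eapply Hol_ext; [| |apply (Hol_scal (- (1))%C _ _ H)]; intro; simpl; ring. Qed.

Lemma Hol_ex F F' G G' : Hol F F' -> (forall w, F w = G w) -> (forall w, F' w = G' w) -> Hol G G'.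
Proof. intros; eapply Hol_ext; eauto. Qed.

(** Because s^2 = 1 the terms with t^2 u and t u cancel, and so does u'; only the perturbation nu^2
    - 1/4 remains. *)
Lemma Hol_Xs nu u u' s : Sol nu u u' -> s * s = 1 ->
  Hol (Xs u u' s) (fun w => RtoC (nu ^ 2 - / 4) * (cexp (RtoC s * cexp w) * cexp (- (RtoC (/ 2) * w)) * u w))%C.
Proof.
  intros [H1 H2] Hs.
  assert (E1 := Hol_cexp_comp _ _ (Hol_scal (RtoC s) _ _ Hol_cexp)).
  assert (E2 := Hol_cexp_comp _ _ (Hol_opp _ _ (Hol_scal (RtoC (/ 2)) _ _ Hol_id))).
  assert (E3 := Hol_plus _ _ _ _ H2 (Hol_mult _ _ _ _ (Hol_minus _ _ _ _ (Hol_const (RtoC (/ 2))) (Hol_scal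
    (RtoC s) _ _ Hol_cexp)) H1)).
  refine (Hol_ex _ _ _ _ (Hol_mult _ _ _ _ (Hol_mult _ _ _ _ E1 E2) E3) _ _).
  - intro w. reflexivity.
  - intro w. cbv beta. rewrite cexp_2.
    assert (S : (RtoC s * RtoC s = 1)%C) by (rewrite <- RtoC_mult, Hs; reflexivity).
    assert (Q : (RtoC (/ 2) * RtoC (/ 2) = RtoC (/ 4))%C) by (rewrite <- RtoC_mult; f_equal; field).
    assert (D : (RtoC (/ 2) + RtoC (/ 2) = 1)%C) by (rewrite <- RtoC_plus; f_equal; field).
    rewrite RtoC_minus.
    set (e := cexp w). set (a := cexp (RtoC s * e)). set (b := cexp (- (RtoC (/ 2) * w))).
    set (h := RtoC (/ 2)) in *. set (q := RtoC (/ 4)) in *. set (si := RtoC s) in *. set (N := RtoC (nu ^ 2)).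
    transitivity (a * b * ((N + e * e) * u w - (h * h) * u w - (si * si) * (e * e) * u w + (h + h) * (si * e *
      u w) - si * e * u w))%C; [ring|].
    rewrite S, Q, D. ring.
Qed.

Lemma hs_eq u u' s w : s * s = 1 -> (RtoC (2 * s) * hs u s w = Xs u u' (- s) w - Ys u u' s w)%C.
Proof.
  intros Hs. unfold hs, Xs, Ys. rewrite RtoC_opp.
  replace (- RtoC s * cexp w)%C with (- (RtoC s * cexp w))%C by ring.
  replace (cexp (RtoC (/ 2) * w)) with (cexp (- (RtoC (/ 2) * w)) * cexp w)%C.
  - rewrite RtoC_mult. ring.
  - rewrite <- cexp_plus. f_equal. replace w with (RtoC 1 * w)%C at 2 by ring.
    replace 1 with (/ 2 + / 2) by field. rewrite RtoC_plus. ring.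
Qed.

Lemma Ys_Xs u u' s w : Ys u u' s w = (cexp (- (RtoC (2 * s) * cexp w)) * Xs u u' s w)%C.
Proof.
  unfold Ys, Xs.
  replace (- (RtoC s * cexp w))%C with (- (RtoC (2 * s) * cexp w) + RtoC s * cexp w)%C by (rewrite RtoC_mult;
    ring).
  rewrite cexp_plus. ring.
Qed.

Lemma Cmod_cexp_RtoC s w : Cmod (cexp (RtoC s * cexp w)%C) = exp (s * fst (cexp w)).
Proof. rewrite Cmod_cexp. f_equal. simpl. ring. Qed.

(** Where Re (s t) does not decrease, e^(s t) is the dominant exponential. Then [Xs u u' (- s)]
    varies by at most sup |hs| times the total perturbation, which is at most 1/2, and [Ys] obeys a
    similar bound because e^(-2 s t) damps earlier contributions. Hence |hs| <= M0/2 + sup |hs| / 2,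
    and [bootstrap] applies. *)
Lemma stable nu u u' s w0 k T (b b' : R -> R) : Sol nu u u' -> s * s = 1 -> Cmod k = 1 -> 0 <= T ->
  (forall x y, 0 <= x <= y -> y <= T -> s * fst (cexp (w0 + RtoC x * k)%C) <= s * fst (cexp (w0 + RtoC y *
    k)%C)) ->
  (forall x, 0 <= x <= T -> is_derive b x (b' x)) ->
  (forall x, 0 <= x <= T -> Rabs (nu ^ 2 - / 4) * exp (- fst (w0 + RtoC x * k)%C) <= b' x) ->
  (forall x, 0 <= x <= T -> b x - b 0 <= / 2) ->
  let M0 := Cmod (Xs u u' (- s) w0) + Cmod (Ys u u' s w0) in
  forall x, 0 <= x <= T -> Cmod (hs u s (w0 + RtoC x * k)%C) <= M0 /\ Cmod (Ys u u' s (w0 + RtoC x * k)%C) <= 2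
    * M0.
Proof.
  intros HS Hs Hk HT Hmono Hb Hb' Hb2 M0.
  set (W := fun x : R => (w0 + RtoC x * k)%C).
  assert (Hs' : - s * - s = 1) by lra.
  assert (As : Rabs s = 1) by (rewrite <- (Rabs_pos_eq 1) by lra; apply Rsqr_eq_abs_0; unfold Rsqr; lra).
  assert (W0 : W 0 = w0) by (unfold W; ring).
  assert (F1 : forall N x, (forall y, 0 <= y <= T -> Cmod (hs u s (W y)) <= N) -> 0 <= x <= T ->
     Cmod (Xs u u' (- s) (W x) - Xs u u' (- s) w0)%C <= N * / 2).
  { intros N x HN Hx.
    assert (N0 : 0 <= N) by (eapply Rle_trans; [apply Cmod_ge_0 | apply (HN x Hx)]).
    rewrite <- W0. apply Rle_trans with (N * b x - N * b 0).
    2: { rewrite <- Rmult_minus_distr_l. apply Rmult_le_compat_l; auto. }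
    apply (curve_mvt (fun y => Xs u u' (- s) (W y)) (fun y => RtoC (nu ^ 2 - / 4) * (cexp (RtoC (- s) * cexp (W
      y)) * cexp (- (RtoC (/ 2) * W y)) * u (W y)) * k)%C
      (fun y => N * b y) (fun y => N * b' y)); [lra | | |].
    - intros y Hy. apply (cder_Hol_line _ _ w0 k y (Hol_Xs nu u u' (- s) HS Hs')).
    - intros y Hy. apply is_derive_scal, Hb; lra.
    - intros y Hy. rewrite !Cmod_mult, Hk, Rmult_1_r, Cmod_R.
      assert (E : Cmod (cexp (RtoC (- s) * cexp (W y))) * Cmod (cexp (- (RtoC (/ 2) * W y))) * Cmod (u (W y)) =
        exp (- fst (W y)) * Cmod (hs u s (W y))).
      { unfold hs. rewrite !Cmod_mult. rewrite <- !Rmult_assoc. f_equal.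
        replace (- (RtoC s * cexp (W y)))%C with (RtoC (- s) * cexp (W y))%C by (rewrite RtoC_opp; ring).
        rewrite (Rmult_comm (exp _)), Rmult_assoc. f_equal. rewrite !Cmod_cexp, <- exp_plus. f_equal. simpl.
        field. }
      rewrite E. rewrite <- Rmult_assoc, Rmult_comm.
      apply Rmult_le_compat; auto using Cmod_ge_0; try (apply HN; lra); try (apply Hb'; lra).
      apply Rmult_le_pos; [apply Rabs_pos | apply Rlt_le, exp_pos]. }
  assert (F2 : forall N x, (forall y, 0 <= y <= T -> Cmod (hs u s (W y)) <= N) -> 0 <= x <= T ->
     Cmod (Ys u u' s (W x)) <= Cmod (Ys u u' s w0) + N * / 2).
  { intros N x HN Hx.
    assert (N0 : 0 <= N) by (eapply Rle_trans; [apply Cmod_ge_0 | apply (HN x Hx)]).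
    (* The damping factor is frozen at the end point x, so that what remains is the increment of a
       curve in y and [curve_mvt] applies. *)
    set (K := cexp (- (RtoC (2 * s) * cexp (W x)))).
    assert (HK : forall y, 0 <= y <= x -> Cmod K <= exp (- (2 * s) * fst (cexp (W y)))).
    { intros y Hy. unfold K. replace (- (RtoC (2 * s) * cexp (W x)))%C with (RtoC (- (2 * s)) * cexp (W x))%C
        by (rewrite RtoC_opp; ring).
      rewrite Cmod_cexp_RtoC. apply exp_le. assert (H := Hmono y x ltac:(lra) ltac:(lra)). unfold W. lra. }
    rewrite Ys_Xs. fold K.
    replace (K * Xs u u' s (W x))%C with (K * Xs u u' s w0 + K * (Xs u u' s (W x) - Xs u u' s w0))%C by ring.
    eapply Rle_trans; [apply Cmod_triangle|]. apply Rplus_le_compat.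
    - rewrite Ys_Xs, !Cmod_mult. apply Rmult_le_compat_r; [apply Cmod_ge_0|].
      assert (H := HK 0 ltac:(lra)). rewrite W0 in H. eapply Rle_trans; [exact H|].
      right. rewrite <- Cmod_cexp_RtoC. f_equal. f_equal. rewrite RtoC_opp. ring.
    - apply Rle_trans with (N * b x - N * b 0).
      2: { rewrite <- Rmult_minus_distr_l. apply Rmult_le_compat_l; auto. }
      replace (K * (Xs u u' s (W x) - Xs u u' s w0))%C with (K * Xs u u' s (W x) - K * Xs u u' s (W 0))%C by
        (rewrite W0; ring).
      apply (curve_mvt (fun y => K * Xs u u' s (W y))%C (fun y => K * (RtoC (nu ^ 2 - / 4) * (cexp (RtoC s *
        cexp (W y)) * cexp (- (RtoC (/ 2) * W y)) * u (W y)) * k))%C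
        (fun y => N * b y) (fun y => N * b' y)); [lra | | |].
      + intros y Hy. eapply cder_eq; [apply cder_mult;
          [apply cder_const | apply (cder_Hol_line _ _ w0 k y (Hol_Xs nu u u' s HS Hs))]|].
        cbv beta. unfold W. ring.
      + intros y Hy. apply is_derive_scal, Hb; lra.
      + intros y Hy. rewrite !Cmod_mult, Hk, Rmult_1_r, Cmod_R.
        assert (E : Cmod (cexp (RtoC s * cexp (W y))) * Cmod (cexp (- (RtoC (/ 2) * W y))) * Cmod (u (W y)) =
          exp (2 * s * fst (cexp (W y))) * exp (- fst (W y)) * Cmod (hs u s (W y))).
        { unfold hs. rewrite !Cmod_mult. rewrite <- !Rmult_assoc. f_equal.
          replace (- (RtoC s * cexp (W y)))%C with (RtoC (- s) * cexp (W y))%C by (rewrite RtoC_opp; ring).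
          rewrite !Cmod_cexp_RtoC, !Cmod_cexp, <- !exp_plus. f_equal. simpl. field. }
        rewrite E.
        assert (HKy := HK y Hy).
        assert (HKE : Cmod K * exp (2 * s * fst (cexp (W y))) <= 1).
        { replace 1 with (exp (- (2 * s) * fst (cexp (W y))) * exp (2 * s * fst (cexp (W y)))).
          - apply Rmult_le_compat_r; auto. apply Rlt_le, exp_pos.
          - rewrite <- exp_plus, <- exp_0. f_equal. ring. }
        replace (Cmod K * (Rabs (nu ^ 2 - / 4) * (exp (2 * s * fst (cexp (W y))) * exp (- fst (W y)) * Cmod (hs
          u s (W y))))) with
          ((Cmod K * exp (2 * s * fst (cexp (W y)))) * (Cmod (hs u s (W y)) * (Rabs (nu ^ 2 - / 4) * exp (- fst
            (W y))))) by ring.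
        apply Rle_trans with (1 * (N * b' y)); [|lra].
        assert (P : 0 <= Rabs (nu ^ 2 - / 4) * exp (- fst (W y))) by (apply Rmult_le_pos;
          [apply Rabs_pos | apply Rlt_le, exp_pos]).
        apply Rmult_le_compat; auto.
        * apply Rmult_le_pos; [apply Cmod_ge_0 | apply Rlt_le, exp_pos].
        * apply Rmult_le_pos; auto using Cmod_ge_0.
        * apply Rmult_le_compat; auto using Cmod_ge_0; [apply HN; lra | apply Hb'; lra]. }
  assert (F3 : forall x, 0 <= x <= T -> Cmod (hs u s (W x)) <= 2 * (M0 / 2)).
  { apply (bootstrap (fun x => Cmod (hs u s (W x))) T); auto.
    - intros x _.
      assert (E1 := Hol_cexp_comp _ _ (Hol_opp _ _ (Hol_scal (RtoC s) _ _ Hol_cexp))).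
      assert (E2 := Hol_cexp_comp _ _ (Hol_scal (RtoC (/ 2)) _ _ Hol_id)).
      exact (continuity_Cmod_line _ _ w0 k x (Hol_mult _ _ _ _ (Hol_mult _ _ _ _ E1 E2) (proj1 HS))).
    - intros N HN x Hx. specialize (F1 N x HN Hx). specialize (F2 N x HN Hx).
      assert (E := hs_eq u u' s (W x) Hs). apply (f_equal Cmod) in E.
      rewrite Cmod_mult, Cmod_R, Rabs_mult, As, (Rabs_pos_eq 2) in E by lra.
      assert (E2 := Cmod_minus_le (Xs u u' (- s) (W x)) (Ys u u' s (W x))). rewrite <- E in E2.
      assert (E3 := Cmod_le_minus (Xs u u' (- s) (W x)) (Xs u u' (- s) w0)). unfold M0. lra. }
  intros x Hx. fold (W x). split; [specialize (F3 x Hx); lra|].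
  assert (F4 := F2 M0 x ltac:(intros y Hy; specialize (F3 y Hy); lra) Hx).
  generalize (Cmod_ge_0 (Xs u u' (- s) w0)) (Cmod_ge_0 (Ys u u' s w0)). unfold M0 in *. lra.
Qed.

(* From [Re w = sz nu] on, the perturbation [(nu^2 - 1/4) e^{-w}] is absorbed by the bootstrap. *)
Definition sz nu := 1 + 2 * Rabs (nu ^ 2 - / 4).

Lemma sz_exp nu x : sz nu <= x -> Rabs (nu ^ 2 - / 4) * exp (- x) <= / 2.
Proof.
  intros H. unfold sz in H. rewrite exp_Ropp. assert (p := exp_pos x). assert (q := exp_ineq1_le x).
  apply Rmult_le_reg_r with (exp x); auto. rewrite Rmult_assoc, Rinv_l by lra. lra.
Qed.

Lemma cexp_pt (x y : R) : cexp (RtoC x + RtoC y * Ci)%C = (exp x * cos y, exp x * sin y).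
Proof. unfold cexp. simpl. apply C_eq; simpl; repeat f_equal; ring. Qed.

(* [Re t] increases along horizontal rays, so that [stable] applies with [s = 1]. *)
Lemma sector_growth nu u u' : Sol nu u u' -> exists B, 0 <= B /\ forall x y, sz nu <= x -> Rabs y <= 1 ->
  Cmod (u (RtoC x + RtoC y * Ci)%C) <= B * exp (exp x * cos y - x / 2) /\
  Cmod (u' (RtoC x + RtoC y * Ci)%C) <= B * exp (exp x * cos y + x / 2).
Proof.
  intros HS. set (s0 := sz nu). assert (s1 : 1 <= s0) by (unfold s0, sz; generalize (Rabs_pos (nu ^ 2 - / 4));
    lra).
  assert (N1 : -1 * -1 = 1) by ring. assert (N2 : 1 * 1 = 1) by ring.
  assert (HX := Hol_Xs nu u u' (-1) HS N1). assert (HX1 := Hol_Xs nu u u' 1 HS N2).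
  destruct (Hol_bound _ _ HX (s0 + 1)) as [B1 [B10 HB1]].
  assert (E1 := Hol_cexp_comp _ _ (Hol_opp _ _ (Hol_scal (RtoC (2 * 1)) _ _ Hol_cexp))).
  destruct (Hol_bound _ _ (Hol_mult _ _ _ _ E1 HX1) (s0 + 1)) as [B2 [B20 HB2]].
  set (M := B1 + B2).
  exists (4 * M). split; [unfold M; lra|]. intros x y Hx Hy.
  set (w0 := (RtoC s0 + RtoC y * Ci)%C).
  assert (Hw0 : Cmod w0 <= s0 + 1).
  { unfold w0. eapply Rle_trans; [apply Cmod_triangle|].
    rewrite Cmod_mult, Cmod_Ci, !Cmod_R, (Rabs_pos_eq s0) by lra. lra. }
  assert (Hc : 0 < cos y).
  { apply cos_gt_0; apply Rabs_le_between in Hy; generalize PI2_1; lra. }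
  assert (EW : forall r, (w0 + RtoC r * 1)%C = (RtoC (s0 + r) + RtoC y * Ci)%C) by (intro r; unfold w0;
    rewrite RtoC_plus; ring).
  assert (ST := stable nu u u' 1 w0 1%C (x - s0) (fun r => - (Rabs (nu ^ 2 - / 4) * exp (- (s0 + r)))) (fun r
    => Rabs (nu ^ 2 - / 4) * exp (- (s0 + r)))
     HS N2 Cmod_1 ltac:(lra)).
  assert (A1 : forall x0 y0 : R, 0 <= x0 <= y0 -> y0 <= x - s0 -> 1 * fst (cexp (w0 + RtoC x0 * 1)) <= 1 * fst
    (cexp (w0 + RtoC y0 * 1))).
  { intros r r' Hr Hr'. rewrite !EW, !cexp_pt. simpl. rewrite !Rmult_1_l. apply Rmult_le_compat_r; [lra|].
    apply exp_le; lra. }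
  assert (A2 : forall r, 0 <= r <= x - s0 -> is_derive (fun r => - (Rabs (nu ^ 2 - / 4) * exp (- (s0 + r)))) r
    (Rabs (nu ^ 2 - / 4) * exp (- (s0 + r)))).
  { intros r _. generalize (Rabs (nu ^ 2 - / 4)); intro c0. auto_derive; auto; ring. }
  assert (A3 : forall r, 0 <= r <= x - s0 -> Rabs (nu ^ 2 - / 4) * exp (- fst (w0 + RtoC r * 1)%C) <= Rabs (nu
    ^ 2 - / 4) * exp (- (s0 + r))).
  { intros r _. rewrite EW. right. f_equal. f_equal. simpl. ring. }
  assert (A4 : forall r, 0 <= r <= x - s0 -> - (Rabs (nu ^ 2 - / 4) * exp (- (s0 + r))) - - (Rabs (nu ^ 2 - /
    4) * exp (- (s0 + 0))) <= / 2).
  { intros r _. assert (Z := sz_exp nu s0 (Rle_refl _)). rewrite Rplus_0_r.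
    assert (0 <= Rabs (nu ^ 2 - / 4) * exp (- (s0 + r))) by (apply Rmult_le_pos;
      [apply Rabs_pos | apply Rlt_le, exp_pos]). lra. }
  destruct (ST A1 A2 A3 A4 (x - s0) ltac:(lra)) as [R1 R2]. clear ST.
  rewrite EW in R1, R2. replace (s0 + (x - s0)) with x in R1, R2 by ring.
  assert (M0 : Cmod (Xs u u' (- (1)) w0) + Cmod (Ys u u' 1 w0) <= M).
  { unfold M. apply Rplus_le_compat; [apply HB1; auto|]. rewrite Ys_Xs. apply HB2; auto. }
  set (w := (RtoC x + RtoC y * Ci)%C) in *.
  assert (Ew : fst w = x) by (unfold w; simpl; ring).
  assert (Et : fst (cexp w) = exp x * cos y) by (unfold w; rewrite cexp_pt; reflexivity).
  assert (P1 : Cmod (u w) = exp (exp x * cos y - x / 2) * Cmod (hs u 1 w)).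
  { unfold hs. rewrite !Cmod_mult.
    replace (- (RtoC 1 * cexp w))%C with (RtoC (- (1)) * cexp w)%C by (rewrite RtoC_opp; ring).
    rewrite Cmod_cexp_RtoC, Et, Cmod_cexp. replace (fst (RtoC (/ 2) * w)%C) with (x / 2) by (rewrite <- Ew;
      simpl; field).
    rewrite <- !Rmult_assoc, <- !exp_plus. match goal with |- _ = exp ?a * _ => replace a with 0 by field end.
    rewrite exp_0; ring. }
  assert (hM : Cmod (hs u 1 w) <= M) by lra. assert (YM : Cmod (Ys u u' 1 w) <= 2 * M) by lra.
  assert (p := exp_pos (exp x * cos y - x / 2)).
  assert (Mp : 0 <= M) by (unfold M; lra).
  assert (U1 : Cmod (u w) <= M * exp (exp x * cos y - x / 2)).
  { rewrite P1, Rmult_comm. apply Rmult_le_compat_r; lra. }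
  split; [nra|].
  assert (x1 : 1 <= x) by (unfold s0 in *; lra).
  (* u' is recovered from [Ys] and u; the factor 1/2 - t accounts for the e^x between the exponents
     - x/2 and x/2. *)
  assert (D : u' w = (cexp (cexp w) * cexp (RtoC (/ 2) * w) * Ys u u' 1 w - (RtoC (/ 2) - cexp w) * u w)%C).
  { unfold Ys. replace (RtoC 1 * cexp w)%C with (cexp w) by ring. rewrite !cexp_opp. field.
    split; apply cexp_neq_0. }
  rewrite D. eapply Rle_trans; [apply Cmod_minus_le|]. rewrite !Cmod_mult, !Cmod_cexp, Et.
  replace (fst (RtoC (/ 2) * w)%C) with (x / 2) by (rewrite <- Ew; simpl; field).
  rewrite <- exp_plus.
  assert (Q1 : Cmod (RtoC (/ 2) - cexp w)%C <= 2 * exp x).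
  { eapply Rle_trans; [apply Cmod_minus_le|]. rewrite Cmod_cexp, Ew, Cmod_R, Rabs_pos_eq by lra.
    generalize (exp_ineq1_le x); lra. }
  assert (Q2 : Cmod (RtoC (/ 2) - cexp w)%C * Cmod (u w) <= 2 * exp x * (M * exp (exp x * cos y - x / 2))) by
    (apply Rmult_le_compat; auto using Cmod_ge_0).
  replace (2 * exp x * (M * exp (exp x * cos y - x / 2))) with (2 * M * exp (exp x * cos y + x / 2)) in Q2.
  2: { replace (exp x * cos y + x / 2) with (x + (exp x * cos y - x / 2)) by field. rewrite (exp_plus x). ring.
       }
  assert (q := exp_pos (exp x * cos y + x / 2)).
  assert (exp (exp x * cos y + x / 2) * Cmod (Ys u u' 1 w) <= exp (exp x * cos y + x / 2) * (2 * M)) by (apply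
    Rmult_le_compat_l; lra).
  lra.
Qed.

(* Along the arcs [|t| = r] the recessive solution is dominant, hence controlled by its values on the real axis. *)
Lemma sector_decay nu U U' : IsK nu U U' -> exists B, 0 <= B /\ forall x y, sz nu <= x -> Rabs y <= 1 ->
  Cmod (U (RtoC x + RtoC y * Ci)%C) <= B * exp (- (exp x * cos y)).
Proof.
  intros [HS HR].
  destruct (kw_bound nu) as [B1 [B10 H1]], (dkw_bound nu) as [B2 [B20 H2]].
  exists (2 * B2 + 3 * B1). split; [lra|].
  (* The sign e treats the arcs above and below the axis at once; e^2 = 1 makes cos (e r) = cos
     r. *)
  assert (G : forall e x y, e * e = 1 -> sz nu <= x -> 0 <= y <= 1 -> Cmod (U (RtoC x + RtoC (e * y) * Ci)%C)
    <= (2 * B2 + 3 * B1) * exp (- (exp x * cos (e * y)))).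
  { intros e x y He Hx Hy.
    assert (x1 : 1 <= x) by (unfold sz in Hx; generalize (Rabs_pos (nu ^ 2 - / 4)); lra).
    assert (N1 : -1 * -1 = 1) by ring.
    set (k := (RtoC e * Ci)%C).
    assert (Hk : Cmod k = 1).
    { unfold k. rewrite Cmod_mult, Cmod_Ci, Cmod_R, Rmult_1_r. rewrite <- (Rabs_pos_eq 1) by lra.
      apply Rsqr_eq_abs_0; unfold Rsqr; lra. }
    assert (Ec : forall r, cos (e * r) = cos r).
    { intro r. assert (D : (e - 1) * (e + 1) = 0) by lra. apply Rmult_integral in D. destruct D as [D|D].
      - replace e with 1 by lra. f_equal; ring.
      - replace e with (- (1)) by lra. rewrite <- cos_neg. f_equal; ring. }
    assert (EW : forall r, (RtoC x + RtoC r * k)%C = (RtoC x + RtoC (e * r) * Ci)%C) by (intro r; unfold k;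
      rewrite RtoC_mult; ring).
    set (c := Rabs (nu ^ 2 - / 4) * exp (- x)).
    assert (ST := stable nu U U' (-1) (RtoC x) k 1 (fun r => c * r) (fun _ => c) HS N1 Hk ltac:(lra)).
    assert (A1 : forall x0 y0 : R, 0 <= x0 <= y0 -> y0 <= 1 -> -1 * fst (cexp (RtoC x + RtoC x0 * k)) <= -1 *
      fst (cexp (RtoC x + RtoC y0 * k))).
    { intros r r' Hr Hr'. rewrite !EW, !cexp_pt. simpl. rewrite !Ec.
      assert (cos r' <= cos r) by (apply cos_decr_1; generalize PI2_1; lra). generalize (exp_pos x); nra. }
    assert (A2 : forall r, 0 <= r <= 1 -> is_derive (fun r => c * r) r c) by (intros r _; auto_derive; auto;
      ring).
    assert (A3 : forall r, 0 <= r <= 1 -> Rabs (nu ^ 2 - / 4) * exp (- fst (RtoC x + RtoC r * k)%C) <= c).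
    { intros r _. rewrite EW. unfold c. right. do 3 f_equal. simpl. ring. }
    assert (A4 : forall r, 0 <= r <= 1 -> c * r - c * 0 <= / 2).
    { intros r Hr. assert (Z := sz_exp nu x Hx). fold c in Z.
      assert (0 <= c) by (apply Rmult_le_pos; [apply Rabs_pos | apply Rlt_le, exp_pos]). nra. }
    destruct (ST A1 A2 A3 A4 y Hy) as [R1 _]. clear ST. rewrite EW in R1.
    set (w := (RtoC x + RtoC (e * y) * Ci)%C) in *.
    assert (Ew : fst w = x) by (unfold w; simpl; ring).
    assert (Et : fst (cexp w) = exp x * cos (e * y)) by (unfold w; rewrite cexp_pt; reflexivity).
    assert (P1 : Cmod (U w) = exp (- (exp x * cos (e * y)) - x / 2) * Cmod (hs U (-1) w)).
    { unfold hs. rewrite !Cmod_mult.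
      replace (- (RtoC (-1) * cexp w))%C with (RtoC 1 * cexp w)%C by (change (-1) with (- (1));
        rewrite RtoC_opp; ring).
      rewrite Cmod_cexp_RtoC, Et, Cmod_cexp. replace (fst (RtoC (/ 2) * w)%C) with (x / 2) by (rewrite <- Ew;
        simpl; field).
      rewrite <- !Rmult_assoc, <- !exp_plus. match goal with |- _ = exp ?a * _ => replace a with 0 by field
        end. rewrite exp_0; ring. }
    destruct (HR x) as [K1 K2]. specialize (H1 x ltac:(lra)). specialize (H2 x ltac:(lra)).
    assert (k0 := kw_pos nu x). assert (ex := exp_pos x). assert (ex2 := exp_ineq1_le x).
    (* Both initial values have the form e^t t^(-1/2) (k' + f k) with f = 1/2 - t or f = 1/2 + t, so
       one estimate serves them; here the decay of K on the axis enters. *)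
    assert (T : forall f : R, Rabs f <= 1 + exp x -> Cmod (cexp (RtoC 1 * cexp x) * cexp (- (RtoC (/ 2) * x)) *
      (RtoC (dkw nu x) + RtoC f * RtoC (kw nu x)))%C
       <= (B2 + 3 / 2 * B1) * exp (x / 2)).
    { intros f Hf.
      replace (RtoC (dkw nu x) + RtoC f * RtoC (kw nu x))%C with (RtoC (dkw nu x + f * kw nu x)) by (rewrite
        RtoC_plus, RtoC_mult; reflexivity).
      rewrite !Cmod_mult, Cmod_cexp_RtoC, Cmod_cexp, Cmod_R, cexp_R. simpl fst.
      replace (- (/ 2 * x - 0 * 0)) with (- (x / 2)) by field. rewrite Rmult_1_l.
      assert (Q : Rabs (dkw nu x + f * kw nu x) <= (B2 + 3 / 2 * B1) * (exp x * exp (- exp x))).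
      { eapply Rle_trans; [apply Rabs_triang|]. rewrite Rabs_mult, (Rabs_pos_eq (kw nu x)) by auto.
        assert (Rabs f * kw nu x <= (3 / 2 * exp x) * (B1 * exp (- exp x))) by (apply Rmult_le_compat;
          auto using Rabs_pos; lra). lra. }
      apply Rle_trans with (exp (exp x) * exp (- (x / 2)) * ((B2 + 3 / 2 * B1) * (exp x * exp (- exp x)))).
      - apply Rmult_le_compat_l; auto. apply Rmult_le_pos; apply Rlt_le, exp_pos.
      - right. replace (exp (x / 2)) with (exp (exp x) * exp (- (x / 2)) * (exp x * exp (- exp x))); [field|].
        rewrite <- !exp_plus. f_equal. field. }
    assert (T1 : Cmod (Xs U U' (- (-1)) (RtoC x)) <= (B2 + 3 / 2 * B1) * exp (x / 2)).
    { unfold Xs. rewrite K1, K2, cexp_R. replace (- (-1)) with 1 by ring.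
      replace (RtoC (/ 2) - RtoC 1 * RtoC (exp x))%C with (RtoC (/ 2 - exp x)) by (rewrite RtoC_minus; ring).
      rewrite <- cexp_R at 1. apply (T (/ 2 - exp x)). apply Rabs_le; lra. }
    assert (T2 : Cmod (Ys U U' (-1) (RtoC x)) <= (B2 + 3 / 2 * B1) * exp (x / 2)).
    { unfold Ys. rewrite K1, K2, cexp_R. change (-1) with (- (1)). rewrite RtoC_opp.
      replace (RtoC (/ 2) - - RtoC 1 * RtoC (exp x))%C with (RtoC (/ 2 + exp x)) by (rewrite RtoC_plus; ring).
      replace (- (- RtoC 1 * RtoC (exp x)))%C with (RtoC 1 * RtoC (exp x))%C by ring.
      rewrite <- cexp_R at 1. apply (T (/ 2 + exp x)). apply Rabs_le; lra. }
    rewrite P1. unfold Rminus. rewrite exp_plus.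
    apply Rle_trans with (exp (- (exp x * cos (e * y))) * exp (- (x / 2)) * ((2 * B2 + 3 * B1) * exp (x / 2))).
    - apply Rmult_le_compat_l; [apply Rmult_le_pos; apply Rlt_le, exp_pos | lra].
    - right. rewrite (exp_Ropp (x / 2)). field. apply Rgt_not_eq, exp_pos. }
  intros x y Hx Hy. destruct (Rle_dec 0 y) as [H|H].
  - replace y with (1 * y) by ring. apply G; auto; [ring | rewrite Rabs_pos_eq in Hy; lra].
  - replace y with ((-1) * (- y)) by ring. apply G; auto; [ring | rewrite Rabs_left in Hy; lra].
Qed.

(** * Primitives and integrals along paths *)

Lemma cder_continuous g s d : cder g s d -> continuous (fun y => fst (g y)) s /\ continuous (fun y => snd (g
  y)) s.
Proof.
  intros [H1 H2]. split; apply (ex_derive_continuous (V := R_NormedModule)); eexists; eassumption.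
Qed.

Lemma cder_id s : cder (fun y => RtoC y) s 1%C.
Proof. split; simpl; [apply (is_derive_id (K := R_AbsRing)) | apply (is_derive_const (V := R_NormedModule))].
Qed.

Lemma primitive (g : R -> C) a : (forall s,
  continuous (fun y => fst (g y)) s /\ continuous (fun y => snd (g y)) s) ->
  forall s, cder (fun y => (RInt (fun r => fst (g r)) a y, RInt (fun r => snd (g r)) a y)) s (g s).
Proof.
  intros H s.
  assert (E : forall f : R -> R, (forall r, continuous f r) -> is_derive (fun y => RInt f a y) s (f s)).
  { intros f Hf. apply (is_derive_RInt (V := R_NormedModule) f _ a); auto.
    exists (mkposreal 1 Rlt_0_1). intros y _. apply (RInt_correct (V := R_CompleteNormedModule)).
    apply (ex_RInt_continuous (V := R_CompleteNormedModule)). auto. }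
  split; [apply (E (fun r => fst (g r))) | apply (E (fun r => snd (g r)))]; intro r; apply (H r).
Qed.

(** The primitive is the integral of f along the ray from 0 to w. Its remainder is estimated without
    contour deformation: f (s w) + s w f' (s w) is the derivative of s f (s w), so the remainder, as
    a function of s on the two rays to v and w, has a derivative of second order in v - w. *)
Lemma Hol_primitive f f' : Hol f f' -> exists G, Hol G f.
Proof.
  intros H.
  set (q := fun w (s : R) => (w * f (0 + RtoC s * w))%C).
  assert (cq : forall w s, cder (q w) s (0 * f (0 + RtoC s * w) + w * (f' (0 + RtoC s * w) * w))%C).
  { intros w s. apply cder_mult; [apply cder_const | apply (cder_Hol_line f f' 0 w s H)]. }
  set (Q := fun w (s : R) => (RInt (fun r => fst (q w r)) 0 s, RInt (fun r => snd (q w r)) 0 s) : C).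
  assert (HQ : forall w s, cder (Q w) s (q w s)).
  { intros w s. apply primitive. intro r. eapply cder_continuous, cq. }
  assert (Q0 : forall w, Q w 0 = 0%C) by (intro w; unfold Q; rewrite !RInt_point; reflexivity).
  exists (fun w => Q w 1). intro r. destruct (H r) as [M [M0 HM]]. destruct (Hol_lip _ _ H r) as [L [L0 HL]].
  assert (Sm : forall s w, 0 <= s <= 1 -> Cmod w <= r -> Cmod (0 + RtoC s * w)%C <= r).
  { intros s w Hs Hw. rewrite Cplus_0_l, Cmod_mult, Cmod_R, Rabs_pos_eq by lra. generalize (Cmod_ge_0 w); nra. }
  exists (Rabs r * M + M + L). split; [generalize (Rabs_pos r); nra|]. intros v w Hv Hw.
  destruct (HM v w Hv Hw) as [A1 [A2 _]].
  assert (r0 : 0 <= r) by (generalize (Cmod_ge_0 w); lra). rewrite (Rabs_pos_eq r) by auto.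
  assert (rM := Rmult_le_pos _ _ r0 M0).
  repeat split; [|lra|].
  - replace (Q w 1) with (Q w 1 - Q w 0)%C by (rewrite Q0; ring).
    apply Rle_trans with (r * M * 1 - r * M * 0); [|lra].
    apply (curve_mvt (Q w) (q w) (fun s => r * M * s) (fun _ => r * M)); [lra | auto | |].
    + intros s _. auto_derive; auto; ring.
    + intros s Hs. unfold q. rewrite Cmod_mult. apply Rmult_le_compat; auto using Cmod_ge_0.
      apply (HM (0 + s * w)%C); auto.
  - set (h := (v - w)%C).
    set (D := fun s : R => (Q v s - Q w s - (h * RtoC s) * f (0 + RtoC s * w))%C).
    replace (Q v 1 - Q w 1 - f w * h)%C with (D 1 - D 0)%C.
    2: { unfold D. rewrite !Q0. replace (0 + 1 * w)%C with w by ring. ring. }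
    set (K := (r * M + M + L) * Cmod h ^ 2).
    apply Rle_trans with (K * 1 - K * 0); [|unfold K; lra].
    apply (curve_mvt D (fun s => q v s - q w s - (h * f (0 + RtoC s * w) + (h * RtoC s) * (f' (0 + RtoC s * w)
      * w)))%C (fun s => K * s) (fun _ => K)); [lra | | |].
    + intros s _. unfold D. apply cder_minus; [apply cder_minus; apply HQ|].
      apply cder_mult; [|apply (cder_Hol_line f f' 0 w s H)].
      eapply cder_eq; [apply cder_mult; [apply cder_const | apply (cder_id s)]|]. cbv beta. ring.
    + intros s _. auto_derive; auto; ring.
    + intros s Hs. unfold q.
      replace (v * f (0 + s * v) - w * f (0 + s * w) - (h * f (0 + s * w) + h * s * (f' (0 + s * w) * w)))%C
        with
       (w * (f (0 + s * v) - f (0 + s * w) - f' (0 + s * w) * (0 + s * v - (0 + s * w))) + h * (f (0 + s * v) -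
         f (0 + s * w)))%C by (unfold h; ring).
      destruct (HM (0 + s * v)%C (0 + s * w)%C) as [_ [_ B1]]; auto.
      assert (B2 := HL (0 + s * v)%C (0 + s * w)%C (Sm s v Hs Hv) (Sm s w Hs Hw)).
      assert (B3 : Cmod (0 + s * v - (0 + s * w))%C <= Cmod h).
      { replace (0 + s * v - (0 + s * w))%C with (s * h)%C by (unfold h; ring).
        rewrite Cmod_mult, Cmod_R, Rabs_pos_eq by lra. generalize (Cmod_ge_0 h); nra. }
      assert (h0 := Cmod_ge_0 h).
      eapply Rle_trans; [apply Cmod_triangle|]. rewrite !Cmod_mult. unfold K.
      assert (B4 : M * Cmod (0 + s * v - (0 + s * w))%C ^ 2 <= M * Cmod h ^ 2) by (apply Rmult_le_compat_l;
        auto; apply pow_incr; split; auto using Cmod_ge_0).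
      assert (B5 : Cmod w * Cmod (f (0 + s * v) - f (0 + s * w) - f' (0 + s * w) * (0 + s * v - (0 + s * w)))%C
        <= r * (M * Cmod h ^ 2))
        by (apply Rmult_le_compat; auto using Cmod_ge_0; lra).
      assert (B6 : Cmod h * Cmod (f (0 + s * v) - f (0 + s * w))%C <= Cmod h * (L * Cmod h)).
      { apply Rmult_le_compat_l; auto. eapply Rle_trans; [exact B2|]. apply Rmult_le_compat_l; auto. }
      generalize (pow2_ge_0 (Cmod h)); intros. nra.
Qed.

Definition ccont (g : R -> C) s := continuous (fun y => fst (g y)) s /\ continuous (fun y => snd (g y)) s.

Lemma ccont_eps g s : ccont g s <-> forall eps, 0 < eps -> locally s (fun y => Cmod (g y - g s)%C < eps).
Proof.
  split.
  - intros [C1 C2] eps He. assert (He2 : 0 < eps / 2) by lra.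
    assert (L1 : locally s (fun y => Rabs (fst (g y) - fst (g s)) < eps / 2))
      by exact (C1 _ (locally_ball (fst (g s)) (mkposreal _ He2))).
    assert (L2 : locally s (fun y => Rabs (snd (g y) - snd (g s)) < eps / 2))
      by exact (C2 _ (locally_ball (snd (g s)) (mkposreal _ He2))).
    refine (filter_imp _ _ _ (filter_and _ _ L1 L2)). intros y [B1 B2].
    destruct (g y) as [y1 y2], (g s) as [s1 s2]. unfold Cminus, Cplus, Copp; simpl in *.
    eapply Rle_lt_trans; [apply Cmod_le_sum|]. unfold Rminus in B1, B2. lra.
  - intros H. split; apply filterlim_locally; intro eps; refine (filter_imp _ _ _ (H eps (cond_pos eps)));
      intros y Hy;
    (eapply Rle_lt_trans; [|exact Hy]); [apply (Cmod_fst (g y - g s)%C) | apply (Cmod_snd (g y - g s)%C)].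
Qed.

Lemma ccont_Hol F F' g s : Hol F F' -> ccont g s -> ccont (fun y => F (g y)) s.
Proof.
  intros H Hg. apply ccont_eps. intros eps He.
  destruct (Hol_lip _ _ H (Cmod (g s) + 1)) as [L [L0 HL]].
  set (d := Rmin 1 (eps / (L + 1))).
  assert (d0 : 0 < d) by (apply Rmin_pos; [lra | apply Rdiv_lt_0_compat; lra]).
  refine (filter_imp _ _ _ (proj1 (ccont_eps g s) Hg d d0)). intros y Hy.
  assert (Cmod (g y) <= Cmod (g s) + 1).
  { eapply Rle_trans; [apply (Cmod_le_minus _ (g s))|]. assert (d <= 1) by apply Rmin_l. lra. }
  eapply Rle_lt_trans; [apply HL; lra|].
  apply Rle_lt_trans with (L * (eps / (L + 1))).
  - apply Rmult_le_compat_l; auto. assert (d <= eps / (L + 1)) by apply Rmin_r. lra.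
  - apply Rmult_lt_reg_r with (L + 1); [lra|]. field_simplify; [|lra]. nra.
Qed.

Lemma ccont_mult g h s : ccont g s -> ccont h s -> ccont (fun y => g y * h y)%C s.
Proof.
  intros [H1 H2] [H3 H4]. split; simpl.
  - apply (continuous_minus (V := R_NormedModule)); apply (continuous_mult (K := R_AbsRing)); assumption.
  - apply (continuous_plus (V := R_NormedModule)); apply (continuous_mult (K := R_AbsRing)); assumption.
Qed.

Lemma C_is_linear_fst : is_linear (U := C_R_NormedModule) (V := R_NormedModule) (fun z : C => fst z).
Proof.
  split; [reflexivity | reflexivity |]. exists 1. split; [lra|]. intro x. rewrite Rmult_1_l.
  rewrite <- Cmod_norm. apply Cmod_fst.
Qed.
Lemma C_is_linear_snd : is_linear (U := C_R_NormedModule) (V := R_NormedModule) (fun z : C => snd z).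
Proof.
  split; [reflexivity | reflexivity |]. exists 1. split; [lra|]. intro x. rewrite Rmult_1_l.
  rewrite <- Cmod_norm. apply Cmod_snd.
Qed.

Lemma cder_of_is_derive g s d : is_derive (K := R_AbsRing) (V := C_R_NormedModule) g s d -> cder g s d.
Proof.
  intros H. split.
  - exact (filterdiff_comp' g (fun z : C => fst z) s _ _ H (filterdiff_linear _ C_is_linear_fst)).
  - exact (filterdiff_comp' g (fun z : C => snd z) s _ _ H (filterdiff_linear _ C_is_linear_snd)).
Qed.

(** Composition with this retraction onto [a, b] extends data known on one piece of a path to
    continuous functions on the whole line, whose primitives are differentiable everywhere. *)
Definition clamp a b s := Rmax a (Rmin b s).

Lemma clamp_in a b s : a <= b -> a <= clamp a b s <= b.
Proof. intros. unfold clamp, Rmax, Rmin. destruct (Rle_dec b s); destruct (Rle_dec a _); lra. Qed.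

Lemma clamp_id a b s : a <= s <= b -> clamp a b s = s.
Proof. intros. unfold clamp, Rmax, Rmin. destruct (Rle_dec b s); destruct (Rle_dec a _); lra. Qed.

Lemma clamp_incr a b s t : a <= b -> s <= t -> 0 <= clamp a b t - clamp a b s <= t - s.
Proof.
  intros. unfold clamp, Rmin. destruct (Rle_dec b s); destruct (Rle_dec b t); unfold Rmax;
  repeat (match goal with |- context [Rle_dec a ?x] => destruct (Rle_dec a x) end); lra.
Qed.

Lemma clamp_lip a b s t : a <= b -> Rabs (clamp a b s - clamp a b t) <= Rabs (s - t).
Proof.
  intros H. destruct (Rle_dec s t).
  - rewrite (Rabs_minus_sym (clamp _ _ _)), (Rabs_minus_sym s). generalize (clamp_incr a b s t H). intros.
    rewrite !Rabs_pos_eq; lra.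
  - generalize (clamp_incr a b t s H). intros. rewrite !Rabs_pos_eq; lra.
Qed.

Lemma clamp_continuous a b s : a <= b -> continuous (clamp a b) s.
Proof.
  intros H. apply filterlim_locally. intro eps. exists eps. intros y Hy.
  eapply Rle_lt_trans; [apply clamp_lip, H | exact Hy].
Qed.

(** * The logarithm along a path, and path integrals as increments of a primitive *)

Definition clog (r : C) (a : R) : C := (ln (Cmod r), a).

Lemma cexp_clog (r : C) (a : R) : r <> 0%C -> is_arg r a -> cexp (clog r a) = r.
Proof.
  intros Hr Ha. unfold cexp, clog; cbn [fst snd]. rewrite exp_ln by (apply Cmod_gt_0; assumption). symmetry.
  exact Ha.
Qed.

Lemma ln_Cmod (z : C) : z <> 0%C -> ln (Cmod z) = / 2 * ln (fst z ^ 2 + snd z ^ 2).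
Proof.
  intros Hz. assert (E : fst z ^ 2 + snd z ^ 2 = Cmod z ^ 2) by (symmetry; apply Cmod2_alt).
  rewrite E, ln_pow by (apply Cmod_gt_0; assumption). simpl. field.
Qed.

(** The argument is only assumed continuous, and its differentiability follows: near s the
    difference a y - a s stays within pi/2, hence is the arctangent of [q y], a rational expression
    in g y rotated by - a s. *)
Lemma clog_derive (g : R -> C) (a : R -> R) s d : cder g s d -> g s <> 0%C ->
  locally s (fun y => g y <> 0%C /\ is_arg (g y) (a y)) -> continuous a s ->
  cder (fun y => clog (g y) (a y)) s (d / g s)%C.
Proof.
  intros [H1 H2] H0 Hloc Ca.
  assert (m0 : 0 < Cmod (g s)) by (apply Cmod_gt_0; assumption).
  assert (E2 : fst (g s) ^ 2 + snd (g s) ^ 2 = Cmod (g s) ^ 2) by (symmetry; apply Cmod2_alt).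
  assert (p2 : 0 < fst (g s) ^ 2 + snd (g s) ^ 2) by (rewrite E2; apply pow_lt; auto).
  assert (Has : is_arg (g s) (a s)) by apply (locally_singleton _ _ Hloc).
  split; simpl.
  - apply is_derive_ext_loc with (fun y => / 2 * ln (fst (g y) ^ 2 + snd (g y) ^ 2)).
    + refine (filter_imp _ _ _ Hloc). intros y [Hy _]. symmetry. now apply ln_Cmod.
    + eapply is_derive_eq.
      * apply is_derive_scal. apply (is_derive_comp ln (fun y => fst (g y) ^ 2 + snd (g y) ^ 2)).
        -- apply is_derive_Reals, derivable_pt_lim_ln. exact p2.
        -- apply (is_derive_plus (V := R_NormedModule)); apply is_derive_pow; eassumption.
      * unfold scal, plus; simpl; unfold mult; simpl.
        assert (fst (g s) * fst (g s) + snd (g s) * snd (g s) <> 0) by (simpl in p2; lra).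
        field. lra.
  - set (c0 := cos (a s)). set (s0 := sin (a s)).
    set (q := fun y => (snd (g y) * c0 - fst (g y) * s0) / (fst (g y) * c0 + snd (g y) * s0)).
    assert (S1 : s0 * s0 + c0 * c0 = 1) by (generalize (sin2_cos2 (a s)); unfold Rsqr; auto).
    assert (Ex : fst (g s) = Cmod (g s) * c0) by (rewrite Has at 1; reflexivity).
    assert (Ey : snd (g s) = Cmod (g s) * s0) by (rewrite Has at 1; reflexivity).
    apply is_derive_ext_loc with (fun y => a s + atan (q y)).
    + assert (P4 : 0 < PI / 2) by (generalize PI2_1; lra).
      assert (La : locally s (fun y => Rabs (a y - a s) < PI / 2)) by exact (Ca _ (locally_ball (a s)
        (mkposreal _ P4))).
      refine (filter_imp _ _ _ (filter_and _ _ La Hloc)). intros y [Hy [Hy0 Hya]].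
      apply Rabs_def2 in Hy.
      assert (my : 0 < Cmod (g y)) by (apply Cmod_gt_0; assumption).
      assert (Ex' : fst (g y) = Cmod (g y) * cos (a y)) by (rewrite Hya at 1; reflexivity).
      assert (Ey' : snd (g y) = Cmod (g y) * sin (a y)) by (rewrite Hya at 1; reflexivity).
      replace (q y) with (tan (a y - a s)); [rewrite atan_tan by lra; apply Rplus_minus|].
      unfold q, tan. rewrite sin_minus, cos_minus. fold c0 s0. rewrite Ex', Ey'.
      assert (0 < cos (a y - a s)) by (apply cos_gt_0; lra). rewrite cos_minus in H. fold c0 s0 in H.
      field. split; [|lra].
      replace (Cmod (g y) * cos (a y) * c0 + Cmod (g y) * sin (a y) * s0) with (Cmod (g y) * (cos (a y) * c0 +
        sin (a y) * s0)) by ring.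
      apply Rgt_not_eq, Rmult_lt_0_compat; auto.
    + assert (Dn : fst (g s) * c0 + snd (g s) * s0 = Cmod (g s)).
      { rewrite Ex, Ey. transitivity (Cmod (g s) * (s0 * s0 + c0 * c0)); [ring | rewrite S1; ring]. }
      assert (Nm : snd (g s) * c0 - fst (g s) * s0 = 0) by (rewrite Ex, Ey; ring).
      assert (Hq : is_derive q s ((snd d * c0 - fst d * s0) / Cmod (g s))).
      { unfold q. eapply is_derive_eq.
        - apply is_derive_div.
          + apply (is_derive_minus (V := R_NormedModule)); apply is_derive_Rmult; try eassumption;
              apply (is_derive_const (V := R_NormedModule)).
          + apply (is_derive_plus (V := R_NormedModule)); apply is_derive_Rmult; try eassumption;
              apply (is_derive_const (V := R_NormedModule)).
          + rewrite Dn. lra.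
        - unfold minus, plus, opp, zero; simpl. rewrite Dn, Nm. field. lra. }
      eapply is_derive_eq.
      * apply (is_derive_plus (V := R_NormedModule)); [apply (is_derive_const (V := R_NormedModule))|].
        apply (is_derive_comp atan q); [apply is_derive_atan | exact Hq].
      * assert (Q0 : q s = 0) by (unfold q; rewrite Nm; unfold Rdiv; ring). rewrite Q0.
        unfold plus, zero, scal; simpl; unfold mult, Rsqr; simpl.
        rewrite Ex, Ey.
        replace (Cmod (g s) * c0 * (Cmod (g s) * c0 * 1) + Cmod (g s) * s0 * (Cmod (g s) * s0 * 1)) with (Cmod
          (g s) * Cmod (g s) * (s0 * s0 + c0 * c0)) by ring.
        rewrite S1. field. lra.
Qed.

Lemma locally_Ioo a b s : a < s < b -> locally s (fun y => a <= y <= b).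
Proof.
  intros H. assert (d0 : 0 < Rmin (s - a) (b - s)) by (apply Rmin_pos; lra). exists (mkposreal _ d0).
  intros y Hy. assert (Hy' : Rabs (y - s) < Rmin (s - a) (b - s)) by exact Hy.
  apply Rabs_def2 in Hy'. generalize (Rmin_l (s - a) (b - s)) (Rmin_r (s - a) (b - s)). lra.
Qed.

Lemma const_of_derive_0 (f : R -> R) a b : a <= b -> (forall x, a < x < b -> is_derive f x 0) ->
  (forall x, a <= x <= b -> continuous f x) -> f b = f a.
Proof.
  intros Hab Hd Hc. destruct (MVT_gen f a b (fun _ => 0)) as [c [_ E]];
    rewrite ?Rmin_left, ?Rmax_right in * by lra; auto.
  - intros x Hx. apply continuity_pt_filterlim. apply Hc; auto.
  - lra.
Qed.

(** Inside the interval G (clog t) has derivative g (clog t) t' / t. At the ends only one-sided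
    information is available, so G (clog t) is compared there with a primitive of the integrand,
    both being continuous up to the ends. *)
Lemma path_piece (G g g1 : C -> C) (t : R -> C) (a : R -> R) al be :
  Hol G g -> Hol g g1 -> 0 <= al <= be -> C1_on t al be ->
  continuous_on (fun s => 0 <= s) a -> (forall s, 0 <= s -> t s <> 0%C /\ is_arg (t s) (a s)) ->
  is_RInt (V := C_R_NormedModule) (fun s => (g (clog (t s) (a s)) / t s * CDerive t s)%C) al be
    (G (clog (t be) (a be)) - G (clog (t al) (a al)))%C.
Proof.
  intros HG Hg Hab [gg [dg [Hgg [Hdg Et]]]] Ha Ht.
  destruct (Req_dec al be) as [<-|Hne].
  { assert (E0 : (G (clog (t al) (a al)) - G (clog (t al) (a al)))%C = RtoC 0) by ring. rewrite E0.
    exact (is_RInt_point (V := C_R_NormedModule) _ al). }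
  assert (Hlt : al < be) by lra. assert (Hle : al <= be) by lra.
  set (c := clamp al be).
  assert (cin : forall s, al <= c s <= be) by (intro; apply clamp_in; auto).
  assert (Cc : forall s, continuous c s) by (intro; apply clamp_continuous; auto).
  assert (Dgg : forall s, cder gg s (dg s)) by (intro; apply cder_of_is_derive, Hgg).
  assert (gg0 : forall s, gg (c s) <> 0%C) by (intro s; rewrite <- Et by apply cin; apply Ht;
    specialize (cin s); lra).
  set (l := fun s => clog (gg (c s)) (a (c s))).
  assert (Cgg : forall s, ccont (fun y => gg (c y)) s).
  { intro s. destruct (cder_continuous _ _ _ (Dgg (c s))) as [K1 K2].
    split; [apply (continuous_comp c (fun y => fst (gg y))) | apply (continuous_comp c (fun y => snd (gg y)))];
      auto. }
  assert (Cl : forall s, ccont l s).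
  { intro s. split.
    - apply continuous_ext with (fun y => / 2 * ln (fst (gg (c y)) ^ 2 + snd (gg (c y)) ^ 2)); [intro y;
        symmetry; apply ln_Cmod, gg0|].
      apply (continuous_scal_r (V := R_NormedModule)). destruct (Cgg s) as [K1 K2].
      assert (p2 : 0 < fst (gg (c s)) ^ 2 + snd (gg (c s)) ^ 2).
      { assert (E := Cmod2_alt (gg (c s))). unfold Re, Im in E. rewrite <- E. apply pow_lt.
        apply Cmod_gt_0, gg0. }
      apply (continuous_comp (fun y => fst (gg (c y)) ^ 2 + snd (gg (c y)) ^ 2) ln).
      + apply (continuous_plus (V := R_NormedModule)); apply (continuous_comp _ (fun y => y ^ 2)); auto;
          apply (ex_derive_continuous (V := R_NormedModule)); auto_derive; auto.
      + apply (ex_derive_continuous (V := R_NormedModule)). eexists.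
        apply is_derive_Reals, derivable_pt_lim_ln. exact p2.
    - simpl. intros P HP. assert (c0 : 0 <= c s) by (specialize (cin s); lra).
      assert (Q := Ha (c s) c0 P HP). unfold filtermap, within in Q.
      assert (Q2 : locally s (fun y => 0 <= c y -> P (a (c y)))) by exact (Cc s _ Q).
      refine (filter_imp _ _ _ Q2). intros y Hy. apply Hy. specialize (cin y); lra. }
  (* Multiplying by e^(-w) keeps the function entire in w, so the factor 1/t is covered by the same
     continuity argument as g. *)
  set (H := fun w => (g w * cexp (- w))%C).
  assert (HH := Hol_mult _ _ _ _ Hg (Hol_comp _ _ (fun w => (- (1)) * w)%C _ Hol_cexp (Hol_scal (- (1))%C _ _
    Hol_id))).
  assert (HH' : Hol H (fun w => g1 w * cexp (- (1) * w) + g w * (cexp (- (1) * w) * (- (1) * 1)))%C).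
  { eapply Hol_ext; [| |exact HH]; intro w; cbv beta; auto. unfold H. do 2 f_equal. ring. }
  set (fh := fun s => (H (l s) * dg (c s))%C).
  assert (Cdg : forall s, ccont (fun y => dg (c y)) s).
  { intro s. split.
    - apply (continuous_comp (fun y => dg (c y)) (fun z : C => fst z)); [apply (continuous_comp c dg);
        auto | apply continuous_fst].
    - apply (continuous_comp (fun y => dg (c y)) (fun z : C => snd z)); [apply (continuous_comp c dg);
        auto | apply continuous_snd]. }
  assert (Cfh : forall s, ccont fh s) by (intro s; apply ccont_mult; auto; apply (ccont_Hol H _ l s HH'), Cl).
  set (P := fun y => (RInt (fun r => fst (fh r)) al y, RInt (fun r => snd (fh r)) al y) : C).
  assert (HP : forall s, cder P s (fh s)) by (apply primitive; exact Cfh).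
  assert (CGl : forall s, ccont (fun y => G (l y)) s) by (intro s; apply (ccont_Hol G g l s HG), Cl).
  assert (cexpl : forall s, cexp (l s) = gg (c s)).
  { intro s. apply cexp_clog; auto. rewrite <- Et by apply cin. apply Ht. specialize (cin s); lra. }
  assert (DG : forall s, al < s < be -> cder (fun y => G (l y)) s (fh s)).
  { intros s Hs.
    assert (Ls := locally_Ioo al be s Hs).
    assert (Dl : cder l s (dg s / gg s)%C).
    { assert (X : cder (fun y => clog (gg y) (a (c y))) s (dg s / gg s)%C).
      { apply clog_derive; auto.
        - assert (Z := gg0 s). unfold c in Z. rewrite clamp_id in Z by lra. exact Z.
        - refine (filter_imp _ _ _ Ls). intros y Hy. unfold c. rewrite clamp_id by auto. rewrite <- Et by auto.
          apply Ht; lra.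
        - apply (Cl s). }
      destruct X as [X1 X2]. split; (eapply is_derive_ext_loc; [|eassumption]); refine (filter_imp _ _ _ Ls);
        intros y Hy; unfold l, c; rewrite clamp_id by auto; reflexivity. }
    eapply cder_eq; [apply (cder_Hol G g l s _ HG Dl)|]. unfold fh, H. rewrite cexp_opp, cexpl.
    unfold c. rewrite clamp_id by lra. unfold Cdiv. ring. }
  assert (Edge : P be = (G (l be) - G (l al))%C).
  { assert (P0 : P al = 0%C) by (unfold P; rewrite !RInt_point; reflexivity).
    assert (E1 : fst (P be) - fst (G (l be)) = fst (P al) - fst (G (l al))).
    { apply (const_of_derive_0 (fun y => fst (P y) - fst (G (l y)))); auto.
      - intros x Hx. eapply is_derive_eq; [exact (is_derive_minus (V := R_NormedModule) _ _ x _ _ (proj1 (HP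
          x)) (proj1 (DG x Hx)))|].
        unfold minus, plus, opp; simpl. ring.
      - intros x _. exact (continuous_minus (V := R_NormedModule) _ _ x (proj1 (cder_continuous _ _ _ (HP x)))
          (proj1 (CGl x))). }
    assert (E2 : snd (P be) - snd (G (l be)) = snd (P al) - snd (G (l al))).
    { apply (const_of_derive_0 (fun y => snd (P y) - snd (G (l y)))); auto.
      - intros x Hx. eapply is_derive_eq; [exact (is_derive_minus (V := R_NormedModule) _ _ x _ _ (proj2 (HP
          x)) (proj2 (DG x Hx)))|].
        unfold minus, plus, opp; simpl. ring.
      - intros x _. exact (continuous_minus (V := R_NormedModule) _ _ x (proj2 (cder_continuous _ _ _ (HP x)))
          (proj2 (CGl x))). }
    rewrite P0 in E1, E2. simpl in E1, E2. apply C_eq; simpl; lra. }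
  assert (Ll : forall s, al <= s <= be -> l s = clog (t s) (a s)).
  { intros s Hs. unfold l, c. rewrite clamp_id by auto. rewrite Et by auto. reflexivity. }
  rewrite <- (Ll be), <- (Ll al), <- Edge by lra.
  apply is_RInt_ext with fh.
  - rewrite Rmin_left, Rmax_right by lra. intros s Hs. rewrite <- Ll by lra. unfold fh, H.
    rewrite cexp_opp, cexpl. unfold c. rewrite clamp_id by lra. rewrite (Et s) by lra.
    assert (ED : CDerive t s = dg s).
    { destruct (Dgg s) as [D1 D2]. assert (Ls := locally_Ioo al be s Hs).
      unfold CDerive. apply C_eq; simpl; apply is_derive_unique.
      - apply is_derive_ext_loc with (2 := D1). refine (filter_imp _ _ _ Ls). intros y Hy. rewrite Et by auto.
        reflexivity.
      - apply is_derive_ext_loc with (2 := D2). refine (filter_imp _ _ _ Ls). intros y Hy. rewrite Et by auto.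
        reflexivity. }
    rewrite ED. unfold Cdiv. reflexivity.
  - assert (I1 : is_RInt (V := R_NormedModule) (fun r => fst (fh r)) al be (RInt (fun r => fst (fh r)) al be)).
    { apply (RInt_correct (V := R_CompleteNormedModule)).
      apply (ex_RInt_continuous (V := R_CompleteNormedModule)).
      intros s _. exact (proj1 (Cfh s)). }
    assert (I2 : is_RInt (V := R_NormedModule) (fun r => snd (fh r)) al be (RInt (fun r => snd (fh r)) al be)).
    { apply (RInt_correct (V := R_CompleteNormedModule)).
      apply (ex_RInt_continuous (V := R_CompleteNormedModule)).
      intros s _. exact (proj2 (Cfh s)). }
    exact (is_RInt_fct_extend_pair (U := R_NormedModule) (V := R_NormedModule) fh al be _ _ I1 I2).
Qed.

Lemma path_integral (G g g1 : C -> C) (z : C) (theta : R) (t : R -> C) (a : R -> R) :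
  Hol G g -> Hol g g1 -> path_to_infty z theta t a -> forall T, 0 <= T ->
  is_RInt (V := C_R_NormedModule) (fun s => (g (clog (t s) (a s)) / t s * CDerive t s)%C) 0 T
    (G (clog (t T) (a T)) - G (clog z theta))%C.
Proof.
  intros HG Hg Hp. destruct (path_start _ _ _ _ Hp) as [S1 S2]. rewrite <- S1, <- S2.
  destruct (path_C1 _ _ _ _ Hp) as [sg [s0 [sinc [slim spc]]]].
  assert (Ha := path_arg_cont _ _ _ _ Hp).
  assert (Hd : forall s, 0 <= s -> t s <> 0%C /\ is_arg (t s) (a s)).
  { intros s Hs. destruct (path_domain _ _ _ _ Hp s Hs) as [D1 [_ D3]]. auto. }
  assert (sg0 : forall n, 0 <= sg n) by (induction n; [lra | specialize (sinc n); lra]).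
  assert (R : forall n T, 0 <= T <= sg n -> is_RInt (V := C_R_NormedModule) (fun s => (g (clog (t s) (a s)) / t
    s * CDerive t s)%C) 0 T
    (G (clog (t T) (a T)) - G (clog (t 0%R) (a 0)))%C).
  { induction n as [|n IH]; intros T HT.
    - replace T with 0 by lra. apply (path_piece G g g1); auto; [lra|].
      destruct (spc O) as [gg [dg [K1 [K2 K3]]]]. exists gg, dg. split; [|split]; auto. intros s Hs. apply K3.
      specialize (sinc O); lra.
    - destruct (Rle_dec T (sg n)) as [H|H]; [apply IH; lra|].
      replace (G (clog (t T) (a T)) - G (clog (t 0%R) (a 0)))%C with
       (plus (G := C_R_NormedModule) (G (clog (t (sg n)) (a (sg n))) - G (clog (t 0%R) (a 0)))%C (G (clog (t T)
         (a T)) - G (clog (t (sg n)) (a (sg n))))%C).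
      2: { change ((G (clog (t (sg n)) (a (sg n))) - G (clog (t 0%R) (a 0)) + (G (clog (t T) (a T)) - G (clog
             (t (sg n)) (a (sg n)))))%C = (G (clog (t T) (a T)) - G (clog (t 0%R) (a 0)))%C). ring. }
      apply is_RInt_Chasles with (sg n).
      + apply IH. specialize (sg0 n); lra.
      + apply (path_piece G g g1); auto; [specialize (sg0 n); lra|].
        destruct (spc n) as [gg [dg [K1 [K2 K3]]]]. exists gg, dg. split; [|split]; auto. intros s Hs.
        apply K3; lra. }
  intros T HT. assert (Ev : eventually (fun n => T < sg n)).
  { apply (slim (fun x => T < x)). exists T. auto. }
  destruct Ev as [N HN]. apply (R N). specialize (HN N (le_n N)). lra.
Qed.

(** The path eventually stays in |arg t| < 1, |t| > e^X, because its argument tends to 0 and its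
    modulus to infinity. There G is small, so the increments of G converge to minus its initial
    value, whichever the path. *)
Lemma int_to_infty (G g g1 : C -> C) (f : C -> R -> C) (z : C) (theta : R) B s0 :
  Hol G g -> Hol g g1 -> 0 <= B -> (forall x y,
    s0 <= x -> Rabs y <= 1 -> Cmod (G (RtoC x + RtoC y * Ci)%C) <= B * exp (- (x / 2))) ->
  (forall (r : C) (a : R), r <> 0%C -> is_arg r a -> f r a = (g (clog r a) / r)%C) ->
  is_int_to_infty f z theta (- G (clog z theta))%C.
Proof.
  intros HG Hg B0 HB Hf t a Hp.
  assert (Hd : forall s, 0 <= s -> t s <> 0%C /\ is_arg (t s) (a s)).
  { intros s Hs. destruct (path_domain _ _ _ _ Hp s Hs) as [D1 [_ D3]]. auto. }
  intros P [eps HP].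
  (* Beyond this X one has B e^(-x/2) < eps; B + 1 avoids dividing by B = 0. *)
  set (X := Rmax s0 (- 2 * ln (eps / (B + 1)))).
  assert (L1 : Rbar_locally p_infty (fun s => exp X < Cmod (t s))).
  { apply (path_end_mod _ _ _ _ Hp (fun y => exp X < y)). exists (exp X). auto. }
  assert (L2 : Rbar_locally p_infty (fun s => Rabs (a s) < 1)).
  { assert (Q := path_end_arg _ _ _ _ Hp).
    assert (Q2 : Rbar_locally p_infty (fun s => Rabs (a s - 0) < 1)) by exact (Q _ (locally_ball 0 (mkposreal 1
      Rlt_0_1))).
    refine (filter_imp _ _ _ Q2). intros s Hs. rewrite Rminus_0_r in Hs. exact Hs. }
  destruct (filter_and _ _ L1 L2) as [T0 HT0].
  exists (fun x => x = 0) (fun T => Rmax 0 T0 < T).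
  { reflexivity. }
  { exists (Rmax 0 T0). auto. }
  intros x T -> HT. assert (T1 : 0 < T) by (eapply Rle_lt_trans; [apply Rmax_l | exact HT]).
  assert (T2 : T0 < T) by (eapply Rle_lt_trans; [apply Rmax_r | exact HT]).
  exists (G (clog (t T) (a T)) - G (clog z theta))%C. split.
  - simpl. apply is_RInt_ext with (fun s => (g (clog (t s) (a s)) / t s * CDerive t s)%C).
    + rewrite Rmin_left, Rmax_right by lra. intros s Hs. destruct (Hd s ltac:(lra)) as [D1 D2].
      rewrite Hf by auto. reflexivity.
    + apply (path_integral G g g1 z theta t a); auto; lra.
  - apply HP. apply C_NormedModule_mixin_compat1.
    destruct (HT0 T T2) as [E1 E2].
    change (Cmod (G (clog (t T) (a T)) - G (clog z theta) - - G (clog z theta))%C < eps).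
    replace (G (clog (t T) (a T)) - G (clog z theta) - - G (clog z theta))%C with (G (clog (t T) (a T))) by
      ring.
    set (x := ln (Cmod (t T))).
    assert (Hx : X < x).
    { unfold x. rewrite <- (ln_exp X). apply ln_increasing; [apply exp_pos | exact E1]. }
    replace (clog (t T) (a T)) with (RtoC x + RtoC (a T) * Ci)%C by (apply C_eq; unfold clog, x; simpl; ring).
    assert (X1 : s0 <= X) by apply Rmax_l. assert (X2 : - 2 * ln (eps / (B + 1)) <= X) by apply Rmax_r.
    eapply Rle_lt_trans; [apply HB; lra|].
    assert (e0 := cond_pos eps).
    assert (X3 : exp (- (x / 2)) <= eps / (B + 1)).
    { rewrite <- (exp_ln (eps / (B + 1))) by (apply Rdiv_lt_0_compat; lra). apply exp_le. lra. }
    apply Rle_lt_trans with (B * (eps / (B + 1))); [apply Rmult_le_compat_l; auto|].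
    apply Rmult_lt_reg_r with (B + 1); [lra|]. field_simplify; [|lra]. nra.
Qed.

(** * Dependence on the order *)

Lemma exp_half_small eps : 0 < eps -> exists X, forall x, X <= x -> exp (- (x / 2)) <= eps.
Proof.
  intros H. exists (- 2 * ln eps). intros x Hx. rewrite <- (exp_ln eps) by auto. apply exp_le. lra.
Qed.

(** Integrating B e^(-x/2) along the real axis gives 2 B e^(-x/2), and a vertical segment of length
    at most 1 adds B e^(-x/2): hence the factor 3. *)
Lemma limit_in_sector G g B s0 : Hol G g -> 0 <= B ->
  (forall x y, s0 <= x -> Rabs y <= 1 -> Cmod (g (RtoC x + RtoC y * Ci)%C) <= B * exp (- (x / 2))) ->
  exists L, forall x y, s0 <= x -> Rabs y <= 1 -> Cmod (G (RtoC x + RtoC y * Ci)%C - L)%C <= 3 * B * exp (- (x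
    / 2)).
Proof.
  intros HG B0 Hg.
  assert (R1 : forall x x', s0 <= x -> x <= x' -> Cmod (G (RtoC x') - G (RtoC x))%C <= 2 * B * exp (- (x / 2))).
  { intros x x' Hx Hx'.
    apply Rle_trans with (- (2 * B) * exp (- (x' / 2)) - - (2 * B) * exp (- (x / 2))).
    - apply (curve_mvt (fun y => G (RtoC y)) (fun y => g (RtoC y)) (fun y => - (2 * B) * exp (- (y / 2))) (fun
        y => B * exp (- (y / 2)))); auto.
      + intros s _. apply cder_Hol_R, HG.
      + intros s _. auto_derive; auto. unfold Rdiv. field.
      + intros s Hs. assert (Q := Hg s 0 ltac:(lra)). rewrite Rabs_R0 in Q. specialize (Q ltac:(lra)).
        replace (RtoC s + 0 * Ci)%C with (RtoC s) in Q by ring. exact Q.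
    - assert (p := exp_pos (- (x' / 2))). nra. }
  assert (Cau : forall (pr : C -> R), (forall a b : C,
    Rabs (pr a - pr b) <= Cmod (a - b)%C) -> ex_finite_lim_seq (fun n => pr (G (RtoC (INR n))))).
  { intros pr Hpr. apply ex_lim_seq_cauchy_corr. intro eps.
    destruct (exp_half_small (eps / (2 * B + 1))) as [X HX]; [apply Rdiv_lt_0_compat; [apply cond_pos | lra]|].
    destruct (INR_unbounded (Rmax X s0)) as [N HN]. exists N.
    assert (m1 := Rmax_l X s0). assert (m2 := Rmax_r X s0).
    assert (Sm : forall n m, (N <= n)%nat -> (n <= m)%nat -> Rabs (pr (G (RtoC (INR m))) - pr (G (RtoC (INR
      n)))) < eps).
    { intros n m Hn Hm. apply le_INR in Hn. apply le_INR in Hm. eapply Rle_lt_trans; [apply Hpr|].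
      eapply Rle_lt_trans; [apply R1; lra|].
      assert (E := HX (INR n) ltac:(lra)). assert (e0 := cond_pos eps).
      apply Rle_lt_trans with (2 * B * (eps / (2 * B + 1))); [apply Rmult_le_compat_l; lra|].
      apply Rmult_lt_reg_r with (2 * B + 1); [lra|]. field_simplify; [|lra]. nra. }
    intros n m Hn Hm. destruct (Nat.le_ge_cases n m) as [H|H]; [rewrite Rabs_minus_sym|]; apply Sm; auto. }
  destruct (Cau fst) as [l1 L1]; [intros; apply (Cmod_fst (a - b)%C)|].
  destruct (Cau snd) as [l2 L2]; [intros; apply (Cmod_snd (a - b)%C)|].
  exists (l1, l2).
  assert (R2 : forall x, s0 <= x -> Cmod (G (RtoC x) - (l1, l2))%C <= 2 * B * exp (- (x / 2))).
  { intros x Hx. apply le_epsilon. intros eps He. assert (e2 : 0 < eps / 2) by lra.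
    apply is_lim_seq_spec in L1. apply is_lim_seq_spec in L2.
    destruct (L1 (mkposreal _ e2)) as [N1 HN1]. destruct (L2 (mkposreal _ e2)) as [N2 HN2]. simpl in HN1, HN2.
    destruct (INR_unbounded x) as [N3 HN3].
    set (n := max N1 (max N2 N3)).
    assert (Hn : x <= INR n) by (apply Rle_trans with (INR N3); [lra | apply le_INR; unfold n; lia]).
    specialize (HN1 n ltac:(unfold n; lia)). specialize (HN2 n ltac:(unfold n; lia)).
    eapply Rle_trans; [apply (Cmod_triangle3 _ (G (RtoC (INR n))))|]. rewrite Cmod_minus_sym.
    apply Rplus_le_compat; [apply R1; auto|].
    destruct (G (RtoC (INR n))) as [y1 y2]. unfold Cminus, Cplus, Copp; simpl in *.
    eapply Rle_trans; [apply Cmod_le_sum|]. unfold Rminus in HN1, HN2. lra. }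
  intros x y Hx Hy.
  assert (R3 : Cmod (G (RtoC x + RtoC y * Ci) - G (RtoC x))%C <= B * exp (- (x / 2))).
  { set (Y := fun s : R => (RtoC x + RtoC s * (RtoC y * Ci))%C).
    replace (G (RtoC x + RtoC y * Ci) - G (RtoC x))%C with (G (Y 1) - G (Y 0))%C by (unfold Y; do 2 f_equal;
      f_equal; ring).
    set (K := B * exp (- (x / 2))). assert (K0 : 0 <= K) by (apply Rmult_le_pos; auto; apply Rlt_le, exp_pos).
    apply Rle_trans with (K * 1 - K * 0); [|lra].
    apply (curve_mvt (fun s => G (Y s)) (fun s => g (Y s) * (RtoC y * Ci))%C (fun s => K * s) (fun _ => K));
      try lra.
    - intros s _. apply (cder_Hol_line G g), HG.
    - intros s _. auto_derive; auto; ring.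
    - intros s Hs. rewrite !Cmod_mult, Cmod_Ci, Cmod_R, Rmult_1_r.
      apply Rle_trans with (K * 1); [|lra]. apply Rmult_le_compat; auto using Cmod_ge_0, Rabs_pos.
      unfold Y. replace (RtoC x + RtoC s * (RtoC y * Ci))%C with (RtoC x + RtoC (s * y) * Ci)%C by (rewrite
        RtoC_mult; ring).
      apply Hg; auto. rewrite Rabs_mult, Rabs_pos_eq by lra. generalize (Rabs_pos y); nra. }
  eapply Rle_trans; [apply (Cmod_triangle3 _ (G (RtoC x)))|]. specialize (R2 x Hx). lra.
Qed.

(** Purely algebraic: U' cancels between the two Wronskians. It is applied to K_mu and to K_nu
    itself, and the two are subtracted. *)
Lemma K_I_identity K K' I I' U U' w : (K w * I' w - K' w * I w = 1)%C ->
  (U w = - K w * Wr I I' U U' w + I w * Wr K K' U U' w)%C.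
Proof.
  intros H. unfold Wr. transitivity (U w * (K w * I' w - K' w * I w))%C; [rewrite H; ring | ring].
Qed.

Lemma sq_diff_bound mu nu : 0 < nu -> Rabs (mu - nu) <= 1 -> Rabs (mu ^ 2 - nu ^ 2) <= (2 * nu + 1) * Rabs (mu
  - nu).
Proof.
  intros H0 H. replace (mu ^ 2 - nu ^ 2) with ((mu + nu) * (mu - nu)) by ring. rewrite Rabs_mult.
  apply Rmult_le_compat_r; [apply Rabs_pos|]. apply Rabs_le_between in H. apply Rabs_le; lra.
Qed.

Lemma Wr_lip_real nu K K' F F' x B c mu U U' : IsK nu K K' -> IsK mu U U' ->
  Cmod (F (RtoC x)) <= B -> Cmod (F' (RtoC x)) <= B ->
  Rabs (kw mu x - kw nu x) <= c -> Rabs (dkw mu x - dkw nu x) <= c ->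
  Cmod (Wr F F' U U' (RtoC x) - Wr F F' K K' (RtoC x))%C <= 2 * B * c.
Proof.
  intros [_ HK] [_ HU] B1 B2 c1 c2. destruct (HK x) as [K1 K2], (HU x) as [U1 U2].
  unfold Wr. rewrite K1, K2, U1, U2.
  replace (F x * dkw mu x - F' x * kw mu x - (F x * dkw nu x - F' x * kw nu x))%C with
    (F x * RtoC (dkw mu x - dkw nu x) - F' x * RtoC (kw mu x - kw nu x))%C by (rewrite !RtoC_minus; ring).
  eapply Rle_trans; [apply Cmod_minus_le|]. rewrite !Cmod_mult, !Cmod_R.
  assert (Cmod (F x) * Rabs (dkw mu x - dkw nu x) <= B * c) by (apply Rmult_le_compat;
    auto using Cmod_ge_0, Rabs_pos).
  assert (Cmod (F' x) * Rabs (kw mu x - kw nu x) <= B * c) by (apply Rmult_le_compat;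
    auto using Cmod_ge_0, Rabs_pos).
  lra.
Qed.

Lemma Wr_segment nu mu F F' U U' x k N B : Sol nu F F' -> Sol mu U U' ->
  (forall s, 0 <= s <= 1 -> Cmod (F (x + RtoC s * k)%C) <= B) ->
  (forall s, 0 <= s <= 1 -> Cmod (U (x + RtoC s * k)%C) <= N) -> forall s, 0 <= s <= 1 ->
  Cmod (Wr F F' U U' (x + RtoC s * k) - Wr F F' U U' x)%C <= Rabs (mu ^ 2 - nu ^ 2) * (B * N * Cmod k).
Proof.
  intros HF HU HB HN s Hs. assert (HW := Hol_Wr nu mu F F' U U' HF HU).
  set (Q := Rabs (mu ^ 2 - nu ^ 2) * (B * N * Cmod k)).
  assert (B0 : 0 <= B) by (eapply Rle_trans; [apply Cmod_ge_0 | apply (HB 0); lra]).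
  assert (N0 : 0 <= N) by (eapply Rle_trans; [apply Cmod_ge_0 | apply (HN 0); lra]).
  assert (Q0 : 0 <= Q) by (apply Rmult_le_pos; [apply Rabs_pos | repeat apply Rmult_le_pos; auto;
    apply Cmod_ge_0]).
  replace (Wr F F' U U' x) with (Wr F F' U U' (x + RtoC 0 * k)%C) by (f_equal; ring).
  apply Rle_trans with (Q * s - Q * 0); [|nra].
  apply (curve_mvt (fun r => Wr F F' U U' (x + RtoC r * k)%C) (fun r => RtoC (mu ^ 2 - nu ^ 2) * (F (x + RtoC r
    * k) * U (x + RtoC r * k)) * k)%C (fun r => Q * r) (fun _ => Q)); try lra.
  - intros r _. apply (cder_Hol_line _ _ x k r HW).
  - intros r _. auto_derive; auto; ring.
  - intros r Hr. rewrite !Cmod_mult, Cmod_R. unfold Q. rewrite !Rmult_assoc.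
    apply Rmult_le_compat_l; [apply Rabs_pos|].
    rewrite <- !Rmult_assoc. apply Rmult_le_compat_r; [apply Cmod_ge_0|].
    apply Rmult_le_compat; auto using Cmod_ge_0; [apply HB | apply HN]; lra.
Qed.

(* By [K_I_identity] and [Wr_segment], a bound [N] for [U] on the segment improves to [A0 + N / 2]. *)
Lemma K_lipschitz nu K K' (w : C) : 0 < nu -> IsK nu K K' -> exists A d, 0 <= A /\ 0 < d /\ d <= 1 /\
  forall mu U U', Rabs (mu - nu) < d -> IsK mu U U' -> forall s, 0 <= s <= 1 ->
    Cmod (U (RtoC (sz nu) + RtoC s * (w - RtoC (sz nu))) - K (RtoC (sz nu) + RtoC s * (w - RtoC (sz nu))))%C <=
      A * Rabs (mu - nu).
Proof.
  intros H0 HK. set (x := sz nu). set (k := (w - RtoC x)%C).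
  assert (x1 : 1 <= x) by (unfold x, sz; generalize (Rabs_pos (nu ^ 2 - / 4)); lra).
  assert (HI := Sol_BI nu (Rlt_le _ _ H0)).
  set (r := x + Cmod k).
  assert (Hr : forall s, 0 <= s <= 1 -> Cmod (RtoC x + RtoC s * k)%C <= r).
  { intros s Hs. eapply Rle_trans; [apply Cmod_triangle|]. rewrite Cmod_mult, !Cmod_R, !Rabs_pos_eq by lra.
    unfold r. generalize (Cmod_ge_0 k); nra. }
  destruct (proj1 HI r) as [b2 [b20 Hb2]]. destruct (proj1 (proj1 HK) r) as [b3 [b30 Hb3]].
  set (B := b2 + b3). assert (B0 : 0 <= B) by (unfold B; lra).
  assert (BI1 : forall v, Cmod v <= r -> Cmod (BI nu v) <= B /\ Cmod (dBI nu v) <= B /\ Cmod (K v) <= B /\ Cmod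
    (K' v) <= B).
  { intros v Hv. destruct (Hb2 v v Hv Hv) as [P1 [P2 _]], (Hb3 v v Hv Hv) as [P3 [P4 _]].
    unfold B; repeat split; lra. }
  destruct (kw_lip (nu + 1)) as [l1 [l10 Hl1]]. destruct (dkw_lip (nu + 1)) as [l2 [l20 Hl2]].
  set (c := l1 + l2). assert (c0 : 0 <= c) by (unfold c; lra).
  set (D := Cmod k). assert (D0 : 0 <= D) by apply Cmod_ge_0.
  (* The condition 4 Z d <= 1 will bring the coefficient of N in the bootstrap down to 1/2; the
     factor 2 nu + 1 comes from [sq_diff_bound]. *)
  set (Z := B * B * D * (2 * nu + 1)). assert (Z0 : 0 <= Z) by (unfold Z; repeat apply Rmult_le_pos; lra).
  set (d := / (4 * Z + 1)). assert (d0 : 0 < d) by (apply Rinv_0_lt_compat; lra).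
  assert (d1 : d <= 1) by (unfold d; rewrite <- Rinv_1; apply Rinv_le_contravar; lra).
  assert (Zd : 4 * Z * d <= 1) by (unfold d; apply Rmult_le_reg_r with (4 * Z + 1); [lra|];
    rewrite Rmult_assoc, Rinv_l; lra).
  set (A0 := B + 4 * (B * B) * c).
  assert (A00 : 0 <= A0) by (unfold A0; generalize (Rmult_le_pos _ _ B0 B0); intros; nra).
  set (A := 4 * (B * B) * c + 4 * Z * A0).
  exists A, d. split; [unfold A; generalize (Rmult_le_pos _ _ B0 B0); intros; nra|]. split; auto. split; auto.
  intros mu U U' Hmu HU.
  set (e := Rabs (mu - nu)) in *. assert (e0 : 0 <= e) by apply Rabs_pos.
  assert (Mmu : Rabs mu <= nu + 1).
  { replace mu with (nu + (mu - nu)) by ring. eapply Rle_trans; [apply Rabs_triang|].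
    rewrite (Rabs_pos_eq nu) by lra. fold e; lra. }
  assert (Mnu : Rabs nu <= nu + 1) by (rewrite Rabs_pos_eq; lra).
  assert (kd : Rabs (kw mu x - kw nu x) <= e * c).
  { eapply Rle_trans; [apply (Hl1 mu nu x); auto|]. fold e. apply Rmult_le_compat_l; auto.
    assert (exp (- x) * exp (- exp x) <= 1 * 1) by (apply Rmult_le_compat; try (apply Rlt_le, exp_pos);
      rewrite <- exp_0; apply exp_le; [lra | generalize (exp_pos x); lra]).
    unfold c. nra. }
  assert (dkd : Rabs (dkw mu x - dkw nu x) <= e * c).
  { eapply Rle_trans; [apply (Hl2 mu nu x); auto|]. fold e. apply Rmult_le_compat_l; auto.
    assert (exp (- exp x) <= 1) by (rewrite <- exp_0; apply exp_le; generalize (exp_pos x); lra).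
    unfold c. nra. }
  assert (sq : Rabs (mu ^ 2 - nu ^ 2) <= (2 * nu + 1) * e) by (apply sq_diff_bound; auto; fold e; lra).
  assert (xr : Cmod (RtoC x) <= r) by (replace (RtoC x) with (RtoC x + RtoC 0 * k)%C by ring; apply Hr; lra).
  destruct (BI1 (RtoC x) xr) as [P1 [P2 [P3 P4]]].
  assert (R1 := Wr_lip_real nu K K' (BI nu) (dBI nu) x B (e * c) mu U U' HK HU P1 P2 kd dkd).
  assert (R2 := Wr_lip_real nu K K' K K' x B (e * c) mu U U' HK HU P3 P4 kd dkd).
  assert (W1 : forall v, Wr K K' (BI nu) (dBI nu) v = 1%C) by (intro v; apply (Wr_K_I nu); auto).
  (* Wronskians of two solutions of order nu are constant, so each difference at v splits into a
     variation from x to v, bounded by [Wr_segment], and a discrepancy at the real point x, bounded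
     by the Lipschitz estimates on the axis. *)
  assert (Id : forall N s, 0 <= s <= 1 -> (forall y, 0 <= y <= 1 -> Cmod (U (RtoC x + RtoC y * k)%C) <= N) ->
     Cmod (U (RtoC x + RtoC s * k) - K (RtoC x + RtoC s * k))%C <= 2 * B * (2 * B * (e * c) + Rabs (mu ^ 2 - nu
       ^ 2) * (B * N * D))).
  { intros N s Hs HN.
    assert (S1 := Wr_segment nu mu (BI nu) (dBI nu) U U' (RtoC x) k N B HI (proj1 HU) (fun s Hs => proj1 (BI1 _
      (Hr s Hs))) HN s Hs).
    assert (S2 := Wr_segment nu mu K K' U U' (RtoC x) k N B (proj1 HK) (proj1 HU) (fun s Hs => proj1 (proj2
      (proj2 (BI1 _ (Hr s Hs))))) HN s Hs).
    fold D in S1, S2.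
    set (v := (RtoC x + RtoC s * k)%C) in *.
    destruct (BI1 v (Hr s Hs)) as [V1 [V2 [V3 V4]]].
    assert (I1 := K_I_identity K K' (BI nu) (dBI nu) U U' v (W1 v)).
    assert (I2 := K_I_identity K K' (BI nu) (dBI nu) K K' v (W1 v)).
    assert (C1 : Wr (BI nu) (dBI nu) K K' v = Wr (BI nu) (dBI nu) K K' (RtoC x)) by (apply (Wr_const nu); auto;
      apply HK).
    assert (C2 : Wr K K' K K' v = Wr K K' K K' (RtoC x)) by (apply (Wr_const nu); apply HK).
    replace (U v - K v)%C with (- K v * ((Wr (BI nu) (dBI nu) U U' v - Wr (BI nu) (dBI nu) U U' (RtoC x)) + (Wr
      (BI nu) (dBI nu) U U' (RtoC x) - Wr (BI nu) (dBI nu) K K' (RtoC x)))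
       + BI nu v * ((Wr K K' U U' v - Wr K K' U U' (RtoC x)) + (Wr K K' U U' (RtoC x) - Wr K K' K K' (RtoC
           x))))%C.
    2: { assert (Ed : (U v - K v = (- K v * Wr (BI nu) (dBI nu) U U' v + BI nu v * Wr K K' U U' v)
           - (- K v * Wr (BI nu) (dBI nu) K K' v + BI nu v * Wr K K' K K' v))%C) by (rewrite <- I1, <- I2;
               reflexivity).
         rewrite Ed, C1, C2. ring. }
    set (T := 2 * B * (e * c) + Rabs (mu ^ 2 - nu ^ 2) * (B * N * D)).
    eapply Rle_trans; [apply Cmod_triangle|]. rewrite !Cmod_mult, Cmod_opp.
    replace (2 * B * T) with (B * T + B * T) by ring.
    apply Rplus_le_compat; apply Rmult_le_compat; auto using Cmod_ge_0; (eapply Rle_trans;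
      [apply Cmod_triangle|]); unfold T; lra. }
  assert (Bd : forall s, 0 <= s <= 1 -> Cmod (U (RtoC x + RtoC s * k)%C) <= 2 * A0).
  { apply (bootstrap (fun s => Cmod (U (RtoC x + RtoC s * k)%C)) 1 A0); [lra | |].
    - intros s _. apply (continuity_Cmod_line U U'), HU.
    - intros N HN s Hs. assert (N0 : 0 <= N) by (eapply Rle_trans; [apply Cmod_ge_0 | apply (HN s Hs)]).
      assert (Q := Id N s Hs HN). destruct (BI1 _ (Hr s Hs)) as [_ [_ [V3 _]]].
      eapply Rle_trans; [apply (Cmod_le_minus _ (K (RtoC x + RtoC s * k)%C))|].
      assert (Y : Rabs (mu ^ 2 - nu ^ 2) * (B * N * D) <= (2 * nu + 1) * d * (B * N * D)).
      { apply Rmult_le_compat_r; [repeat apply Rmult_le_pos; auto|]. eapply Rle_trans; [exact sq|].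
        apply Rmult_le_compat_l; lra. }
      assert (Y2 : 2 * B * ((2 * nu + 1) * d * (B * N * D)) <= N / 2).
      { replace (2 * B * ((2 * nu + 1) * d * (B * N * D))) with ((4 * Z * d) * (N / 2)) by (unfold Z; field).
        rewrite <- (Rmult_1_l (N / 2)) at 2. apply Rmult_le_compat_r; lra. }
      assert (Y3 : 2 * B * (Rabs (mu ^ 2 - nu ^ 2) * (B * N * D)) <= N / 2) by (eapply Rle_trans;
        [apply Rmult_le_compat_l; [lra | exact Y] | exact Y2]).
      assert (Y4 : 2 * B * (2 * B * (e * c)) <= 4 * (B * B) * c).
      { replace (2 * B * (2 * B * (e * c))) with (4 * (B * B) * c * e) by ring.
        rewrite <- (Rmult_1_r (4 * (B * B) * c)) at 2.
        apply Rmult_le_compat_l; [|lra]. generalize (Rmult_le_pos _ _ B0 B0); intros; nra. }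
      unfold A0. lra. }
  (* The bound 2 * A0, which does not depend on mu, re-enters [Id]; since |mu^2 - nu^2| is of size
     |mu - nu|, so is the result. *)
  intros s Hs. assert (Q := Id (2 * A0) s Hs Bd). eapply Rle_trans; [exact Q|].
  assert (Y : Rabs (mu ^ 2 - nu ^ 2) * (B * (2 * A0) * D) <= (2 * nu + 1) * e * (B * (2 * A0) * D)).
  { apply Rmult_le_compat_r; [repeat apply Rmult_le_pos; lra|]. exact sq. }
  apply Rle_trans with (2 * B * (2 * B * (e * c) + (2 * nu + 1) * e * (B * (2 * A0) * D))).
  - apply Rmult_le_compat_l; lra.
  - right. unfold A, Z. ring.
Qed.

Lemma K_lipschitz_pt nu K K' (w : C) : 0 < nu -> IsK nu K K' -> exists A d, 0 <= A /\ 0 < d /\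
  forall mu U U', Rabs (mu - nu) < d -> IsK mu U U' -> Cmod (U w - K w)%C <= A * Rabs (mu - nu).
Proof.
  intros H0 HK. destruct (K_lipschitz nu K K' w H0 HK) as [A [d [A0 [d0 [_ H]]]]]. exists A, d.
  repeat split; auto.
  intros mu U U' Hmu HU. assert (Q := H mu U U' Hmu HU 1 ltac:(lra)).
  replace (RtoC (sz nu) + RtoC 1 * (w - RtoC (sz nu)))%C with w in Q by ring. exact Q.
Qed.

(** The Lipschitz bound at mu = nu forces distance 0. *)
Lemma IsK_unique nu K K' U U' w : 0 < nu -> IsK nu K K' -> IsK nu U U' -> U w = K w.
Proof.
  intros H0 HK HU. destruct (K_lipschitz_pt nu K K' w H0 HK) as [A [d [A0 [d0 H]]]].
  assert (Q := H nu U U'). replace (nu - nu) with 0 in Q by ring. rewrite Rabs_R0, Rmult_0_r in Q.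
  apply Ceq_minus, Cmod_eq_0, Rle_antisym; [|apply Cmod_ge_0]. auto.
Qed.

(** At nonintegral order, [IsK_nonint] and uniqueness. At an integer the definition is a limit over
    mu; the punctured unit neighbourhood contains nonintegral orders only, and their K_mu converge
    to K by [K_lipschitz_pt]. *)
Lemma BesselK_eq nu K K' w : 0 < nu -> IsK nu K K' -> BesselK nu (cexp w) (snd w) = K w.
Proof.
  intros H0 HK.
  assert (NI : forall n mu V V', INR n < mu < INR n + 1 -> IsK mu V V' -> BesselK_nonint mu (cexp w) (snd w) =
    V w).
  { intros n mu V V' Hmu HV. rewrite (BesselK_nonint_eq n) by auto.
    destruct (IsK_nonint n mu Hmu) as [U [U' [HU E]]].
    rewrite <- E. apply (IsK_unique mu V V' U U'); auto. generalize (pos_INR n); lra. }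
  unfold BesselK. destruct (Req_dec_T (frac_part nu) 0) as [Hf|Hf].
  - destruct (fp_nat nu Hf) as [m Em].
    assert (m0 : (0 < m)%Z) by (apply lt_IZR; lra).
    set (n := Z.to_nat (m - 1)).
    assert (En : nu = INR n + 1) by (unfold n; rewrite INR_IZR_INZ, Z2Nat.id, minus_IZR by lia; lra).
    destruct (K_lipschitz_pt nu K K' w H0 HK) as [A [d [A0 [d0 H]]]].
    assert (HL : forall pr : C -> R, (forall a b : C, Rabs (pr a - pr b) <= Cmod (a - b)%C) ->
       is_lim (fun mu => pr (BesselK_nonint mu (cexp w) (snd w))) nu (pr (K w))).
    { intros pr Hpr. apply is_lim_spec. intro eps.
      assert (dd : 0 < Rmin (Rmin d 1) (eps / (A + 1))).
      { apply Rmin_pos; [apply Rmin_pos; lra | apply Rdiv_lt_0_compat; [apply cond_pos | lra]]. }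
      exists (mkposreal _ dd). intros mu Hmu Hne.
      assert (Hmu' : Rabs (mu - nu) < Rmin (Rmin d 1) (eps / (A + 1))) by exact Hmu.
      assert (M1 : Rabs (mu - nu) < d) by (eapply Rlt_le_trans; [exact Hmu' | eapply Rle_trans; apply Rmin_l]).
      assert (M2 : Rabs (mu - nu) < 1) by (eapply Rlt_le_trans; [exact Hmu' | eapply Rle_trans;
        [apply Rmin_l | apply Rmin_r]]).
      assert (M3 : Rabs (mu - nu) < eps / (A + 1)) by (eapply Rlt_le_trans; [exact Hmu' | apply Rmin_r]).
      assert (n0 := pos_INR n). apply Rabs_def2 in M2.
      destruct (IsK_exists mu) as [U [U' HU]]; [lra|].
      assert (E : BesselK_nonint mu (cexp w) (snd w) = U w).
      { destruct (Rlt_dec mu nu) as [L|L]; [apply (NI n mu U U'); auto; lra|].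
        apply (NI (S n) mu U U'); auto. rewrite S_INR. split; [|lra].
        destruct (Rtotal_order mu nu) as [X|[X|X]]; try lra. }
      rewrite E. eapply Rle_lt_trans; [apply Hpr|]. eapply Rle_lt_trans; [apply (H mu U U'); auto|].
      assert (e0 := cond_pos eps).
      apply Rle_lt_trans with (A * (eps / (A + 1))); [apply Rmult_le_compat_l; lra|].
      apply Rmult_lt_reg_r with (A + 1); [lra|]. field_simplify; [|lra]. nra. }
    unfold CLim, Re, Im. apply C_eq; cbn [fst snd].
    + rewrite (is_lim_unique _ _ _ (HL fst (fun a b => Cmod_fst (a - b)%C))). reflexivity.
    + rewrite (is_lim_unique _ _ _ (HL snd (fun a b => Cmod_snd (a - b)%C))). reflexivity.
  - destruct (nfloor_ex nu) as [n Hn]; [lra|]. apply (NI n nu K K'); auto. split; [|lra].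
    destruct (proj1 Hn) as [L|E]; auto. exfalso. apply Hf. rewrite <- E. unfold frac_part.
    rewrite Int_part_INR, <- INR_IZR_INZ. ring.
Qed.

(* [(W(F, K_mu) - W(F, K_nu)) / (mu^2 - nu^2)] tends, as [mu] tends to [nu], to the primitive [G] of [F K_nu] vanishing at infinity. *)
Lemma Wr_quotient nu K K' F F' G C0 (w : C) : 0 < nu -> IsK nu K K' -> Sol nu F F' -> Hol G (fun v => F v * K
  v)%C ->
  0 <= C0 -> (forall x : R, sz nu <= x -> Cmod (G (RtoC x)) <= C0 * exp (- (x / 2))) ->
  exists A d, 0 <= A /\ 0 < d /\ forall mu U U', mu <> nu -> Rabs (mu - nu) < d -> IsK mu U U' ->
    Cmod ((Wr F F' U U' w - Wr F F' K K' w) / RtoC (mu ^ 2 - nu ^ 2) - G w)%C <= A * Rabs (mu - nu).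
Proof.
  intros H0 HK HF HG C00 HGi.
  destruct (K_lipschitz nu K K' w H0 HK) as [A1 [d [A10 [d0 [d1 HL]]]]].
  set (x := sz nu) in *. set (k := (w - RtoC x)%C) in *.
  assert (x1 : 1 <= x) by (unfold x, sz; generalize (Rabs_pos (nu ^ 2 - / 4)); lra).
  destruct (sector_growth nu F F' HF) as [B1 [B10 HB1]].
  destruct (kw_lip (nu + 1)) as [l1 [l10 Hl1]]. destruct (dkw_lip (nu + 1)) as [l2 [l20 Hl2]].
  set (r := x + Cmod k).
  assert (Hr : forall s, 0 <= s <= 1 -> Cmod (RtoC x + RtoC s * k)%C <= r).
  { intros s Hs. eapply Rle_trans; [apply Cmod_triangle|]. rewrite Cmod_mult, !Cmod_R, !Rabs_pos_eq by lra.
    unfold r. generalize (Cmod_ge_0 k); nra. }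
  destruct (Hol_bound _ _ (proj1 HF) r) as [B2 [B20 HB2]].
  (* The first summand comes from the segment between x and w, the second from the real half-line
     beyond x. *)
  set (A := B2 * A1 * Cmod k + B1 * l1).
  (* Within distance nu the order mu is positive, so that |mu^2 - nu^2| >= nu |mu - nu|. *)
  exists A, (Rmin d nu). split; [unfold A; apply Rplus_le_le_0_compat; [repeat apply Rmult_le_pos; auto;
    apply Cmod_ge_0 | now apply Rmult_le_pos]|].
  split; [apply Rmin_pos; auto|]. intros mu U U' Hne Hmu' HU.
  assert (Hmu : Rabs (mu - nu) < d) by (eapply Rlt_le_trans; [exact Hmu' | apply Rmin_l]).
  assert (Hmn : Rabs (mu - nu) < nu) by (eapply Rlt_le_trans; [exact Hmu' | apply Rmin_r]).
  apply Rabs_def2 in Hmn.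
  set (e := Rabs (mu - nu)) in *. assert (e0 : 0 < e) by (apply Rabs_pos_lt; lra).
  assert (Hmu2 := Hmu). apply Rabs_def2 in Hmu2.
  assert (Mmu : Rabs mu <= nu + 1) by (apply Rabs_le; lra).
  assert (Mnu : Rabs nu <= nu + 1) by (rewrite Rabs_pos_eq; lra).
  set (q := mu ^ 2 - nu ^ 2). assert (q0 : q <> 0).
  { unfold q. replace (mu ^ 2 - nu ^ 2) with ((mu + nu) * (mu - nu)) by ring.
    apply Rmult_integral_contrapositive_currified; lra. }
  assert (qC : RtoC q <> 0%C) by now apply RtoC_neq_0.
  (* The second Wronskian is constant, so H' = F (K_mu - K_nu), which is already of size |mu -
     nu|. *)
  set (H := fun v => ((Wr F F' U U' v - Wr F F' K K' v) / RtoC q - G v)%C).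
  assert (HH : Hol H (fun v => F v * (U v - K v))%C).
  { assert (Y := Hol_minus _ _ _ _ (Hol_scal (/ RtoC q)%C _ _ (Hol_minus _ _ _ _ (Hol_Wr nu mu F F' U U' HF
      (proj1 HU)) (Hol_Wr nu nu F F' K K' HF (proj1 HK)))) HG).
    eapply Hol_ext; [| |exact Y]; intro v; cbv beta.
    - unfold H, Cdiv. ring.
    - fold q. replace (nu ^ 2 - nu ^ 2) with 0 by ring. field. exact qC. }
  change (Cmod (H w) <= A * e).
  assert (RB : forall y, x <= y -> Cmod (F (RtoC y)) <= B1 * exp (exp y - y / 2) /\ Cmod (F' (RtoC y)) <= B1 *
    exp (exp y + y / 2)).
  { intros y Hy. assert (Q := HB1 y 0 Hy). rewrite Rabs_R0, cos_0 in Q. specialize (Q ltac:(lra)).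
    replace (RtoC y + 0 * Ci)%C with (RtoC y) in Q by ring. rewrite Rmult_1_r in Q. exact Q. }
  (* On the axis the growth e^(e^s) of F is matched by the decay e^(-e^s) in the Lipschitz bound for
     K, leaving the integrable e^(-s). *)
  assert (RH : forall y, x <= y -> Cmod (H (RtoC y) - H (RtoC x))%C <= B1 * l1 * e).
  { intros y Hy. apply Rle_trans with (- (B1 * l1 * e) * exp (- y) - - (B1 * l1 * e) * exp (- x)).
    - apply (curve_mvt (fun s => H (RtoC s)) (fun s => F (RtoC s) * (U (RtoC s) - K (RtoC s)))%C (fun s => -
        (B1 * l1 * e) * exp (- s)) (fun s => (B1 * l1 * e) * exp (- s))); auto.
      + intros s _. apply (cder_Hol_R H _ s HH).
      + intros s _. auto_derive; auto; ring.
      + intros s Hs. destruct (proj2 HK s) as [K1 _], (proj2 HU s) as [U1 _].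
        rewrite K1, U1, <- RtoC_minus, Cmod_mult, Cmod_R.
        destruct (RB s ltac:(lra)) as [F1 _]. assert (Q := Hl1 mu nu s Mmu Mnu ltac:(lra)). fold e in Q.
        apply Rle_trans with (B1 * exp (exp s - s / 2) * (e * (l1 * (exp (- s) * exp (- exp s))))).
        * apply Rmult_le_compat; auto using Cmod_ge_0, Rabs_pos.
        * replace (B1 * exp (exp s - s / 2) * (e * (l1 * (exp (- s) * exp (- exp s))))) with ((B1 * l1 * e *
            exp (- s)) * (exp (exp s - s / 2) * exp (- exp s))) by ring.
          rewrite <- exp_plus. rewrite <- (Rmult_1_r (B1 * l1 * e * exp (- s))) at 2. apply Rmult_le_compat_l.
          -- apply Rmult_le_pos; [apply Rmult_le_pos; [now apply Rmult_le_pos | lra] | apply Rlt_le, exp_pos].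
          -- rewrite <- exp_0. apply exp_le. lra.
    - assert (0 <= B1 * l1 * e) by (apply Rmult_le_pos; [now apply Rmult_le_pos | lra]).
      assert (exp (- x) <= 1) by (rewrite <- exp_0; apply exp_le; lra). generalize (exp_pos (- y)); nra. }
  (* This bound is not small in |mu - nu|, but it shows that H vanishes at infinity, which turns the
     estimate of its increments into one of H itself. *)
  assert (RE : forall y, x <= y -> Cmod (H (RtoC y)) <= (B1 * (l1 + l2) / nu + C0) * exp (- (y / 2))).
  { intros y Hy. unfold H. eapply Rle_trans; [apply Cmod_minus_le|]. rewrite Rmult_plus_distr_r.
    apply Rplus_le_compat; [|apply HGi, Hy].
    destruct (proj2 HK y) as [K1 K2], (proj2 HU y) as [U1 U2]. destruct (RB y Hy) as [F1 F2].
    assert (Q1 := Hl1 mu nu y Mmu Mnu ltac:(lra)). assert (Q2 := Hl2 mu nu y Mmu Mnu ltac:(lra)).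
    fold e in Q1, Q2.
    rewrite Cmod_div, Cmod_R by auto.
    assert (qe : nu * e <= Rabs q).
    { unfold q. replace (mu ^ 2 - nu ^ 2) with ((mu + nu) * (mu - nu)) by ring. rewrite Rabs_mult. fold e.
      apply Rmult_le_compat_r; [lra|]. rewrite Rabs_pos_eq; lra. }
    assert (Nm : Cmod (Wr F F' U U' (RtoC y) - Wr F F' K K' (RtoC y))%C <= e * (B1 * (l1 + l2) * exp (- (y /
      2)))).
    { unfold Wr. rewrite K1, K2, U1, U2.
      replace (F y * dkw mu y - F' y * kw mu y - (F y * dkw nu y - F' y * kw nu y))%C with
        (F y * RtoC (dkw mu y - dkw nu y) - F' y * RtoC (kw mu y - kw nu y))%C by (rewrite !RtoC_minus; ring).
      eapply Rle_trans; [apply Cmod_minus_le|]. rewrite !Cmod_mult, !Cmod_R.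
      assert (X1 : Cmod (F y) * Rabs (dkw mu y - dkw nu y) <= B1 * exp (exp y - y / 2) * (e * (l2 * exp (- exp
        y)))) by (apply Rmult_le_compat; auto using Cmod_ge_0, Rabs_pos).
      assert (X2 : Cmod (F' y) * Rabs (kw mu y - kw nu y) <= B1 * exp (exp y + y / 2) * (e * (l1 * (exp (- y) *
        exp (- exp y))))) by (apply Rmult_le_compat; auto using Cmod_ge_0, Rabs_pos).
      replace (B1 * exp (exp y - y / 2) * (e * (l2 * exp (- exp y)))) with (e * (B1 * l2 * exp (- (y / 2)))) in
        X1.
      2: { replace (exp (- (y / 2))) with (exp (exp y - y / 2) * exp (- exp y)) by (rewrite <- exp_plus;
             f_equal; ring). ring. }
      replace (B1 * exp (exp y + y / 2) * (e * (l1 * (exp (- y) * exp (- exp y))))) with (e * (B1 * l1 * exp (-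
        (y / 2)))) in X2.
      2: { replace (exp (- (y / 2))) with (exp (exp y + y / 2) * (exp (- y) * exp (- exp y))) by (rewrite <-
             !exp_plus; f_equal; field). ring. }
      lra. }
    assert (aq : 0 < Rabs q) by now apply Rabs_pos_lt.
    apply Rmult_le_reg_r with (Rabs q); auto.
    unfold Rdiv at 1. rewrite Rmult_assoc, Rinv_l, Rmult_1_r by lra. eapply Rle_trans; [exact Nm|].
    replace (e * (B1 * (l1 + l2) * exp (- (y / 2)))) with (B1 * (l1 + l2) / nu * exp (- (y / 2)) * (nu * e)) by
      (field; lra).
    apply Rmult_le_compat_l; auto. apply Rmult_le_pos; [|apply Rlt_le, exp_pos].
    apply Rmult_le_pos; [apply Rmult_le_pos; lra | apply Rlt_le, Rinv_0_lt_compat; lra]. }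
  assert (Hx : Cmod (H (RtoC x)) <= B1 * l1 * e).
  { apply le_epsilon. intros eps He. set (Cc := B1 * (l1 + l2) / nu + C0) in *.
    assert (Cc0 : 0 <= Cc).
    { unfold Cc. apply Rplus_le_le_0_compat; auto.
      apply Rmult_le_pos; [apply Rmult_le_pos; lra | apply Rlt_le, Rinv_0_lt_compat; lra]. }
    destruct (exp_half_small (eps / (Cc + 1))) as [X HX]; [apply Rdiv_lt_0_compat; lra|].
    set (y := Rmax X x). assert (y1 : X <= y) by apply Rmax_l. assert (y2 : x <= y) by apply Rmax_r.
    eapply Rle_trans; [apply (Cmod_le_minus _ (H (RtoC y)))|]. rewrite Cmod_minus_sym.
    assert (Q1 := RE y y2). assert (Q2 := RH y y2). assert (Q3 := HX y y1).
    assert (Q4 : Cc * exp (- (y / 2)) <= eps).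
    { apply Rle_trans with (Cc * (eps / (Cc + 1))); [apply Rmult_le_compat_l; auto|].
      apply Rmult_le_reg_r with (Cc + 1); [lra|]. field_simplify; [|lra]. nra. }
    lra. }
  assert (Hs : Cmod (H w - H (RtoC x))%C <= B2 * A1 * Cmod k * e).
  { set (Q := B2 * A1 * Cmod k * e).
    replace (H w - H (RtoC x))%C with (H (RtoC x + RtoC 1 * k) - H (RtoC x + RtoC 0 * k))%C by (unfold k;
      do 2 f_equal; f_equal; ring).
    apply Rle_trans with (Q * 1 - Q * 0); [|lra].
    apply (curve_mvt (fun s => H (RtoC x + RtoC s * k)%C) (fun s => F (RtoC x + RtoC s * k) * (U (RtoC x + RtoC
      s * k) - K (RtoC x + RtoC s * k)) * k)%C (fun s => Q * s) (fun _ => Q)); try lra.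
    - intros s _. apply (cder_Hol_line H _ (RtoC x) k s HH).
    - intros s _. auto_derive; auto; ring.
    - intros s Hs. rewrite !Cmod_mult.
      assert (Q1 := HB2 _ (Hr s Hs)). assert (Q2 := HL mu U U' Hmu HU s Hs). fold e in Q2.
      unfold Q. replace (B2 * A1 * Cmod k * e) with (B2 * (A1 * e) * Cmod k) by ring.
      apply Rmult_le_compat_r; [apply Cmod_ge_0|]. apply Rmult_le_compat; auto using Cmod_ge_0. }
  eapply Rle_trans; [apply (Cmod_le_minus _ (H (RtoC x)))|]. unfold A. lra.
Qed.

Lemma primitive_at_infinity g g1 B s0 : Hol g g1 -> 0 <= B ->
  (forall x y, s0 <= x -> Rabs y <= 1 -> Cmod (g (RtoC x + RtoC y * Ci)%C) <= B * exp (- (x / 2))) ->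
  exists G, Hol G g /\ forall x y, s0 <= x -> Rabs y <= 1 -> Cmod (G (RtoC x + RtoC y * Ci)%C) <= 3 * B * exp
    (- (x / 2)).
Proof.
  intros Hg B0 HB. destruct (Hol_primitive g g1 Hg) as [G HG].
  destruct (limit_in_sector G g B s0 HG B0 HB) as [L HL].
  exists (fun w => G w - L)%C. split; auto.
  eapply Hol_ext_r; [|apply (Hol_minus _ _ _ _ HG (Hol_const L))]. intro w; cbv beta; ring.
Qed.

(** The factors e^t from I and e^(-t) from K cancel in modulus, leaving |t|^(-1/2). *)
Lemma IK_sector nu K K' : 0 < nu -> IsK nu K K' -> exists B, 0 <= B /\ forall x y, sz nu <= x -> Rabs y <= 1 ->
  Cmod (BI nu (RtoC x + RtoC y * Ci) * K (RtoC x + RtoC y * Ci))%C <= B * exp (- (x / 2)).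
Proof.
  intros H0 HK. destruct (sector_growth nu _ _ (Sol_BI nu (Rlt_le _ _ H0))) as [B1 [B10 H1]].
  destruct (sector_decay nu K K' HK) as [B2 [B20 H2]].
  exists (B1 * B2). split; [now apply Rmult_le_pos|]. intros x y Hx Hy.
  destruct (H1 x y Hx Hy) as [Q1 _]. assert (Q2 := H2 x y Hx Hy). rewrite Cmod_mult.
  eapply Rle_trans; [apply Rmult_le_compat; eauto using Cmod_ge_0|]. right.
  replace (exp (- (x / 2))) with (exp (exp x * cos y - x / 2) * exp (- (exp x * cos y))) by (rewrite <-
    exp_plus; f_equal; ring).
  ring.
Qed.

(** In the sector cos y >= 1 - y^2/2 >= 1/2, so K^2 decays at least like e^(-|t|); the weaker rate
    is the one shared with I K. *)
Lemma KK_sector nu K K' : IsK nu K K' -> exists B, 0 <= B /\ forall x y, sz nu <= x -> Rabs y <= 1 ->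
  Cmod (K (RtoC x + RtoC y * Ci) * K (RtoC x + RtoC y * Ci))%C <= B * exp (- (x / 2)).
Proof.
  intros HK. destruct (sector_decay nu K K' HK) as [B2 [B20 H2]].
  exists (B2 * B2). split; [now apply Rmult_le_pos|]. intros x y Hx Hy.
  assert (Q2 := H2 x y Hx Hy). rewrite Cmod_mult.
  eapply Rle_trans; [apply Rmult_le_compat; eauto using Cmod_ge_0|].
  replace (B2 * exp (- (exp x * cos y)) * (B2 * exp (- (exp x * cos y)))) with (B2 * B2 * (exp (- (exp x * cos
    y)) * exp (- (exp x * cos y)))) by ring.
  apply Rmult_le_compat_l; [now apply Rmult_le_pos|]. rewrite <- exp_plus. apply exp_le.
  assert (C1 := cos_ge_quad y). assert (Y2 : y ^ 2 <= 1).
  { rewrite <- (pow2_abs y). generalize (Rabs_pos y); nra. }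
  assert (x1 : 1 <= x) by (unfold sz in Hx; generalize (Rabs_pos (nu ^ 2 - / 4)); lra).
  assert (ex := exp_ineq1_le x). nra.
Qed.

Lemma is_derive_of_quadratic (f : R -> C) (D : C) x A :
  locally x (fun y => Cmod (f y - f x - RtoC (y - x) * D)%C <= A * (y - x) ^ 2) ->
  is_derive (K := R_AbsRing) (V := C_R_NormedModule) f x D.
Proof.
  intros H.
  assert (E : forall pr : C -> R, (forall a, Rabs (pr a) <= Cmod a) -> (forall a b,
    pr (a - b)%C = pr a - pr b) ->
     (forall r a, pr (RtoC r * a)%C = r * pr a) -> is_derive (fun y => pr (f y)) x (pr D)).
  { intros pr P1 P2 P3.
    apply (is_derive_squeeze _ (fun y => pr (f x) + (y - x) * pr D) (fun y => A * (y - x) ^ 2)).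
    - auto_derive; auto; ring.
    - ring.
    - auto_derive; auto; ring.
    - ring.
    - refine (filter_imp _ _ _ H). intros y Hy. eapply Rle_trans; [|exact Hy]. eapply Rle_trans; [|apply P1].
      right. f_equal. rewrite !P2, P3. ring. }
  apply is_derive_ext with (fun y => (fst (f y), snd (f y))); [intro y; symmetry; apply surjective_pairing|].
  rewrite (surjective_pairing D).
  apply (is_derive_pair (fun y => fst (f y)) (fun y => snd (f y))).
  - apply (E fst); [apply Cmod_fst | reflexivity | intros; simpl; ring].
  - apply (E snd); [apply Cmod_snd | reflexivity | intros; simpl; ring].
Qed.

Lemma K_expansion nu K K' G1 G2 B1 B2 w : 0 < nu -> IsK nu K K' ->
  Hol G1 (fun v => BI nu v * K v)%C -> Hol G2 (fun v => K v * K v)%C -> 0 <= B1 -> 0 <= B2 ->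
  (forall x : R, sz nu <= x -> Cmod (G1 (RtoC x)) <= B1 * exp (- (x / 2))) ->
  (forall x : R, sz nu <= x -> Cmod (G2 (RtoC x)) <= B2 * exp (- (x / 2))) ->
  exists A d, 0 < d /\ forall mu U U', Rabs (mu - nu) < d -> IsK mu U U' ->
    Cmod (U w - K w - RtoC (mu - nu) * (RtoC (2 * nu) * (BI nu w * G2 w - K w * G1 w)))%C <= A * (mu - nu) ^ 2.
Proof.
  intros H0 HK HG1 HG2 B10 B20 L1 L2. assert (HI := Sol_BI nu (Rlt_le _ _ H0)).
  destruct (Wr_quotient nu K K' (BI nu) (dBI nu) G1 B1 w H0 HK HI HG1 B10 L1) as [A1 [d1 [A10 [d10 Q1]]]].
  destruct (Wr_quotient nu K K' K K' G2 B2 w H0 HK (proj1 HK) HG2 B20 L2) as [A2 [d2 [A20 [d20 Q2]]]].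
  set (P := (BI nu w * G2 w - K w * G1 w)%C).
  set (A := (2 * nu + 1) * (Cmod (K w) * A1 + Cmod (BI nu w) * A2) + Cmod P).
  exists A, (Rmin nu (Rmin 1 (Rmin d1 d2))). split; [repeat apply Rmin_pos; lra|]. intros mu U U' Hmu' HU.
  assert (Hmn : Rabs (mu - nu) < nu) by (eapply Rlt_le_trans; [exact Hmu' | apply Rmin_l]).
  apply Rabs_def2 in Hmn.
  assert (Hmu : Rabs (mu - nu) < Rmin 1 (Rmin d1 d2)) by (eapply Rlt_le_trans; [exact Hmu' | apply Rmin_r]).
  assert (M0 : Rabs (mu - nu) < 1) by (eapply Rlt_le_trans; [exact Hmu | apply Rmin_l]).
  assert (M1 : Rabs (mu - nu) < d1) by (eapply Rlt_le_trans; [exact Hmu | eapply Rle_trans;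
    [apply Rmin_r | apply Rmin_l]]).
  assert (M2 : Rabs (mu - nu) < d2) by (eapply Rlt_le_trans; [exact Hmu | eapply Rle_trans;
    [apply Rmin_r | apply Rmin_r]]).
  assert (W1 : forall v, Wr K K' (BI nu) (dBI nu) v = 1%C) by (intro v; apply (Wr_K_I nu); auto).
  (* At mu = nu the quotient by mu^2 - nu^2 is meaningless; there the left side vanishes by
     uniqueness. *)
  destruct (Req_dec mu nu) as [->|Hne].
  { rewrite (IsK_unique nu K K' U U' w H0 HK HU).
    replace (nu - nu) with 0 by ring. replace (K w - K w - 0 * (RtoC (2 * nu) * P))%C with (RtoC 0) by ring.
    rewrite Cmod_0. right; ring. }
  specialize (Q1 mu U U' Hne M1 HU). specialize (Q2 mu U U' Hne M2 HU).
  set (q := mu ^ 2 - nu ^ 2) in *. set (e := Rabs (mu - nu)) in *.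
  set (H1 := ((Wr (BI nu) (dBI nu) U U' w - Wr (BI nu) (dBI nu) K K' w) / RtoC q - G1 w)%C) in *.
  set (H2 := ((Wr K K' U U' w - Wr K K' K K' w) / RtoC q - G2 w)%C) in *.
  assert (qe : Rabs q <= (2 * nu + 1) * e) by (apply sq_diff_bound; auto; fold e; lra).
  assert (q0 : q <> 0).
  { unfold q. replace (mu ^ 2 - nu ^ 2) with ((mu + nu) * (mu - nu)) by ring.
    apply Rmult_integral_contrapositive_currified; lra. }
  assert (qC : RtoC q <> 0%C) by now apply RtoC_neq_0.
  assert (I1 := K_I_identity K K' (BI nu) (dBI nu) U U' w (W1 w)).
  assert (I2 := K_I_identity K K' (BI nu) (dBI nu) K K' w (W1 w)).
  assert (E1 : Wr (BI nu) (dBI nu) U U' w = (Wr (BI nu) (dBI nu) K K' w + RtoC q * (H1 + G1 w))%C) by (unfold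
    H1; field; auto).
  assert (E2 : Wr K K' U U' w = (Wr K K' K K' w + RtoC q * (H2 + G2 w))%C) by (unfold H2; field; auto).
  assert (Ed : (U w - K w = RtoC q * (P + (BI nu w * H2 - K w * H1)))%C).
  { transitivity ((- K w * Wr (BI nu) (dBI nu) U U' w + BI nu w * Wr K K' U U' w)
           - (- K w * Wr (BI nu) (dBI nu) K K' w + BI nu w * Wr K K' K K' w))%C; [rewrite <- I1, <- I2;
               reflexivity|].
    rewrite E1, E2. unfold P. ring. }
  (* Since mu^2 - nu^2 = 2 nu (mu - nu) + (mu - nu)^2, replacing the first by the linear term leaves
     the error (mu - nu)^2 P. *)
  replace (U w - K w - RtoC (mu - nu) * (RtoC (2 * nu) * P))%C with
    (RtoC q * (BI nu w * H2 - K w * H1) + RtoC ((mu - nu) ^ 2) * P)%C.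
  2: { rewrite Ed. replace ((mu - nu) ^ 2) with (q - (mu - nu) * (2 * nu)) by (unfold q; ring).
       rewrite RtoC_minus, (RtoC_mult (mu - nu)). ring. }
  eapply Rle_trans; [apply Cmod_triangle|]. rewrite !Cmod_mult, !Cmod_R.
  rewrite (Rabs_pos_eq ((mu - nu) ^ 2)) by apply pow2_ge_0. rewrite <- (pow2_abs (mu - nu)). fold e.
  assert (e0 : 0 <= e) by apply Rabs_pos.
  assert (X : Cmod (BI nu w * H2 - K w * H1)%C <= (Cmod (K w) * A1 + Cmod (BI nu w) * A2) * e).
  { eapply Rle_trans; [apply Cmod_minus_le|]. rewrite !Cmod_mult.
    assert (Cmod (BI nu w) * Cmod H2 <= Cmod (BI nu w) * (A2 * e)) by (apply Rmult_le_compat_l;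
      auto using Cmod_ge_0).
    assert (Cmod (K w) * Cmod H1 <= Cmod (K w) * (A1 * e)) by (apply Rmult_le_compat_l; auto using Cmod_ge_0).
    lra. }
  assert (Y : Rabs q * Cmod (BI nu w * H2 - K w * H1)%C <= ((2 * nu + 1) * e) * ((Cmod (K w) * A1 + Cmod (BI nu
    w) * A2) * e))
    by (apply Rmult_le_compat; auto using Cmod_ge_0, Rabs_pos).
  unfold A. lra.
Qed.

Theorem theorem8 (nu : R) (z : C) (theta : R)
  (hnu : 0 < nu) (hz : z <> 0%C)
  (htheta : Rabs theta <= PI) (harg : is_arg z theta) :
  exists J1 J2 : C,
    is_int_to_infty (fun t a => (BesselI nu t a * BesselK nu t a / t)%C) z theta J1 /\
    is_int_to_infty (fun t a => (BesselK nu t a ^ 2 / t)%C) z theta J2 /\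
    is_derive (K := R_AbsRing) (V := C_R_NormedModule)
      (fun mu : R => BesselK mu z theta) nu
      (RtoC (2 * nu) * (BesselK nu z theta * J1 - BesselI nu z theta * J2))%C.
Proof.
  destruct (IsK_exists nu (Rlt_le _ _ hnu)) as [K [K' HK]].
  assert (HI := Sol_BI nu (Rlt_le _ _ hnu)).
  assert (Hg1 := Hol_mult _ _ _ _ (proj1 HI) (proj1 (proj1 HK))).
  assert (Hg2 := Hol_mult _ _ _ _ (proj1 (proj1 HK)) (proj1 (proj1 HK))).
  destruct (IK_sector nu K K' hnu HK) as [B1 [B10 HB1]]. destruct (KK_sector nu K K' HK) as [B2 [B20 HB2]].
  destruct (primitive_at_infinity _ _ B1 (sz nu) Hg1 B10 HB1) as [G1 [HG1 L1]].
  destruct (primitive_at_infinity _ _ B2 (sz nu) Hg2 B20 HB2) as [G2 [HG2 L2]].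
  set (w := clog z theta).
  assert (EI : forall (r : C) (a : R), r <> 0%C -> is_arg r a -> BesselI nu r a = BI nu (clog r a)).
  { intros r a Hr Ha. assert (E := BesselI_eq nu (clog r a) (nonpole_pos nu (Rlt_le _ _ hnu))).
    rewrite cexp_clog in E by auto. exact E. }
  assert (EK : forall mu U U' (r : C) (a : R),
    0 < mu -> IsK mu U U' -> r <> 0%C -> is_arg r a -> BesselK mu r a = U (clog r a)).
  { intros mu U U' r a Hmu HU Hr Ha. assert (E := BesselK_eq mu U U' (clog r a) Hmu HU).
    rewrite cexp_clog in E by auto. exact E. }
  (* The primitives vanish at infinity in the sector, so the integrals starting at w are minus their
     values at w; this reverses the signs of [K_expansion]. *)
  exists (- G1 w)%C, (- G2 w)%C. split; [|split].
  - apply (int_to_infty G1 _ _ _ z theta (3 * B1) (sz nu) HG1 Hg1); [lra | exact L1 |].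
    intros r a Hr Ha. cbv beta. rewrite EI, (EK nu K K') by auto. reflexivity.
  - apply (int_to_infty G2 _ _ _ z theta (3 * B2) (sz nu) HG2 Hg2); [lra | exact L2 |].
    intros r a Hr Ha. cbv beta. rewrite (EK nu K K') by auto. simpl Cpow. rewrite Cmult_1_r. reflexivity.
  - rewrite EI, (EK nu K K') by auto. fold w.
    assert (R0 : forall (G : C -> C) B, (forall x y,
      sz nu <= x -> Rabs y <= 1 -> Cmod (G (RtoC x + RtoC y * Ci)%C) <= B * exp (- (x / 2))) ->
      forall x : R, sz nu <= x -> Cmod (G (RtoC x)) <= B * exp (- (x / 2))).
    { intros G B HB x Hx. assert (Q := HB x 0 Hx). rewrite Rabs_R0 in Q. specialize (Q ltac:(lra)).
      replace (RtoC x + 0 * Ci)%C with (RtoC x) in Q by ring. exact Q. }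
    destruct (K_expansion nu K K' G1 G2 (3 * B1) (3 * B2) w hnu HK HG1 HG2 ltac:(lra) ltac:(lra) (R0 _ _ L1)
      (R0 _ _ L2)) as [A [d [d0 HE]]].
    replace (RtoC (2 * nu) * (K w * - G1 w - BI nu w * - G2 w))%C with (RtoC (2 * nu) * (BI nu w * G2 w - K w *
      G1 w))%C by ring.
    apply (is_derive_of_quadratic _ _ _ A).
    (* Within distance nu the order mu stays positive, where [EK] identifies [BesselK mu]. *)
    assert (dd : 0 < Rmin d nu) by (apply Rmin_pos; auto). exists (mkposreal _ dd). intros mu Hmu.
    assert (Hmu' : Rabs (mu - nu) < Rmin d nu) by exact Hmu.
    assert (M1 : Rabs (mu - nu) < d) by (eapply Rlt_le_trans; [exact Hmu' | apply Rmin_l]).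
    assert (M2 : Rabs (mu - nu) < nu) by (eapply Rlt_le_trans; [exact Hmu' | apply Rmin_r]).
    apply Rabs_def2 in M2.
    assert (mu0 : 0 < mu) by lra.
    destruct (IsK_exists mu (Rlt_le _ _ mu0)) as [U [U' HU]].
    rewrite (EK mu U U'), (EK nu K K') by auto. apply (HE mu U U' M1 HU).
Qed.
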